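(* There exist universal numerical constants $C>0$ and $C_{\mathrm{abs}}\ge 1$ such that the following holds. Let $T\ge 1$ be an integer, $0<\delta<1$, $d\ge 2$, $L\ge\mu>0$, $\sigma>0$, and let the deterministic initial point satisfy $x_0\neq x^*$. Suppose that $f$ is $L$-smooth and $\mu$-strongly convex; that for almost every $\xi$ the function $f(\cdot;\xi)$ is $L$-smooth, $(x,\xi)\mapsto\nabla f(x;\xi)$ is jointly measurable, and $\mathbb{E}_\xi[\nabla f(x;\xi)]=\nabla f(x)$ for all $x\in\mathbb{R}^d$; and that $$\mathbb{E}_\xi\big[\exp(\lambda\|\nabla f(x)-\nabla f(x;\xi)\|^2)\big]\le \exp(\lambda\sigma^2)\qquad\text{for all }x\in\mathbb{R}^d,\ \lambda\in(0,\sigma^{-2}).$$ Run the same-sample two-point Gaussian zeroth-order SGD algorithm (described in the context) for $T$ iterations from $x_0$, using the same sample $\xi_t$ in both function evaluations at iteration $t$. With $T_0,\Lambda,\Gamma_T(\delta),c_\delta,\Theta_T,\Delta_0$ and $c_\rho=2\exp\big(\tfrac{2C}{T_0}\Gamma_T(\delta)\big)$ as in the context, define $$ \mathcal{C}:=\max\Big\{\frac{8c_\rho T_0\Delta_0}{d\Theta_T},\ \frac{C_{\mathrm{abs}}L\sigma^2c_\rho^2}{\mu^2}\Big(1+\frac{c_\delta}{T_0}\Big),\ \frac{C_{\mathrm{abs}}Lc_\rho\sigma^2}{\mu^2\Gamma_T(\delta)}\Big(1+\frac{dc_\delta}{T_0}\Big),\ \frac{C_{\mathrm{abs}}c_\rho(1+c_\delta)}{\Gamma_T(\delta)}\Big(1+\frac{L^2}{\mu}+\frac{L^3}{\mu^2}\Big)\Big\},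 $$ and, for $0\le K\le T$, the event $$\mathcal{E}_{\Delta_K}:=\Big\{f(x_k)-f(x^* )\le\frac{\mathcal{C}\,d\,\Theta_T}{k+T_0}\ \text{ for all }k=0,\dots,K\Big\}.$$ Then, with probability at least $1-\delta$, the events $\mathcal{E}_{\Delta_K}$ hold simultaneously for all $K\le T$. In particular, on this event, $$ f(x_T)-f(x^* )\le \mathcal{C}\,\frac{d\,\Theta_T}{T+T_0} =\mathcal{O}\Big(\frac{c_\rho T_0\Delta_0}{T+T_0}+c_\rho^2\,\frac{d\Lambda\Gamma_T(\delta)}{T+T_0}\Big(1+\frac{\Gamma_T(\delta)}{T_0}\Big)\Big), $$ where the implicit constant in $\mathcal{O}$ depends only on universal numerical constants and on the fixed problem parameters $L,\mu,\sigma$.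
   Context: Problem: $f:\mathbb{R}^d\to\mathbb{R}$, $f(x)=\mathbb{E}_\xi[f(x;\xi)]$ for a random sample $\xi$; $\|\cdot\|$ is the Euclidean norm; $x^*$ is the unique minimizer of $f$. ''$f$ is $L$-smooth and $\mu$-strongly convex'' means $f$ is differentiable and $f(x)+\langle\nabla f(x),y-x\rangle+\frac{\mu}{2}\|y-x\|^2\le f(y)\le f(x)+\langle\nabla f(x),y-x\rangle+\frac{L}{2}\|y-x\|^2$ for all $x,y$. ''$f(\cdot;\xi)$ is $L$-smooth'' means it is differentiable with $L$-Lipschitz gradient (no convexity is assumed for $f(\cdot;\xi)$). Algorithm (same-sample two-point Gaussian zeroth-order SGD). Input: deterministic $x_0\in\mathbb{R}^d$ and horizon $T$. Set $T_0=32dL/\mu$ and $\alpha=1/\sqrt{d(T+T_0)}$. For $t=0,\dots,T-1$: draw $u_t\sim\mathcal{N}(0,I_d)$ and, independently, a fresh sample $\xi_t$ distributed as $\xi$ (both independent of the past); set $\eta_t=\frac{4d}{\mu(t+T_0)\|u_t\|^2}$ (and $\eta_t=0$ on the null event $u_t=0$); set $g_t=\frac{f(x_t+\alpha u_t;\xi_t)-f(x_t-\alpha u_t;\xi_t)}{2\alpha}\,u_t$; update $x_{t+1}=x_t-\eta_tg_t$. Output $x_T$. Notation: $\Lambda:=\log(T+T_0)$; $J_T:=1+\big\lceil\log_2\big(\tfrac{T(T+T_0)}{T_0}\big)\big\rceil$; $\Delta_0:=f(x_0)-f(x^* )$; $\Gamma_T(\delta):=1+\log\frac1\delta+\log J_T+\log(e+T_0)$;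 $c_\delta:=\Gamma_T(\delta)/\Lambda$; $\Theta_T:=\Lambda\,\Gamma_T(\delta)$. ''Universal numerical constant'' means an absolute constant independent of all other quantities. *)

(* Defs.v *)
From HB Require Import structures.
From mathcomp Require Import all_boot all_order all_algebra finmap.
From mathcomp Require Import all_classical all_reals all_analysis.

Set Implicit Arguments.
Unset Strict Implicit.
Unset Printing Implicit Defensive.

Import Order.TTheory GRing.Theory Num.Theory.
Import numFieldNormedType.Exports.

Local Open Scope classical_set_scope.
Local Open Scope ring_scope.

(* R^d is 'rV[R]_d. The norm `|x| of the library on this type is the sup norm;
   it defines the same topology, open sets and differentiability as the
   Euclidean norm enorm below, but it is not used in any quantitative bound. *)

Section euclidean.
Context {R : realType} {d : nat}.
Implicit Types (x y v : 'rV[R]_d) (h : 'rV[R]_d -> R).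

Definition dotp x y : R := \sum_(i < d) x 0 i * y 0 i.

Definition enorm x : R := Num.sqrt (dotp x x).

(* The vector representing the differential; only meaningful where h is
   differentiable. *)
Definition grad h x : 'rV[R]_d := \row_(i < d) 'd h x (delta_mx 0 i).

Definition smooth_strongly_convex (L mu : R) h : Prop :=
  (forall x, differentiable h x) /\
  forall x y,
    h x + dotp (grad h x) (y - x) + mu / 2 * enorm (y - x) ^+ 2 <= h y /\
    h y <= h x + dotp (grad h x) (y - x) + L / 2 * enorm (y - x) ^+ 2.

Definition lipschitz_gradient (L : R) h : Prop :=
  (forall x, differentiable h x) /\
  forall x y, enorm (grad h x - grad h y) <= L * enorm (x - y).

Definition unique_minimizer h x : Prop := forall y, y <> x -> h x < h y.

End euclidean.

Definition borel_rV_display : measure_display.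
Proof. exact. Qed.

Section borel_rV.
Context {R : realType} {d : nat}.

Let borel : set (set 'rV[R]_d) := <<s @open 'rV[R]_d >>.

Let borel0 : borel set0.
Proof. exact: sigma_algebra0. Qed.

Let borelC A : borel A -> borel (~` A).
Proof. exact: sigma_algebraC. Qed.

Let borel_bigcup (A : (set 'rV[R]_d)^nat) :
  (forall i, borel (A i)) -> borel (\bigcup_i (A i)).
Proof. exact: sigma_algebra_bigcup. Qed.

HB.instance Definition _ := @isMeasurable.Build borel_rV_display
  'rV[R]_d borel borel0 borelC borel_bigcup.

End borel_rV.

Section probability_notions.
Context {dW : measure_display} {W : measurableType dW} {R : realType}.
Variable P : probability W R.

(* Mutual independence of the set systems S i, i \in D: the product rule for
   every finite subfamily. *)
Definition mutually_independent {I : choiceType} (D : set I)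
    (S : I -> set (set W)) : Prop :=
  forall J : {fset I}, [set` J] `<=` D ->
  forall A : I -> set W, (forall i, i \in J -> S i (A i)) ->
  P (\bigcap_(i in [set` J]) A i) = (\prod_(i <- J) P (A i))%E.

Definition sigma_of {d'} {Y : measurableType d'} (X : W -> Y) : set (set W) :=
  preimage_set_system setT X measurable.

Definition has_mean (X : W -> R) (m : R) : Prop :=
  P.-integrable setT (EFin \o X) /\ 'E_P[X]%E = m%:E.

(* E need not be measurable itself: it is only required to contain a measurable
   set of probability at least p. *)
Definition with_prob_at_least (p : R) (E : set W) : Prop :=
  exists2 A : set W, measurable A /\ A `<=` E & (p%:E <= P A)%E.

End probability_notions.

(* N(0, I_d), i.e. the d-fold product of N(0, 1), determined by its values on
   measurable boxes. *)
Definition std_gaussian_law {R : realType} {d : nat}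
    (nu : set 'rV[R]_d -> \bar R) : Prop :=
  forall A : 'I_d -> set R, (forall i, measurable (A i)) ->
  nu [set v | forall i, A i (v 0 i)] = (\prod_(i < d) normal_prob 0 1 (A i))%E.

Section algorithm.
Context {R : realType}.

Definition T0 (d : nat) (L mu : R) : R := 32 * d%:R * L / mu.

Definition smoothing_radius (d : nat) (t0 : R) (T : nat) : R :=
  (Num.sqrt (d%:R * (T%:R + t0)))^-1.

(* Since 0^-1 = 0, the step size is 0 when v = 0. *)
Definition step_size (d : nat) (mu t0 : R) (t : nat) (v : 'rV[R]_d) : R :=
  4 * d%:R / (mu * (t%:R + t0) * enorm v ^+ 2).

Definition two_point_estimator (d : nat) (h : 'rV[R]_d -> R) (alpha : R)
    (x v : 'rV[R]_d) : 'rV[R]_d :=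
  ((h (x + alpha *: v) - h (x - alpha *: v)) / (2 * alpha)) *: v.

(* The iterate x_t along one realization u, xi of the directions and samples. *)
Fixpoint zo_sgd (d : nat) (Xi : Type) (F : 'rV[R]_d -> Xi -> R)
    (mu t0 alpha : R) (x0 : 'rV[R]_d) (u : nat -> 'rV[R]_d) (xi : nat -> Xi)
    (t : nat) : 'rV[R]_d :=
  if t is s.+1 then
    let x := zo_sgd F mu t0 alpha x0 u xi s in
    x - step_size mu t0 s (u s)
        *: two_point_estimator (F^~ (xi s)) alpha x (u s)
  else x0.

(* In the constants below, t0 stands for T_0. *)

Definition Lambda (T : nat) (t0 : R) : R := ln (T%:R + t0).

Definition JT (T : nat) (t0 : R) : R :=
  1 + (Num.ceil (ln (T%:R * (T%:R + t0) / t0) / ln 2))%:~R.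

Definition Gamma (T : nat) (t0 delta : R) : R :=
  1 + ln (delta^-1) + ln (JT T t0) + ln (expR 1 + t0).

Definition c_delta (T : nat) (t0 delta : R) : R :=
  Gamma T t0 delta / Lambda T t0.

Definition Theta (T : nat) (t0 delta : R) : R :=
  Lambda T t0 * Gamma T t0 delta.

Definition c_rho (C : R) (T : nat) (t0 delta : R) : R :=
  2 * expR (2 * C / t0 * Gamma T t0 delta).

Definition calC (C Cabs : R) (d T : nat) (L mu sigma delta Delta0 : R) : R :=
  let t0 := T0 d L mu in
  let G := Gamma T t0 delta in
  let cd := c_delta T t0 delta in
  let cr := c_rho C T t0 delta in
  Num.max (8 * cr * t0 * Delta0 / (d%:R * Theta T t0 delta))
  (Num.max (Cabs * L * sigma ^+ 2 * cr ^+ 2 / mu ^+ 2 * (1 + cd / t0))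
  (Num.max (Cabs * L * cr * sigma ^+ 2 / (mu ^+ 2 * G) * (1 + d%:R * cd / t0))
           (Cabs * cr * (1 + cd) / G
              * (1 + L ^+ 2 / mu + L ^+ 3 / mu ^+ 2)))).

End algorithm.

(* Main.v *)
Require Import Defs.
From HB Require Import structures.
From mathcomp Require Import all_boot all_order all_algebra finmap.
From mathcomp Require Import all_classical all_reals all_analysis.
From mathcomp Require Import perm measurable_realfun ring lra.

(** Write w = t + T0, D = f x_t - f xstar and a = 4d / (mu w). A step moves along
    u_t alone, so that only the components p and n of the gradient and of the
    noise along the unit vector u_t / |u_t| matter, and smoothness of f gives
      D' <= D - 3/4 a p^2 - a p n + 3/2 L a^2 n^2 + 5 a L^2 alpha^2 |u_t|^2
    (descent_step). On average p^2 is |grad f|^2 / d >= 2 mu D / d, which beats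
    the growth of the weight w in the scaled gap Z = w D. The centered term
    a p n is sub-Gaussian with a variance proportional to p^2, so a fraction of
    the drift pays for it. The other two terms have mean of order L a^2 sigma^2/d
    and a L^2 alpha^2 d, and their sums over time, after scaling, are of order
    (d L sigma^2 / mu^2) Lambda and d L^2 / mu.

    The potential is (B + Z)^q, written expR (q * ln (B + Z)), and not
    an exponential of Z: the drift and the variance of the noise are both of the
    order of the gap, and the slope q / (B + Z) of the logarithm keeps every
    exponent bounded whatever the gap is. The four terms of the descent
    inequality are separated by convexity of the exponential and integrated one
    by one (one_step_integral), hence the potential is a supermartingale up to
    the factors exp (growth t) (potential_step), whose product is at most
    exp (q/4).

    The Gaussian direction enters only through its symmetries. Reflections of
    the coordinates remove cross terms and swaps give the component along a
    fixed vector its share 1/d of the square; with crude bounds on the second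
    and fourth moments of N(0, 1), this yields the Laplace bound
    E exp (-k p^2) <= 1 - k |grad f|^2 / (4d) for k |grad f|^2 / d <= 1/120
    (gaussian_projection_laplace).

    To control all times at once, the iterate is frozen when Z exceeds the level
    M. At a fixed point Z only increases with t, so Z exceeds M at some time
    up to T if and only if it does so at time T for the frozen process, and
    Markov's inequality at time T replaces a union bound (sgd_uniform_bound).
    That the noise of step t is independent of x_t is proved along the recursion
    (chain_independent).

    The level is B + M = (B + T0 Delta0) exp (ln (1/delta) / q + 1/4). The range
    of the Laplace bound limits q to T0 / 1920, so q is the minimum of this and
    of Gamma, and delta^(-1/q) is at most e exp (1920 Gamma / T0), which is the
    origin of c_rho. *)

Set Implicit Arguments.
Unset Strict Implicit.
Unset Printing Implicit Defensive.

Import Order.TTheory GRing.Theory Num.Theory.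
Import numFieldNormedType.Exports.

Local Open Scope classical_set_scope.
Local Open Scope ring_scope.

(** * Borel sets and measurable maps on R^d *)

Section borel_rV_theory.
Context {R : realType} {d : nat}.
Implicit Types (A : 'I_d -> set R) (U : set 'rV[R]_d).

Definition box A : set 'rV[R]_d := [set v | forall i, A i (v 0 i)].

Definition boxes : set (set 'rV[R]_d) :=
  [set box A | A in [set A | forall i, measurable (A i)]].

Lemma open_measurable_rV U : open U -> measurable U.
Proof. by move=> oU; apply: sub_sigma_algebra. Qed.

Lemma continuous_measurable_rV (h : 'rV[R]_d -> R) :
  continuous h -> measurable_fun setT h.
Proof.
move=> hc; apply: (measurability _ (RGenOpens.measurableE R)).
move=> _ [_ [a [b ->]] <-]; rewrite setTI; apply: open_measurable_rV.
by apply: open_comp => [x _|]; [exact: hc|exact: interval_open].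
Qed.

Lemma measurable_coord (i : 'I_d) :
  measurable_fun setT (fun v : 'rV[R]_d => v 0 i).
Proof. by apply: continuous_measurable_rV; exact: coord_continuous. Qed.

Lemma box_measurable A : (forall i, measurable (A i)) -> measurable (box A).
Proof.
move=> mA; rewrite (_ : box A =
    \bigcap_(i in [set: 'I_d]) ((fun v : 'rV[R]_d => v 0 i) @^-1` A i)).
  apply: fin_bigcap_measurable => // i _.
  by rewrite -[_ @^-1` _]setTI; apply: measurable_coord.
by apply/seteqP; split=> [v Av i _|v Av i]; [exact: Av|exact: Av].
Qed.

Lemma boxes_setI_closed : setI_closed boxes.
Proof.
move=> _ _ [A mA <-] [B mB <-]; exists (fun i => A i `&` B i).
  by move=> i; apply: measurableI.
apply/seteqP; split=> [v AB|v [Av Bv] i]; last by split.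
by split=> i; have [] := AB i.
Qed.

(** An open set is the union of the boxes with rational vertices that it
    contains. This ties the Borel structure, in which maps are measurable, to
    the boxes, on which the Gaussian law is specified. *)
Lemma measurable_rVE : @measurable _ 'rV[R]_d = <<s boxes >>.
Proof.
apply/seteqP; split; last first.
  apply: smallest_sub; first exact: sigma_algebra_measurable.
  by move=> _ [A mA <-]; exact: box_measurable.
apply: smallest_sub; first exact: smallest_sigma_algebra.
move=> U oU.
pose q (z : {ffun 'I_d -> rat * rat}) : 'I_d -> set R :=
  fun i => `](ratr (z i).1), (ratr (z i).2)[%classic.
rewrite (_ : U = \bigcup_z (if pselect (box (q z) `<=` U) then box (q z)
                            else set0)); last first.
  apply/seteqP; split=> [v Uv|v [z _]]; last by case: pselect => // s /s.
  have [P Pv PU] : nbhs v U by apply: open_nbhs_nbhs.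
  have ex (i : 'I_d) : exists z : rat * rat,
      (v 0 i \in `](ratr z.1), (ratr z.2)[) /\
      forall y, y \in `](ratr z.1 : R), (ratr z.2)[ -> P 0 i y.
    have /nbhs_ballP[e /= e0 eP] := Pv 0 i.
    have /rat_in_itvoo[a] : v 0 i - e < v 0 i by rewrite ltrBlDr ltrDl.
    have /rat_in_itvoo[b] : v 0 i < v 0 i + e by rewrite ltrDl.
    rewrite !in_itv/= => /andP[vb be] /andP[ae av]; exists (a, b); split.
      by rewrite in_itv/= av vb.
    move=> y; rewrite in_itv/= => /andP[ay yb]; apply: eP.
    by rewrite /ball/= ltr_norml; apply/andP; split; lra.
  have [g gP] := choice ex.
  exists [ffun i => g i] => //=; case: pselect => [s|[]].
    by move=> i /=; rewrite /q ffunE; have [] := gP i.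
  move=> w wq; apply: PU => i j; rewrite ord1.
  by have [_] := gP j; apply; have := wq j; rewrite /q ffunE.
pose T := g_sigma_algebraType boxes.
apply: (@countable_bigcupT_measurable _ T) => [|z]; first exact: countableP.
case: pselect => [s|s]; last exact: (@measurable0 _ T).
by apply: sub_sigma_algebra; exists (q z) => //= i; exact: measurable_itv.
Qed.

Lemma measurable_fun_rV d' (T : measurableType d') (h : T -> 'rV[R]_d) :
  (forall i, measurable_fun setT (fun t => h t 0 i)) -> measurable_fun setT h.
Proof.
move=> mh; apply: (measurability _ measurable_rVE) => _ [_ [A mA <-] <-].
rewrite setTI (_ : _ @^-1` _ =
    \bigcap_(i in [set: 'I_d]) ((fun t => h t 0 i) @^-1` A i)).
  apply: fin_bigcap_measurable => // i _.
  by rewrite -[_ @^-1` _]setTI; apply: mh.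
by apply/seteqP; split=> [v Av i _|v Av i]; [exact: Av|exact: Av].
Qed.

Lemma measure_unique_boxes (m1 m2 : probability 'rV[R]_d R) :
  (forall A, (forall i, measurable (A i)) -> m1 (box A) = m2 (box A)) ->
  forall U, measurable U -> m1 U = m2 U.
Proof.
move=> m12; apply: (measure_unique boxes (fun=> setT)) => //.
- exact: measurable_rVE.
- exact: boxes_setI_closed.
- by move=> _; exists (fun=> setT) => //; apply/seteqP.
- by rewrite bigcup_const//; exists 0%N.
- by move=> _ [A mA <-]; exact: m12.
- by move=> _ /=; rewrite probability_setT ltry.
Qed.

Lemma measurable_addr d' (T : measurableType d') (g h : T -> 'rV[R]_d) :
  measurable_fun setT g -> measurable_fun setT h ->
  measurable_fun setT (fun t => g t + h t).
Proof.
move=> mg mh; apply: measurable_fun_rV => i.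
under eq_fun do rewrite mxE.
by apply: measurable_funD; apply: measurableT_comp (measurable_coord i) _.
Qed.

Lemma measurable_scaler d' (T : measurableType d') (c : T -> R)
    (h : T -> 'rV[R]_d) :
  measurable_fun setT c -> measurable_fun setT h ->
  measurable_fun setT (fun t => c t *: h t).
Proof.
move=> mc mh; apply: measurable_fun_rV => i.
under eq_fun do rewrite mxE.
by apply: measurable_funM => //; apply: measurableT_comp (measurable_coord i) _.
Qed.

Lemma measurable_dotp d' (T : measurableType d') (g h : T -> 'rV[R]_d) :
  measurable_fun setT g -> measurable_fun setT h ->
  measurable_fun setT (fun t => dotp (g t) (h t)).
Proof.
move=> mg mh; apply: measurable_sum => i.
by apply: measurable_funM; apply: measurableT_comp (measurable_coord i) _.
Qed.

End borel_rV_theory.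

(** * Joint measurability of Caratheodory functions *)

Section caratheodory.
Context {R : realType} {d : nat} {dX : measure_display} {X : measurableType dX}.

Definition grid (n : nat) (z : {ffun 'I_d -> int}) : 'rV[R]_d :=
  \row_i ((z i)%:~R / n.+1%:R).

Definition grid_index (n : nat) (v : 'rV[R]_d) : {ffun 'I_d -> int} :=
  [ffun i => Num.floor (v 0 i * n.+1%:R)].

Lemma grid_cvg (v : 'rV[R]_d) : grid n (grid_index n v) @[n --> \oo] --> v.
Proof.
move=> U [P Pv PU].
suff H : \forall n \near \oo, forall j, P 0 j (grid n (grid_index n v) 0 j).
  by apply: filterS H => n H; apply: PU => i j; rewrite ord1; exact: H.
apply: filter_forall => j; have := Pv 0 j; move: (P 0 j) => S.
suff : grid n (grid_index n v) 0 j @[n --> \oo] --> v 0 j by apply.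
apply/(@cvgrPdist_le _ R^o) => e e0; near=> n.
rewrite !mxE ffunE.
set x := v 0 j.
have n0 : 0 < n.+1%:R :> R by rewrite ltr0n.
have -> : x - (Num.floor (x * n.+1%:R))%:~R / n.+1%:R =
  (x * n.+1%:R - (Num.floor (x * n.+1%:R))%:~R) / n.+1%:R.
  by rewrite mulrBl mulfK ?gt_eqF.
have fl := floor_le (x * n.+1%:R).
have := floorD1_gt (x * n.+1%:R); rewrite intrD => fg.
rewrite ger0_norm; last by rewrite divr_ge0// subr_ge0.
apply: (@le_trans _ _ n.+1%:R^-1).
  by rewrite -[leRHS]mul1r ler_pM2r ?invr_gt0//; lra.
by near: n; apply: filterS (near_infty_natSinv_lt (PosNum e0)) => n /ltW.
Unshelve. all: by end_near. Qed.

(** A Caratheodory function is the pointwise limit of its values at the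
    nearest lower grid points, which range over a countable set. *)
Lemma measurable_caratheodory (h : 'rV[R]_d -> X -> R) :
  (forall x, measurable_fun setT (h x)) -> (forall s, continuous (h^~ s)) ->
  measurable_fun setT (fun p => h p.1 p.2).
Proof.
move=> mh ch.
apply: (@measurable_fun_cvg _ _ _ _
  (fun n (p : 'rV[R]_d * X) => h (grid n (grid_index n p.1)) p.2)).
  move=> n _ B mB; rewrite setTI.
  rewrite (_ : _ @^-1` _ = \bigcup_(z in [set: {ffun 'I_d -> int}])
    (box (fun i => [set r | Num.floor (r * n.+1%:R) = z i]) `*`
     (h (grid n z) @^-1` B))).
    apply: countable_bigcupT_measurable => [|z]; first exact: countableP.
    apply: measurableX.
      apply: box_measurable => i.
      rewrite (_ : mkset _ = `[(z i)%:~R / n.+1%:R, (z i + 1)%:~R / n.+1%:R[%classic).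
        exact: measurable_itv.
      apply/seteqP; split=> r /=; rewrite in_itv/=.
        by move=> <-; rewrite ler_pdivrMr// ltr_pdivlMr// floor_le floorD1_gt.
      by rewrite ler_pdivrMr// ltr_pdivlMr// => ?; apply: floor_def.
    by rewrite -[_ @^-1` _]setTI; apply: mh.
  apply/seteqP; split=> [[v s] /= Bvs|[v s] [z _] [/= vz]].
    by exists (grid_index n v) => //; split=> // i /=; rewrite ffunE.
  rewrite (_ : grid_index n v = z)//.
  by apply/ffunP => i; rewrite ffunE; exact: vz.
move=> [v s] _ /=.
by apply: (@continuous_cvg _ _ _ _ _ _ (h^~ s)); [exact: ch|exact: grid_cvg].
Qed.

End caratheodory.

(** * Elementary inequalities for the exponential *)

Section exponential_inequalities.
Context {R : realType}.
Implicit Types x y : R.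

Lemma expR_ge1DxDsq x : 0 <= x -> 1 + x + x ^+ 2 / 2 <= expR x.
Proof.
move=> x0; rewrite /expR.
have : series (exp_coeff x) 3%N <= limn (series (exp_coeff x)).
  apply: nondecreasing_cvgn_le; last exact: is_cvg_series_exp_coeff.
  by apply: nondecreasing_series => n _ _; apply: exp_coeff_ge0.
rewrite /series/= !big_nat_recr//= big_nil add0r /exp_coeff/=.
by rewrite expr0 expr1 divr1 divr1.
Qed.

Lemma expR_cosh_ge x : 0 <= x -> 2 + x ^+ 2 <= expR x + expR (- x).
Proof.
move=> x0; set t := x / 2.
have t0 : 0 <= t by rewrite divr_ge0.
have -> : x = t + t by rewrite /t; lra.
rewrite opprD !expRD expRN.
have et := expR_ge1DxDsq t0.
set a := expR t in et *.
have a0 : 0 < a by apply: expR_gt0.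
have a1 : a * a^-1 = 1 by rewrite mulfV// gt_eqF.
have s : 2 * t <= a - a^-1.
  rewrite -(ler_pM2r a0) mulrBl mulVf ?gt_eqF//.
  by nra.
have : (2 * t) ^+ 2 <= (a - a^-1) ^+ 2 by rewrite ler_sqr ?nnegrE; nra.
by nra.
Qed.

Lemma expRN_le x : 0 <= x -> expR (- x) <= 1 - x + x ^+ 2.
Proof.
move=> x0; rewrite expRN invf_ple ?posrE ?expR_gt0//; last by nra.
apply: le_trans (expR_ge1Dx x).
have q0 : 0 < 1 - x + x ^+ 2 by nra.
rewrite -(ler_pM2r q0) mulVf ?gt_eqF//.
have -> : (1 + x) * (1 - x + x ^+ 2) = 1 + x ^+ 3 by ring.
by rewrite lerDl exprn_ge0.
Qed.

(** The standard proof that centering turns an exponential moment of the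
    square into sub-Gaussian behaviour uses e^x <= x + e^(x^2); the factor 2
    makes the inequality elementary. *)
Lemma expR_le_centered x : expR x <= x + expR (2 * x ^+ 2).
Proof.
have e2 := expR_ge1Dx (2 * x ^+ 2).
have [x0|x0] := leP x 0.
  have : expR x <= 1 + x + x ^+ 2.
    have /expRN_le : 0 <= - x by rewrite oppr_ge0.
    by rewrite opprK sqrrN.
  by nra.
have [x1|x1] := leP (1 / 2) x.
  apply: (@le_trans _ _ (expR (2 * x ^+ 2))); last by lra.
  by rewrite ler_expR; nra.
have : expR x <= (1 - x)^-1.
  rewrite -[x in expR x]opprK expRN lef_pV2 ?posrE ?expR_gt0//; last by lra.
  exact: expR_ge1Dx.
have : (1 - x)^-1 <= 1 + x + 2 * x ^+ 2.
  have q0 : 0 < 1 - x by lra.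
  rewrite -(ler_pM2r q0) mulVf ?gt_eqF//.
  by nra.
by lra.
Qed.

Lemma expR_chord k x : 0 <= x <= 1 -> expR (k * x) <= 1 + x * (expR k - 1).
Proof.
move=> /andP[x0 x1].
have := @convex_expR R (Itv01 x0 x1) k 0.
rewrite !convRE/= mulr0 addr0 expR0 mulrC => /le_trans; apply.
by rewrite /unstable.onem; lra.
Qed.

End exponential_inequalities.

(** * Moments of the standard normal law *)

Section normal_moments.
Context {R : realType}.
Notation mu := (@lebesgue_measure R).
Notation N01 := (@normal_prob R 0 1).

Lemma ge0_integral_normal_prob (m s : R) (g : R -> \bar R) :
  measurable_fun setT g -> (forall x, 0 <= g x)%E ->
  (\int[normal_prob m s]_x g x =
   \int[mu]_x (g x * (normal_pdf m s x)%:E))%E.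
Proof.
move=> mg g0.
have dom := @normal_prob_dominates R m s.
rewrite -(Radon_Nikodym_SigmaFinite.change_of_variables dom)//.
apply: ae_eq_integral => //.
- apply: emeasurable_funM => //.
  exact: measurable_int (Radon_Nikodym_SigmaFinite.f_integrable _).
- apply: emeasurable_funM => //; apply/measurable_EFinP.
  exact: measurable_normal_pdf.
- apply: ae_eqe_mul2l; apply: integral_ae_eq => //.
  + exact: Radon_Nikodym_SigmaFinite.f_integrable.
  + by apply/measurable_EFinP; exact: measurable_normal_pdf.
  + by move=> E _ mE; rewrite -Radon_Nikodym_SigmaFinite.f_integral.
Qed.

(** The density of N(0, 1) times exp(s x^2) is a multiple of the density of
    N(0, 1/(1 - 2s)), which integrates to 1. *)
Lemma normal_expR_sqr (s : R) : s < 1 / 2 ->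
  (\int[N01]_x (expR (s * x ^+ 2))%:E = ((Num.sqrt (1 - 2 * s))^-1)%:E)%E.
Proof.
move=> s2; set r := 1 - 2 * s.
have r0 : 0 < r by rewrite /r; lra.
set t := (Num.sqrt r)^-1.
have t0 : 0 < t by rewrite invr_gt0 sqrtr_gt0.
have t2 : t ^+ 2 = r^-1 by rewrite exprVn sqr_sqrtr// ltW.
rewrite ge0_integral_normal_prob; last 2 first.
- apply/measurable_EFinP; apply: measurableT_comp => //.
  by apply: measurable_funM => //; exact: measurable_funX.
- by move=> x; rewrite lee_fin expR_ge0.
transitivity (\int[mu]_x (t%:E * (normal_pdf 0 t x)%:E))%E.
  apply: eq_integral => x _; rewrite -!EFinM !normal_pdfE ?gt_eqF//; congr EFin.
  have -> : normal_peak t = t^-1 * normal_peak 1 :> R.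
    rewrite /normal_peak -mulrnAr sqrtrM ?sqr_ge0// sqrtr_sqr gtr0_norm//.
    by rewrite invfM expr1n mul1r.
  rewrite -[in RHS]mulrA mulVKf ?gt_eqF// mulrCA; congr (_ * _).
  rewrite /normal_fun -expRD; congr expR; rewrite !subr0 expr1n t2.
  by rewrite /r; field; lra.
rewrite ge0_integralZl//.
- by rewrite integral_normal_pdf mule1.
- by apply/measurable_EFinP; exact: measurable_normal_pdf.
- by move=> x _; rewrite lee_fin normal_pdf_ge0.
- by rewrite lee_fin ltW.
Qed.

Lemma invr_sqrt_le (a b : R) : 0 < a -> 0 < b -> 1 <= a * b ^+ 2 ->
  (Num.sqrt a)^-1 <= b.
Proof.
move=> a0 b0 ab; rewrite invf_ple ?posrE ?sqrtr_gt0//.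
have -> : b^-1 = Num.sqrt (b^-1 ^+ 2).
  by rewrite sqrtr_sqr ger0_norm// invr_ge0 ltW.
rewrite ler_wsqrtr//.
by rewrite exprVn -div1r ler_pdivrMr// exprn_gt0.
Qed.

(** The Laplace transform of x^2 is known in closed form, and elementary
    inequalities for the exponential turn it into moment bounds within a few
    percent of the true values 1 and 3; such bounds are enough below. *)
Lemma normal_sqr_ge : ((24 / 25)%:E <= \int[N01]_x (x ^+ 2)%:E)%E.
Proof.
have mX n : measurable_fun setT (fun x : measurableTypeR R => (x ^+ n)%:E).
  by apply/measurable_EFinP; exact: measurable_funX.
have mexp c : measurable_fun setT (fun x : measurableTypeR R => (expR (c * x ^+ 2))%:E).
  apply/measurable_EFinP; apply: measurableT_comp => //.
  by apply: measurable_funM => //; exact: measurable_funX.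
(* integrate 1 <= exp(-x^2/40) + x^2/40 *)
have : (1 <= \int[N01]_x ((expR (- 40^-1 * x ^+ 2))%:E
                         + (40^-1)%:E * (x ^+ 2)%:E))%E.
  rewrite -[leLHS](@probability_setT _ _ _ N01) -[leLHS]mul1e -integral_cst//.
  apply: ge0_le_integral => //.
  - apply: emeasurable_funD => //; apply: measurable_funeM; exact: mX.
  - move=> x _; rewrite -EFinM -EFinD lee_fin.
    by have := expR_ge1Dx (- 40^-1 * x ^+ 2); lra.
rewrite ge0_integralD//; last 2 first.
- by move=> x _; rewrite -EFinM lee_fin mulr_ge0// sqr_ge0.
- by apply: measurable_funeM; exact: mX.
rewrite ge0_integralZl//; last by move=> x _; rewrite lee_fin sqr_ge0.
rewrite normal_expR_sqr; last by lra.
case: (\int[N01]_x _)%E => [m||]; last 2 first.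
- by move=> _; rewrite leey.
- by rewrite mulrNy gtr0_sg// ?invr_gt0// mul1e addeNy.
rewrite -EFinM -EFinD !lee_fin.
have : (Num.sqrt (1 - 2 * - 40^-1))^-1 <= 81 / 83 :> R.
  by apply: invr_sqrt_le; lra.
by lra.
Qed.

Lemma normal_pow4_le : (\int[N01]_x (x ^+ 4)%:E <= (63 / 20)%:E)%E.
Proof.
have mX n : measurable_fun setT (fun x : measurableTypeR R => (x ^+ n)%:E).
  by apply/measurable_EFinP; exact: measurable_funX.
have mexp c : measurable_fun setT (fun x : measurableTypeR R => (expR (c * x ^+ 2))%:E).
  apply/measurable_EFinP; apply: measurableT_comp => //.
  by apply: measurable_funM => //; exact: measurable_funX.
have e0 c (x : R) : setT x -> (0 <= (expR (c * x ^+ 2))%:E)%E.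
  by rewrite lee_fin expR_ge0.
have p0 (x : R) : setT x -> (0 <= (x ^+ 4)%:E)%E.
  by rewrite lee_fin exprn_even_ge0.
(* integrate 2 + y^2 <= exp y + exp (-y) at y = x^2/10 *)
have : (\int[N01]_x (2%:E + (100^-1)%:E * (x ^+ 4)%:E)
    <= \int[N01]_x ((expR (10^-1 * x ^+ 2))%:E
                   + (expR (- 10^-1 * x ^+ 2))%:E))%E.
  apply: ge0_le_integral => //.
  - by move=> x _; rewrite adde_ge0// mule_ge0// p0.
  - by apply: emeasurable_funD => //; apply: measurable_funeM; exact: mX.
  - exact: emeasurable_funD.
  - move=> x _; rewrite -!EFinM -!EFinD lee_fin mulNr.
    have /expR_cosh_ge : 0 <= 10^-1 * x ^+ 2 by rewrite mulr_ge0// sqr_ge0.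
    by apply: le_trans; lra.
rewrite !ge0_integralD//; last 2 first.
- by move=> x _; rewrite mule_ge0// p0.
- by apply: measurable_funeM; exact: mX.
rewrite ge0_integralZl// integral_cst//.
rewrite [X in (2 * X)%E](_ : _ = 1%E) ?mule1; last exact: (@probability_setT _ _ _ N01).
rewrite !normal_expR_sqr; [|lra|lra].
have : (0 <= \int[N01]_x (x ^+ 4)%:E)%E by apply: integral_ge0.
case: (\int[N01]_x _)%E => [m||]; last 2 first.
- by rewrite mulry gtr0_sg ?invr_gt0// mul1e addey.
- by [].
rewrite -EFinM -!EFinD !lee_fin => _.
have : (Num.sqrt (1 - 2 * 10^-1))^-1 <= 85 / 76 :> R.
  by apply: invr_sqrt_le; lra.
have : (Num.sqrt (1 - 2 * - 10^-1))^-1 <= 21 / 23 :> R.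
  by apply: invr_sqrt_le; lra.
by lra.
Qed.

Lemma normal_expR_sqr_le (s : R) : 0 <= s <= 1 / 4 ->
  (\int[N01]_x (expR (s * x ^+ 2))%:E <= (1 + 2 * s)%:E)%E.
Proof.
move=> /andP[s0 s4]; rewrite normal_expR_sqr ?lee_fin; last by lra.
by apply: invr_sqrt_le; nra.
Qed.

Lemma normal_prob_opp (A : set R) : measurable A ->
  N01 ((-%R) @^-1` A) = N01 A.
Proof.
move=> mA; rewrite /normal_prob.
transitivity (\int[mu]_(x in (-%R : _ -> measurableTypeR R) @^-1` A)
  (((fun x => (normal_pdf 0 1 x)%:E) \o (-%R : _ -> measurableTypeR R)) x))%E.
  apply: eq_integral => x _; rewrite /= !normal_pdfE ?oner_neq0//.
  by rewrite /normal_fun !subr0 sqrrN.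
rewrite -ge0_integral_pushforward//=.
- by apply: eq_measure_integral => B mB _; exact: lebesgue_measureN.
- by apply/measurable_EFinP/measurable_funTS; exact: measurable_normal_pdf.
- by move=> x _; rewrite lee_fin normal_pdf_ge0.
Qed.

End normal_moments.

(** * Integrals of nonnegative real functions *)

Lemma integral_real_cst (dT : measure_display) (T : measurableType dT)
    (R : realType) (m : probability T R) (c : R) :
  (\int[m]_t c%:E = c%:E)%E.
Proof. by rewrite integral_cst//= probability_setT mule1. Qed.

Section real_integrals.
Context {dT : measure_display} {T : measurableType dT} {R : realType}.
Variable m : {measure set T -> \bar R}.
Implicit Types (F G : T -> R) (c : R).

Lemma integral_realD F G :
  measurable_fun setT F -> measurable_fun setT G ->
  (forall t, 0 <= F t) -> (forall t, 0 <= G t) ->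
  (\int[m]_t (F t + G t)%:E = \int[m]_t (F t)%:E + \int[m]_t (G t)%:E)%E.
Proof.
move=> mF mG F0 G0; under eq_integral do rewrite EFinD.
by rewrite ge0_integralD//;
  [move=> t _; rewrite lee_fin|exact/measurable_EFinP|
   move=> t _; rewrite lee_fin|exact/measurable_EFinP].
Qed.

Lemma integral_realZ c F : 0 <= c ->
  measurable_fun setT F -> (forall t, 0 <= F t) ->
  (\int[m]_t (c * F t)%:E = c%:E * \int[m]_t (F t)%:E)%E.
Proof.
move=> c0 mF F0; under eq_integral do rewrite EFinM.
by rewrite ge0_integralZl//; [exact/measurable_EFinP|move=> t _; rewrite lee_fin].
Qed.

Lemma le_integral_real F G :
  measurable_fun setT F -> measurable_fun setT G ->
  (forall t, 0 <= F t) -> (forall t, F t <= G t) ->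
  (\int[m]_t (F t)%:E <= \int[m]_t (G t)%:E)%E.
Proof.
move=> mF mG F0 FG; apply: ge0_le_integral => //.
- by move=> t _; rewrite lee_fin.
- exact/measurable_EFinP.
- exact/measurable_EFinP.
- by move=> t _; rewrite lee_fin.
Qed.

Lemma integral_real_sum (I : Type) (r : seq I) (F : I -> T -> R) :
  (forall i, measurable_fun setT (F i)) -> (forall i t, 0 <= F i t) ->
  (\int[m]_t (\sum_(i <- r) F i t)%:E = \sum_(i <- r) \int[m]_t (F i t)%:E)%E.
Proof.
move=> mF F0; under eq_integral do rewrite -sumEFin.
rewrite ge0_integral_sum//.
by move=> i; apply/measurable_EFinP.
by move=> i t _; rewrite lee_fin.
Qed.

Lemma integral_real_ge0 F : (forall t, 0 <= F t) ->
  (0 <= \int[m]_t (F t)%:E)%E.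
Proof. by move=> F0; apply: integral_ge0 => t _; rewrite lee_fin. Qed.

End real_integrals.

Ltac mfun := repeat first
  [ exact: measurable_cst | exact: measurable_id | exact: measurable_coord
  | assumption
  | apply: measurable_funD | apply: measurable_funM | apply: measurable_funX
  | apply: measurable_sum => ?
  | apply: measurable_dotp | apply: (measurableT_comp (@measurable_expR _)) ].

Ltac nonneg := repeat first
  [ exact: sqr_ge0 | exact: expR_ge0 | exact: ler0n | exact: ler01
  | solve [auto] | exact: ltW
  | apply: mulr_ge0 | apply: addr_ge0 | (rewrite invr_ge0) | apply: exprn_ge0
  | apply: sumr_ge0 => ? _].

(** * The Euclidean inner product *)

Section euclidean_theory.
Context {R : realType} {d : nat}.
Implicit Types x y z v h : 'rV[R]_d.

Lemma dotp_ge0 v : 0 <= dotp v v.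
Proof. by apply: sumr_ge0 => i _; rewrite -expr2 sqr_ge0. Qed.

Lemma enorm_sqr v : enorm v ^+ 2 = dotp v v.
Proof. by rewrite sqr_sqrtr// dotp_ge0. Qed.

Lemma enorm_ge0 v : 0 <= enorm v.
Proof. exact: sqrtr_ge0. Qed.

Lemma dotpC x y : dotp x y = dotp y x.
Proof. by apply: eq_bigr => i _; rewrite mulrC. Qed.

Lemma dotpDl x y z : dotp (x + y) z = dotp x z + dotp y z.
Proof. by rewrite -big_split; apply: eq_bigr => i _; rewrite mxE mulrDl. Qed.

Lemma dotpZl c x z : dotp (c *: x) z = c * dotp x z.
Proof. by rewrite mulr_sumr; apply: eq_bigr => i _; rewrite mxE mulrA. Qed.

Lemma dotpDr x y z : dotp z (x + y) = dotp z x + dotp z y.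
Proof. by rewrite !(dotpC z) dotpDl. Qed.

Lemma dotpZr c x z : dotp z (c *: x) = c * dotp z x.
Proof. by rewrite !(dotpC z) dotpZl. Qed.

Lemma dotpNl x z : dotp (- x) z = - dotp x z.
Proof. by rewrite -scaleN1r dotpZl mulN1r. Qed.

Lemma dotpNr x z : dotp z (- x) = - dotp z x.
Proof. by rewrite !(dotpC z) dotpNl. Qed.

Lemma dotp_eq0 v : dotp v v = 0 -> v = 0.
Proof.
move=> /eqP; rewrite psumr_eq0 => [|i _]; last by rewrite -expr2 sqr_ge0.
move=> /allP v0; apply/rowP => i; rewrite mxE.
have := v0 i (mem_index_enum i); rewrite /= mulf_eq0 orbb.
by move/eqP.
Qed.

Lemma dotp0 h : dotp h 0 = 0.
Proof. by apply: big1 => i _; rewrite mxE mulr0. Qed.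

Lemma cauchy_schwarz x y : dotp x y ^+ 2 <= dotp x x * dotp y y.
Proof.
have [y0|y0] := eqVneq (dotp y y) 0.
  by rewrite (dotp_eq0 y0) !dotp0 expr0n mulr0.
have yp : 0 < dotp y y by rewrite lt_neqAle eq_sym y0 dotp_ge0.
have := dotp_ge0 (dotp y y *: x - dotp x y *: y).
rewrite !(dotpDl, dotpDr, dotpNl, dotpNr, dotpZl, dotpZr) (dotpC y x).
set a := dotp x y; set b := dotp y y; set c := dotp x x => H.
rewrite -subr_ge0 -(pmulr_rge0 _ yp) -/b.
by rewrite (_ : b * _ = b * (b * c) - a * (b * a) - (b * (a * a) - a * (a * b)))//;
  [apply: le_trans H _; lra|ring].
Qed.

End euclidean_theory.

(** * Symmetries and moments of a Gaussian vector *)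

Section gaussian_vector.
Context {R : realType} {d : nat}.
Variable gam : probability 'rV[R]_d R.
Hypothesis gam_normal : std_gaussian_law gam.
Notation N01 := (@normal_prob R 0 1).
Implicit Types (i j : 'I_d) (h v : 'rV[R]_d) (F G w : 'rV[R]_d -> R).

Definition flip i v : 'rV[R]_d := \row_j (if j == i then - v 0 j else v 0 j).

Definition swap i j v : 'rV[R]_d := \row_k v 0 (tperm i j k).

Lemma measurable_flip i : measurable_fun setT (flip i).
Proof.
apply: measurable_fun_rV => j; under eq_fun do rewrite mxE.
case: (j == i); last exact: measurable_coord.
by apply: (measurable_comp measurableT) => //; exact: measurable_coord.
Qed.

Lemma measurable_swap i j : measurable_fun setT (swap i j).
Proof.
apply: measurable_fun_rV => k; under eq_fun do rewrite mxE.
exact: measurable_coord.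
Qed.

Lemma gaussian_coord i (F : R -> R) :
  measurable_fun setT F -> (forall x, 0 <= F x) ->
  (\int[gam]_v (F (v 0 i))%:E = \int[N01]_x (F x)%:E)%E.
Proof.
move=> mF F0.
pose c (v : 'rV[R]_d) : measurableTypeR R := v 0 i.
have mc : measurable_fun setT c by exact: measurable_coord.
rewrite [RHS](@eq_measure_integral _ _ _ _ (pushforward gam c)); last first.
  move=> A mA _.
  transitivity (gam (box (fun j => if j == i then A else setT))).
    rewrite gam_normal; last by move=> j; case: ifP.
    rewrite (bigD1 i)//= eqxx big1 ?mule1// => j /negPf ->.
    exact: (@probability_setT _ _ _ N01).
  rewrite /pushforward; congr (gam _); apply/seteqP; split=> v /=.
    by move=> /(_ i); rewrite eqxx.
  by move=> Av j; case: eqP => [->|].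
rewrite ge0_integral_pushforward//.
- exact/measurable_EFinP.
- by move=> x _; rewrite lee_fin.
Qed.

(** A map that preserves the measures of boxes preserves the law, since the
    boxes form a generating family closed under intersection. *)
Lemma gaussian_invariant (phi : 'rV[R]_d -> 'rV[R]_d) F :
  measurable_fun setT phi ->
  (forall A : 'I_d -> set R, (forall i, measurable (A i)) ->
     gam (phi @^-1` (box A)) = gam (box A)) ->
  measurable_fun setT F -> (forall v, 0 <= F v) ->
  (\int[gam]_v (F (phi v))%:E = \int[gam]_v (F v)%:E)%E.
Proof.
move=> mphi phiA mF F0.
pose X : {mfun 'rV[R]_d >-> 'rV[R]_d} := HB.pack phi (isMeasurableFun.Build _ _ _ _ phi mphi).
rewrite [RHS](@eq_measure_integral _ _ _ _ (distribution gam X)); last first.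
  move=> A mA _.
  by apply: (measure_unique_boxes (m1 := gam) (m2 := distribution gam X)) => // B mB; rewrite -phiA.
rewrite ge0_integral_pushforward//.
- exact/measurable_EFinP.
- by move=> x _; rewrite lee_fin.
Qed.

Lemma gaussian_flip i F :
  measurable_fun setT F -> (forall v, 0 <= F v) ->
  (\int[gam]_v (F (flip i v))%:E = \int[gam]_v (F v)%:E)%E.
Proof.
apply: gaussian_invariant; first exact: measurable_flip.
move=> A mA.
have -> : flip i @^-1` (box A) =
    box (fun j => if j == i then (-%R) @^-1` (A j) else A j).
  by apply/seteqP; split=> v Av j /=; have := Av j; rewrite mxE; case: eqP.
rewrite !gam_normal//; last first.
  move=> j; case: eqP => // _; rewrite -[_ @^-1` _]setTI.
  exact: oppr_measurable.
by apply: eq_bigr => j _; case: eqP => // _; exact: normal_prob_opp.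
Qed.

Lemma gaussian_swap i j F :
  measurable_fun setT F -> (forall v, 0 <= F v) ->
  (\int[gam]_v (F (swap i j v))%:E = \int[gam]_v (F v)%:E)%E.
Proof.
apply: gaussian_invariant; first exact: measurable_swap.
move=> A mA.
have -> : swap i j @^-1` (box A) = box (fun k => A (tperm i j k)).
  apply/seteqP; split=> v Av k /=.
    by have := Av (tperm i j k); rewrite mxE tpermK.
  by have := Av (tperm i j k); rewrite mxE tpermK.
rewrite !gam_normal// (reindex_inj (@perm_inj _ (tperm i j)))/=.
by apply: eq_bigr => k _; rewrite ?tpermK.
Qed.

(** Averaging an integrand over the reflection of one coordinate removes its
    odd part in that coordinate. *)
Lemma gaussian_even_part i F G :
  measurable_fun setT F -> (forall v, 0 <= F v) ->
  measurable_fun setT G -> (forall v, 0 <= G v) ->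
  (forall v, F v + F (flip i v) = 2 * G v) ->
  (\int[gam]_v (F v)%:E = \int[gam]_v (G v)%:E)%E.
Proof.
move=> mF F0 mG G0 FG.
have : (\int[gam]_v (F v + F (flip i v))%:E = 2%:E * \int[gam]_v (G v)%:E)%E.
  by rewrite -integral_realZ//; apply: eq_integral => v _; rewrite FG.
rewrite integral_realD//; last first.
  by apply: (measurableT_comp mF); exact: measurable_flip.
rewrite gaussian_flip//.
have := integral_real_ge0 gam F0; have := integral_real_ge0 gam G0.
case: (\int[gam]_v (F v)%:E)%E => [a||]//; case: (\int[gam]_v _)%E => [b||]//.
- by move=> _ _; rewrite -EFinM -EFinD => -[ab]; congr EFin; lra.
- by rewrite gt0_muley.
Qed.

Definition flip_invariant w := forall i v, w (flip i v) = w v.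

(** The cross terms of the square are odd in some coordinate and integrate to
    0; this diagonalizes every quadratic form met below, including those
    weighted by a function of |v|. *)
Lemma gaussian_square_sum h (r : seq 'I_d) w :
  uniq r -> measurable_fun setT w -> (forall v, 0 <= w v) -> flip_invariant w ->
  (\int[gam]_v ((\sum_(i <- r) h 0 i * v 0 i) ^+ 2 * w v)%:E =
   \sum_(i <- r) (h 0 i ^+ 2)%:E * \int[gam]_v (v 0 i ^+ 2 * w v)%:E)%E.
Proof.
move=> + mw w0 wf; elim: r => [_|i r IH /= /andP[ir ur]].
  rewrite big_nil; under eq_integral do rewrite big_nil expr0n mul0r.
  by rewrite integral0.
rewrite big_cons -(IH ur) -integral_realZ ?sqr_ge0//; last 2 first.
- by mfun.
- by move=> v; nonneg.
rewrite -integral_realD//; last 4 first.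
- by mfun.
- by mfun.
- by move=> v; nonneg.
- by move=> v; nonneg.
apply: (gaussian_even_part (i := i)).
- under eq_fun do rewrite big_cons; by mfun.
- by move=> v; nonneg.
- by mfun.
- by move=> v; nonneg.
move=> v; rewrite wf !big_cons mxE eqxx.
have -> : \sum_(j <- r) h 0 j * flip i v 0 j = \sum_(j <- r) h 0 j * v 0 j.
  rewrite big_seq [RHS]big_seq; apply: eq_bigr => j jr; rewrite mxE.
  by case: eqP => // ji; move: ir; rewrite -ji jr.
by ring.
Qed.

Lemma gaussian_pow4_le i : (\int[gam]_v (v 0 i ^+ 4)%:E <= (63 / 20)%:E)%E.
Proof.
rewrite (@gaussian_coord i (fun x => x ^+ 4)).
- exact: normal_pow4_le.
- exact: measurable_funX.
- by move=> x; rewrite exprn_even_ge0.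
Qed.

Lemma gaussian_sqr_ge i : ((24 / 25)%:E <= \int[gam]_v (v 0 i ^+ 2)%:E)%E.
Proof.
rewrite (@gaussian_coord i (fun x => x ^+ 2)).
- exact: normal_sqr_ge.
- exact: measurable_funX.
- by move=> x; rewrite exprn_even_ge0.
Qed.

Lemma gaussian_cross_le i j :
  (\int[gam]_v (v 0 i ^+ 2 * v 0 j ^+ 2)%:E <= (63 / 20)%:E)%E.
Proof.
apply: (@le_trans _ _ (\int[gam]_v (2^-1 * v 0 i ^+ 4 + 2^-1 * v 0 j ^+ 4)%:E)%E).
  apply: le_integral_real; [by mfun|by mfun| |].
    by move=> v; nonneg.
  move=> v; have := sqr_ge0 (v 0 i ^+ 2 - v 0 j ^+ 2); nra.
have e4 k (v : 'rV[R]_d) : 0 <= v 0 k ^+ 4 by rewrite exprn_even_ge0.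
rewrite integral_realD; [|by mfun|by mfun|by move=> v; rewrite mulr_ge0|
  by move=> v; rewrite mulr_ge0].
rewrite !integral_realZ//; [|by mfun|by mfun].
have := gaussian_pow4_le i; have := gaussian_pow4_le j.
have := integral_real_ge0 gam (e4 i); have := integral_real_ge0 gam (e4 j).
case: (\int[gam]_v _)%E => [a||]//; case: (\int[gam]_v _)%E => [b||]//.
rewrite -!EFinM -EFinD !lee_fin; lra.
Qed.

End gaussian_vector.

(** * The projection of a vector on a Gaussian direction *)

Lemma measurable_invr (R : realType) : measurable_fun [set: R] (@GRing.inv R).
Proof.
rewrite (_ : [set: R] = [set 0] `|` ~` [set 0]); last by rewrite setUCr.
apply/measurable_funU => //; first exact: measurableC.
split; first exact: measurable_fun_set1.
apply: open_continuous_measurable_fun.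
  by apply: closed_openC; exact: closed_eq.
by move=> x; rewrite inE/= => /eqP x0; exact: inv_continuous.
Qed.

Section gaussian_direction.
Context {R : realType} {d : nat}.
Variable gam : probability 'rV[R]_d R.
Hypothesis gam_normal : std_gaussian_law gam.
Hypothesis d_gt0 : (0 < d)%N.
Implicit Types (i j : 'I_d) (h v : 'rV[R]_d).

Let dR : 0 < d%:R :> R. Proof. by rewrite ltr0n. Qed.

Lemma measurable_invr_dotp : measurable_fun setT (fun v : 'rV[R]_d => (dotp v v)^-1).
Proof.
apply: (measurableT_comp (@measurable_invr R)).
by apply: measurable_dotp; exact: measurable_id.
Qed.

Lemma dotp_flip i v : dotp (flip i v) (flip i v) = dotp v v.
Proof. by apply: eq_bigr => j _; rewrite mxE; case: eqP => // _; rewrite mulrNN. Qed.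

Lemma dotp_swap i j v : dotp (swap i j v) (swap i j v) = dotp v v.
Proof.
rewrite /dotp [RHS](reindex_inj (@perm_inj _ (tperm i j)))/=.
by apply: eq_bigr => k _; rewrite mxE.
Qed.

Lemma gaussian_dotp_sqr h (w : 'rV[R]_d -> R) :
  measurable_fun setT w -> (forall v, 0 <= w v) -> flip_invariant w ->
  (\int[gam]_v (dotp h v ^+ 2 * w v)%:E =
   \sum_(i < d) (h 0 i ^+ 2)%:E * \int[gam]_v (v 0 i ^+ 2 * w v)%:E)%E.
Proof.
by move=> mw w0 wf; apply: gaussian_square_sum => //; exact: index_enum_uniq.
Qed.

Lemma sum_sqr_coord h : \sum_(i < d) h 0 i ^+ 2 = dotp h h.
Proof. by apply: eq_bigr => i _; rewrite expr2. Qed.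

Lemma gaussian_dotp_sqr_ge h :
  ((24 / 25 * dotp h h)%:E <= \int[gam]_v (dotp h v ^+ 2)%:E)%E.
Proof.
have := @gaussian_dotp_sqr h (fun=> 1).
under eq_integral do rewrite mulr1.
move=> ->//; rewrite -sum_sqr_coord mulr_sumr -sumEFin.
apply: lee_sum => i _; rewrite mulrC EFinM lee_wpmul2l ?lee_fin ?sqr_ge0//.
under eq_integral do rewrite mulr1.
exact: gaussian_sqr_ge.
Qed.

Lemma gaussian_dotp_sqr_norm_le h :
  (\int[gam]_v (dotp h v ^+ 2 * dotp v v)%:E
    <= (63 / 20 * d%:R * dotp h h)%:E)%E.
Proof.
have mw : measurable_fun setT (fun v : 'rV[R]_d => dotp v v).
  by apply: measurable_dotp; exact: measurable_id.
rewrite gaussian_dotp_sqr//; [|by move=> v; exact: dotp_ge0|by move=> i v; exact: dotp_flip].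
rewrite -sum_sqr_coord mulr_sumr -sumEFin.
apply: lee_sum => i _; rewrite [X in (_ <= X%:E)%E]mulrC [leRHS]EFinM lee_wpmul2l ?lee_fin ?sqr_ge0//.
under eq_integral do rewrite -sum_sqr_coord mulr_sumr.
rewrite integral_real_sum; [|by move=> j; mfun|by move=> j v; nonneg].
have -> : 63 / 20 * d%:R = \sum_(j < d) (63 / 20) :> R.
  by rewrite sumr_const card_ord mulr_natr.
by rewrite -sumEFin; apply: lee_sum => j _; exact: gaussian_cross_le.
Qed.

(** Adding one coordinate at a time, the odd powers of the new coordinate
    average out and each even one has a bounded moment. *)
Lemma gaussian_fourth_sum h (r : seq 'I_d) : uniq r ->
  (\int[gam]_v ((\sum_(i <- r) h 0 i * v 0 i) ^+ 4)%:E
    <= (3 * (63 / 20) * (\sum_(i <- r) h 0 i ^+ 2) ^+ 2)%:E)%E.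
Proof.
elim: r => [_|i r IH /= /andP[ir ur]].
  under eq_integral do rewrite big_nil expr0n.
  by rewrite integral0 big_nil expr0n mulr0.
pose S v := \sum_(j <- r) h 0 j * v 0 j.
have mS : measurable_fun setT S by rewrite /S; mfun.
pose G v := S v ^+ 4 + (6 * h 0 i ^+ 2 * (S v ^+ 2 * v 0 i ^+ 2)
                        + h 0 i ^+ 4 * v 0 i ^+ 4).
have p4 (x : R) : 0 <= x ^+ 4 by rewrite exprn_even_ge0.
have mG : measurable_fun setT G by rewrite /G; mfun.
have G0 v : 0 <= G v by rewrite /G; nonneg.
rewrite (gaussian_even_part gam_normal (i := i) (G := G))//; last 2 first.
- under eq_fun do rewrite big_cons; by mfun.
- move=> v; rewrite !big_cons mxE eqxx /G.
  have -> : \sum_(j <- r) h 0 j * flip i v 0 j = S v.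
    rewrite /S big_seq [RHS]big_seq; apply: eq_bigr => j jr; rewrite mxE.
    by case: eqP => // ji; move: ir; rewrite -ji jr.
  by rewrite -/(S v); ring.
set s := \sum_(j <- r) h 0 j ^+ 2 in IH.
have s0 : 0 <= s by apply: sumr_ge0 => j _; exact: sqr_ge0.
rewrite /G integral_realD; [|by mfun|by mfun|by []|by move=> v; nonneg].
rewrite integral_realD; [|by mfun|by mfun|by move=> v; nonneg|by move=> v; nonneg].
rewrite !integral_realZ; [|by []|by mfun|by []|by nonneg|by mfun|by move=> v; nonneg].
have -> : 3 * (63 / 20) * (\sum_(j <- i :: r) h 0 j ^+ 2) ^+ 2 =
   3 * (63 / 20) * s ^+ 2 + (6 * h 0 i ^+ 2 * (63 / 20 * s) + h 0 i ^+ 4 * (63 / 20)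
     + h 0 i ^+ 4 * (2 * (63 / 20))).
  by rewrite big_cons -/s; ring.
apply: (@le_trans _ _ (3 * (63 / 20) * s ^+ 2 +
   (6 * h 0 i ^+ 2 * (63 / 20 * s) + h 0 i ^+ 4 * (63 / 20)))%:E); last first.
  by rewrite lee_fin lerD2l lerDl; nonneg; lra.
rewrite 2!EFinD leeD ?IH// leeD// [leRHS]EFinM lee_wpmul2l ?lee_fin//.
- by nonneg.
- have mw : measurable_fun setT (fun v : 'rV[R]_d => v 0 i ^+ 2) by mfun.
  rewrite (gaussian_square_sum gam_normal h ur mw).
  + rewrite /s mulr_sumr -sumEFin; apply: lee_sum => j _.
    rewrite [X in (_ <= X%:E)%E]mulrC [leRHS]EFinM lee_wpmul2l ?lee_fin ?sqr_ge0//.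
    exact: gaussian_cross_le.
  + by move=> v; exact: sqr_ge0.
  + by move=> j v; rewrite mxE; case: eqP => // _; rewrite sqrrN.
- exact: gaussian_pow4_le.
Qed.

Lemma gaussian_dotp_pow4_le h :
  (\int[gam]_v (dotp h v ^+ 4)%:E <= (189 / 20 * dotp h h ^+ 2)%:E)%E.
Proof.
have := @gaussian_fourth_sum h (index_enum 'I_d) (index_enum_uniq _).
rewrite sum_sqr_coord => /le_trans; apply.
by rewrite lee_fin; have := sqr_ge0 (dotp h h); lra.
Qed.

(** The tangent of 1/r at r = 3d gives 1/r >= (2 - r/(3d))/(3d), which bounds
    <h, v>^2 / |v|^2 below by a polynomial in v, so that no moment of 1/|v|^2
    is needed. Where that polynomial is negative, the trivial bound 1 on the
    exponential is enough. *)
Lemma gaussian_projection_pointwise h v k : 0 <= k ->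
  expR (- (k * dotp h v ^+ 2 * (dotp v v)^-1)) + 2 * k / (3 * d%:R) * dotp h v ^+ 2
  <= 1 + (k / (9 * d%:R ^+ 2) * (dotp h v ^+ 2 * dotp v v)
          + 4 * k ^+ 2 / (9 * d%:R ^+ 2) * dotp h v ^+ 4).
Proof.
move=> k0; have [v0|v0] := eqVneq (dotp v v) 0.
  by rewrite (dotp_eq0 v0) !dotp0 !expr0n/= !(mulr0, mul0r) oppr0 expR0 !addr0.
set g := dotp h v; set r := dotp v v.
have r0 : 0 < r by rewrite lt_neqAle eq_sym v0 dotp_ge0.
pose c := k / d%:R; pose z := r / (3 * d%:R).
have c0 : 0 <= c by rewrite divr_ge0// ltW.
have z0 : 0 < z by rewrite divr_gt0// mulr_gt0.
set x := k * g ^+ 2 * r^-1.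
have -> : 2 * k / (3 * d%:R) * g ^+ 2 = 2 / 3 * (c * g ^+ 2).
  by rewrite /c; field; rewrite gt_eqF.
have -> : k / (9 * d%:R ^+ 2) * (g ^+ 2 * r) = 3^-1 * (c * g ^+ 2) * z.
  by rewrite /c /z; field; rewrite gt_eqF.
have -> : 4 * k ^+ 2 / (9 * d%:R ^+ 2) * g ^+ 4 = (2 / 3 * (c * g ^+ 2)) ^+ 2.
  by rewrite /c; field; rewrite gt_eqF.
have xE : x = 3^-1 * (c * g ^+ 2) * z^-1.
  by rewrite /c /z /x; field; rewrite !gt_eqF.
set q := c * g ^+ 2 in xE *.
have q0 : 0 <= q by rewrite mulr_ge0// sqr_ge0.
have [z2|z2] := leP z 2; last first.
  have : expR (- x) <= 1 by rewrite expR_le1 oppr_le0 xE; nonneg; lra.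
  have : 0 <= q * (z - 2) by rewrite mulr_ge0// subr_ge0 ltW.
  by have := sqr_ge0 (2 / 3 * q); lra.
have zi : 2 - z <= z^-1.
  by rewrite -(ler_pM2r z0) mulVf ?gt_eqF//; have := sqr_ge0 (z - 1); nra.
pose y := 3^-1 * q * (2 - z).
have y0 : 0 <= y by apply: mulr_ge0; [apply: mulr_ge0 => //; rewrite invr_ge0|rewrite subr_ge0].
have yx : y <= x by rewrite xE ler_wpM2l//; nonneg.
have : expR (- x) <= expR (- y) by rewrite ler_expR lerN2.
have := expRN_le y0.
have : y ^+ 2 <= (2 / 3 * q) ^+ 2.
  have qz : 0 <= q * z by rewrite mulr_ge0// ltW.
  have q3 : 0 <= 2 / 3 * q by lra.
  have yq : y <= 2 / 3 * q by rewrite /y; lra.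
  by rewrite ler_sqr ?nnegrE.
by rewrite /y; lra.
Qed.

(** To first order the left-hand side is 1 - k |h|^2 / d; a quarter of this
    decrease survives the approximations. *)
Lemma gaussian_projection_laplace h k : 0 <= k ->
  k * dotp h h / d%:R <= 120^-1 ->
  (\int[gam]_v (expR (- (k * dotp h v ^+ 2 * (dotp v v)^-1)))%:E
    <= (1 - k * dotp h h / (4 * d%:R))%:E)%E.
Proof.
move=> k0; set S := k * dotp h h / d%:R => S1.
have S0 : 0 <= S.
  by apply: divr_ge0; [apply: mulr_ge0 => //; exact: dotp_ge0|exact: ltW].
have := measurable_invr_dotp => mi.
have mr : measurable_fun setT (fun v : 'rV[R]_d => dotp v v).
  by apply: measurable_dotp; exact: measurable_id.
have mh : measurable_fun setT (dotp h) by apply: measurable_dotp; [exact: measurable_cst|exact: measurable_id].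
have mE : measurable_fun setT (fun v => expR (- (k * dotp h v ^+ 2 * (dotp v v)^-1))).
  apply: (measurableT_comp (@measurable_expR R)).
  apply: (@measurable_funN _ _ _ setT (fun v => k * dotp h v ^+ 2 * (dotp v v)^-1)).
  by mfun.
have dp := @dotp_ge0 R d.
have p4 (x : R) : 0 <= x ^+ 4 by rewrite exprn_even_ge0.
have dR' : 0 <= d%:R :> R by exact: ltW.
have : (\int[gam]_v (expR (- (k * dotp h v ^+ 2 * (dotp v v)^-1)) + 2 * k / (3 * d%:R) * dotp h v ^+ 2)%:E
  <= \int[gam]_v (1 + (k / (9 * d%:R ^+ 2) * (dotp h v ^+ 2 * dotp v v)
          + 4 * k ^+ 2 / (9 * d%:R ^+ 2) * dotp h v ^+ 4))%:E)%E.
  apply: le_integral_real; [by mfun|by mfun|by move=> v; nonneg|].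
  by move=> v; exact: gaussian_projection_pointwise.
do 3 (rewrite integral_realD; [|by mfun|by mfun|by move=> v; nonneg|by move=> v; nonneg]).
do 3 (rewrite integral_realZ; [|by nonneg|by mfun|by move=> v; nonneg]).
rewrite integral_real_cst.
have A0 : 0 <= 2 * k / (3 * d%:R) by nonneg.
have B0 : 0 <= k / (9 * d%:R ^+ 2) by nonneg.
have C0 : 0 <= 4 * k ^+ 2 / (9 * d%:R ^+ 2) by nonneg.
have iA := lee_wpmul2l (x := (2 * k / (3 * d%:R))%:E) A0 (gaussian_dotp_sqr_ge h).
have iB := lee_wpmul2l (x := (k / (9 * d%:R ^+ 2))%:E) B0 (gaussian_dotp_sqr_norm_le h).
have iC := lee_wpmul2l (x := (4 * k ^+ 2 / (9 * d%:R ^+ 2))%:E) C0 (gaussian_dotp_pow4_le h).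
move=> H.
have {H} := le_trans (leeD (lexx _) iA) (le_trans H (leeD (lexx 1%:E) (leeD iB iC))).
rewrite -!EFinM -!EFinD.
have := @integral_real_ge0 _ _ _ gam (fun v => expR (- (k * dotp h v ^+ 2 * (dotp v v)^-1))) (fun v => expR_ge0 _).
case: (\int[gam]_v _)%E => [I||]// _; rewrite -EFinD !lee_fin.
have -> : 2 * k / (3 * d%:R) * (24 / 25 * dotp h h) = 16 / 25 * S.
  by rewrite /S; field; rewrite gt_eqF.
have -> : k / (9 * d%:R ^+ 2) * (63 / 20 * d%:R * dotp h h) = 7 / 20 * S.
  by rewrite /S; field; rewrite gt_eqF.
have -> : 4 * k ^+ 2 / (9 * d%:R ^+ 2) * (189 / 20 * dotp h h ^+ 2) = 21 / 5 * S ^+ 2.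
  by rewrite /S; field; rewrite gt_eqF.
have -> : k * dotp h h / (4 * d%:R) = S / 4.
  by rewrite /S; field; rewrite gt_eqF.
by nra.
Qed.

(** The d ratios v_i^2 / |v|^2 have the same mean because the law is invariant
    under swapping coordinates, and their sum is at most 1. *)
Lemma gaussian_coord_ratio i :
  (\int[gam]_v (v 0 i ^+ 2 * (dotp v v)^-1)%:E <= (d%:R^-1)%:E)%E.
Proof.
have := measurable_invr_dotp => mi.
have ip v : 0 <= (dotp v v)^-1 :> R by rewrite invr_ge0 dotp_ge0.
pose I j := (\int[gam]_v (v 0 j ^+ 2 * (dotp v v)^-1)%:E)%E.
have Ieq j : I j = I i.
  rewrite /I -(gaussian_swap gam_normal i j); [|by mfun|by move=> v; nonneg].
  by apply: eq_integral => v _; rewrite dotp_swap mxE tpermR.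
have : (\sum_(j < d) I j <= 1)%E.
  rewrite -integral_real_sum; [|by move=> j; mfun|by move=> j v; nonneg].
  rewrite -[leRHS](integral_real_cst gam 1).
  apply: le_integral_real; [by mfun|by mfun|by move=> v; nonneg|].
  move=> v; rewrite -mulr_suml sum_sqr_coord.
  have [->|v0] := eqVneq (dotp v v) 0; first by rewrite mul0r.
  by rewrite mulfV.
under eq_bigr do rewrite Ieq.
have : (0 <= I i)%E by apply: integral_real_ge0 => v; nonneg.
have : (I i <= 1)%E.
  rewrite -[leRHS](integral_real_cst gam 1).
  apply: le_integral_real; [by mfun|by mfun|by move=> v; nonneg|].
  move=> v; have [->|v0] := eqVneq (dotp v v) 0; first by rewrite invr0 mulr0.
  rewrite ler_pdivrMr ?mul1r; last by rewrite lt_neqAle eq_sym v0 dotp_ge0.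
  rewrite -sum_sqr_coord (bigD1 i)//= lerDl.
  by apply: sumr_ge0 => j _; exact: sqr_ge0.
rewrite -/(I i); case: (I i) => [a||]// _ _.
rewrite sumEFin sumr_const card_ord !lee_fin => h1.
by rewrite -(ler_pM2r dR) mulVf ?gt_eqF// mulr_natr.
Qed.

Lemma gaussian_projection_le h :
  (\int[gam]_v (dotp h v ^+ 2 * (dotp v v)^-1)%:E <= (dotp h h / d%:R)%:E)%E.
Proof.
have ip v : 0 <= (dotp v v)^-1 :> R by rewrite invr_ge0 dotp_ge0.
rewrite gaussian_dotp_sqr//; last 2 first.
- exact: measurable_invr_dotp.
- by move=> i v; rewrite dotp_flip.
rewrite -sum_sqr_coord mulr_suml -sumEFin.
apply: lee_sum => i _; rewrite [leRHS]EFinM lee_wpmul2l ?lee_fin ?sqr_ge0//.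
exact: gaussian_coord_ratio.
Qed.

(** The fraction of |h|^2 captured by the direction of v is a number in [0, 1]
    with mean 1/d, so the chord of exp turns this mean into an exponential
    moment that keeps the factor 1/d. *)
Lemma gaussian_projection_expR h k : 0 <= k ->
  (\int[gam]_v (expR (k * (dotp h v ^+ 2 * (dotp v v)^-1)))%:E
    <= (1 + d%:R^-1 * (expR (k * dotp h h) - 1))%:E)%E.
Proof.
move=> k0; have := measurable_invr_dotp => mi.
have mh : measurable_fun setT (dotp h) by apply: measurable_dotp; [exact: measurable_cst|exact: measurable_id].
have ip v : 0 <= (dotp v v)^-1 :> R by rewrite invr_ge0 dotp_ge0.
have [h0|h0] := eqVneq (dotp h h) 0.
  rewrite h0 mulr0 expR0 subrr mulr0 addr0.
  rewrite -[leRHS](integral_real_cst gam 1).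
  apply: le_integral_real; [by mfun|by mfun|by move=> v; nonneg|].
  by move=> v; rewrite (dotp_eq0 h0) dotpC dotp0 expr0n mul0r mulr0 expR0.
have hp : 0 < dotp h h by rewrite lt_neqAle eq_sym h0 dotp_ge0.
pose e := (expR (k * dotp h h) - 1) / dotp h h.
have e0 : 0 <= e.
  by rewrite divr_ge0 ?(ltW hp)// subr_ge0 -expR0 ler_expR mulr_ge0// ltW.
apply: (@le_trans _ _ (\int[gam]_v (1 + e * (dotp h v ^+ 2 * (dotp v v)^-1))%:E)%E).
  apply: le_integral_real; [by mfun|by mfun|by move=> v; nonneg|].
  move=> v; pose x := dotp h v ^+ 2 * (dotp v v)^-1 / dotp h h.
  have x01 : 0 <= x <= 1.
    apply/andP; split; first by rewrite /x divr_ge0 ?(ltW hp)//; nonneg.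
    rewrite /x ler_pdivrMr// mul1r.
    have [v0|v0] := eqVneq (dotp v v) 0; first by rewrite v0 invr0 mulr0 ltW.
    by rewrite ler_pdivrMr ?cauchy_schwarz// lt_neqAle eq_sym v0 dotp_ge0.
  have := expR_chord (k * dotp h h) x01.
  have -> : k * dotp h h * x = k * (dotp h v ^+ 2 * (dotp v v)^-1).
    by rewrite /x -mulrA; move: (dotp h v ^+ 2 * (dotp v v)^-1) => p; field.
  move=> /le_trans; apply; rewrite lerD2l le_eqVlt; apply/orP; left; apply/eqP.
  by rewrite /x /e; move: (dotp h v ^+ 2 * (dotp v v)^-1) => p; ring.
rewrite integral_realD; [|by mfun|by mfun|by []|by move=> v; nonneg].
rewrite integral_realZ; [|by []|by mfun|by move=> v; nonneg].
rewrite integral_real_cst EFinD leeD2l//.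
apply: (@le_trans _ _ (e%:E * (dotp h h / d%:R)%:E)%E).
  by rewrite lee_wpmul2l// gaussian_projection_le.
rewrite -EFinM (_ : e * _ = d%:R^-1 * (expR (k * dotp h h) - 1))//.
by rewrite /e; field; rewrite h0 gt_eqF.
Qed.

Lemma gaussian_sqnorm_expR s : 0 <= s -> s * d%:R <= 1 / 4 ->
  (\int[gam]_v (expR (s * dotp v v))%:E <= (1 + 2 * (s * d%:R))%:E)%E.
Proof.
move=> s0 sd.
have mr : measurable_fun setT (fun v : 'rV[R]_d => dotp v v).
  by apply: measurable_dotp; exact: measurable_id.
have sd0 : 0 <= s * d%:R by rewrite mulr_ge0// ltW.
apply: (@le_trans _ _ (\int[gam]_v (\sum_(i < d) d%:R^-1 * expR (s * d%:R * v 0 i ^+ 2))%:E)%E).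
  apply: le_integral_real; [by mfun|by mfun|by move=> v; nonneg|].
  move=> v; rewrite -mulr_sumr.
  (* Jensen, through the tangent of exp at the mean exponent *)
  set a := s * dotp v v.
  have aE : a = d%:R^-1 * \sum_(i < d) s * d%:R * v 0 i ^+ 2.
    by rewrite -mulr_sumr sum_sqr_coord /a; field; rewrite gt_eqF.
  rewrite -(ler_pM2l dR) mulrA mulfV ?gt_eqF// mul1r.
  apply: (@le_trans _ _ (\sum_(i < d) (expR a * (1 + (s * d%:R * v 0 i ^+ 2 - a))))).
    rewrite -mulr_sumr big_split/= sumrB !sumr_const !card_ord.
    rewrite -mulr_sumr sum_sqr_coord -[a *+ d]mulr_natr.
    rewrite (_ : s * d%:R * dotp v v = a * d%:R); last by rewrite /a mulrAC.
    by rewrite subrr addr0 mulrC.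
  apply: ler_sum => i _.
  rewrite -[X in _ <= expR X](subrKC a) expRD ler_wpM2l ?expR_ge0//.
  exact: expR_ge1Dx.
rewrite integral_real_sum; [|by move=> j; mfun|by move=> j v; nonneg].
have -> : 1 + 2 * (s * d%:R) = \sum_(i < d) d%:R^-1 * (1 + 2 * (s * d%:R)).
  by rewrite sumr_const card_ord -[RHS]mulr_natr; field; rewrite gt_eqF.
rewrite -sumEFin; apply: lee_sum => i _.
rewrite integral_realZ; [|by rewrite invr_ge0 ltW|by mfun|by move=> v; nonneg].
rewrite [leRHS]EFinM lee_wpmul2l ?lee_fin ?invr_ge0 ?(ltW dR)//.
rewrite (gaussian_coord gam_normal i (F := fun x => expR (s * d%:R * x ^+ 2))).
- by apply: normal_expR_sqr_le; rewrite sd0.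
- by mfun.
- by move=> x; exact: expR_ge0.
Qed.

End gaussian_direction.

(** * Means and sub-Gaussian noise *)

Section subgaussian.
Context {dX : measure_display} {Xi : measurableType dX} {R : realType}.
Variable Q : probability Xi R.
Implicit Types (X Y : Xi -> R) (a b c : R).

Lemma has_mean_cst c : has_mean Q (fun=> c) c.
Proof.
split; last exact: expectation_cst.
by apply: (@finite_measure_integrable_cst _ _ _ Q setT c).
Qed.

Lemma has_meanD X Y a b : has_mean Q X a -> has_mean Q Y b ->
  has_mean Q (fun s => X s + Y s) (a + b).
Proof.
move=> [iX EX] [iY EY]; split; first exact: (integrableD measurableT iX iY).
move: EX EY; rewrite unlock => EX EY.
under eq_integral do rewrite EFinD.
by rewrite (integralD measurableT iX iY) EX EY.
Qed.

Lemma has_meanZ X a c : has_mean Q X a -> has_mean Q (fun s => c * X s) (c * a).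
Proof.
move=> [iX EX]; split; first exact: (integrableZl measurableT c iX).
move: EX; rewrite unlock => EX.
under eq_integral do rewrite EFinM.
by rewrite (integralZl measurableT iX) EX.
Qed.

Lemma has_mean_dotp d (G : Xi -> 'rV[R]_d) (g h : 'rV[R]_d) :
  (forall i, has_mean Q (fun s => G s 0 i) (g 0 i)) ->
  has_mean Q (fun s => dotp h (G s)) (dotp h g).
Proof.
move=> Gg; rewrite /dotp; elim: (index_enum _) => [|i r IH].
  rewrite big_nil; under eq_fun do rewrite big_nil.
  exact: has_mean_cst.
rewrite big_cons; under eq_fun do rewrite big_cons.
by apply: has_meanD => //; exact: has_meanZ.
Qed.

Lemma has_mean_measurable X a : has_mean Q X a -> measurable_fun setT X.
Proof. by case=> /integrableP[/measurable_EFinP]. Qed.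

(** For small b the first-order term of expR_le_centered integrates to 0; for
    large b the square absorbs b X by Young's inequality. *)
Lemma subgaussian_laplace X sigma b : 0 < sigma ->
  has_mean Q X 0 ->
  (forall l, 0 < l < sigma ^- 2 ->
    (\int[Q]_s (expR (l * X s ^+ 2))%:E <= (expR (l * sigma ^+ 2))%:E)%E) ->
  (\int[Q]_s (expR (b * X s))%:E <= (expR (2 * b ^+ 2 * sigma ^+ 2))%:E)%E.
Proof.
move=> sg0 X0 Xexp; have mX := has_mean_measurable X0.
have s2 : 0 < sigma ^+ 2 by rewrite exprn_gt0.
have [->|b0] := eqVneq b 0.
  rewrite expr0n/= mulr0 mul0r; under eq_integral do rewrite mul0r.
  by rewrite integral_real_cst.
have b2 : 0 < b ^+ 2 by rewrite exprn_even_gt0.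
have [small|large] := ltP (2 * b ^+ 2) (sigma ^- 2).
  have l0 : 0 < 2 * b ^+ 2 < sigma ^- 2 by rewrite small mulr_gt0.
  apply: le_trans (Xexp _ l0).
  have [ibX EbX] := has_meanZ b X0.
  have me : measurable_fun setT (fun s => expR (2 * b ^+ 2 * X s ^+ 2)) by mfun.
  have ie : Q.-integrable setT (fun s => (expR (2 * b ^+ 2 * X s ^+ 2))%:E).
    apply/integrableP; split; first exact/measurable_EFinP.
    under eq_integral do rewrite /= ger0_norm ?expR_ge0//.
    exact: le_lt_trans (Xexp _ l0) (ltry _).
  apply: (@le_trans _ _
    (\int[Q]_s (b * X s + expR (2 * b ^+ 2 * X s ^+ 2))%:E)%E).
    apply: le_integral_real; [by mfun|by mfun|by move=> s; nonneg|].
    move=> s; have := expR_le_centered (b * X s).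
    by rewrite exprMn mulrA.
  under eq_integral do rewrite EFinD.
  rewrite (integralD measurableT ibX ie).
  by move: EbX; rewrite unlock mulr0 => ->; rewrite add0e.
pose l := (4 * sigma ^+ 2)^-1.
have l0 : 0 < l < sigma ^- 2.
  by rewrite invr_gt0 mulr_gt0//= ltf_pV2 ?posrE ?mulr_gt0//; lra.
have ls : l * sigma ^+ 2 = 4^-1 by rewrite /l; field; rewrite gt_eqF.
have bs : 1 <= 2 * b ^+ 2 * sigma ^+ 2.
  by rewrite -ler_pdivrMr// div1r.
apply: (@le_trans _ _ (\int[Q]_s (expR (b ^+ 2 * sigma ^+ 2) * expR (l * X s ^+ 2))%:E)%E).
  apply: le_integral_real; [by mfun|by mfun|by move=> s; nonneg|].
  move=> s; rewrite -expRD ler_expR.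
  have := sqr_ge0 (b * sigma - X s / (2 * sigma)).
  have -> : (b * sigma - X s / (2 * sigma)) ^+ 2 =
    b ^+ 2 * sigma ^+ 2 + l * X s ^+ 2 - b * X s.
    by rewrite /l; field; rewrite gt_eqF.
  by lra.
rewrite integral_realZ; [|exact: expR_ge0|by mfun|by move=> s; nonneg].
apply: (@le_trans _ _ ((expR (b ^+ 2 * sigma ^+ 2))%:E * (expR (l * sigma ^+ 2))%:E)%E).
  by rewrite lee_wpmul2l ?lee_fin ?expR_ge0//; exact: Xexp.
by rewrite -EFinM lee_fin -expRD ler_expR ls; lra.
Qed.

End subgaussian.

(** * Smooth functions and the two-point difference *)

Section smooth_functions.
Context {R : realType} {d : nat}.
Implicit Types (f h : 'rV[R]_d -> R) (x y z v : 'rV[R]_d) (L mu : R).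

Lemma diff_dotp_grad h x z : differentiable h x -> 'd h x z = dotp (grad h x) z.
Proof.
move=> dh; rewrite [in LHS](row_sum_delta z) linear_sum /dotp.
by apply: eq_bigr => i _; rewrite linearZ/= mxE mulrC.
Qed.

(** Strong convexity bounds f below by a parabola around x, whose minimum is
    f x - |grad f x|^2 / (2 mu). *)
Lemma polyak_lojasiewicz f L mu x y : 0 < mu -> smooth_strongly_convex L mu f ->
  2 * mu * (f x - f y) <= dotp (grad f x) (grad f x).
Proof.
move=> mu0 [_ /(_ x y)[+ _]]; rewrite enorm_sqr.
move: (grad f x) (y - x) => g z H.
have := dotp_ge0 (g + mu *: z).
rewrite !(dotpDl, dotpDr, dotpZl, dotpZr) (dotpC z g); move: H.
set a := dotp g z; set b := dotp z z; set c := dotp g g => H.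
move: (f x) (f y) H => p q H H1.
have : mu * (p + a + mu / 2 * b) <= mu * q by rewrite ler_pM2l.
by lra.
Qed.

Lemma smooth_strongly_convex_continuous f L mu :
  smooth_strongly_convex L mu f -> continuous f.
Proof. by move=> [df _] x; exact: differentiable_continuous. Qed.

Lemma is_derive_line h x z (t : R) : (forall y, differentiable h y) ->
  is_derive (t : R^o) 1 (fun t : R^o => h (x + t *: z))
    (dotp (grad h (x + t *: z)) z).
Proof.
move=> dh.
have dl : is_diff (t : R^o) (cst x + ( *:%R^~ z)) (0 + ( *:%R^~ z)).
  by apply: is_diffD.
have dc : is_diff (t : R^o) (h \o (cst x + ( *:%R^~ z)))
    ('d h (x + t *: z) \o (0 + ( *:%R^~ z))).
  by apply: is_diff_comp; exact: differentiableP.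
apply: DeriveDef; first by apply: diff_derivable; exact: ex_diff.
rewrite deriveE; last exact: ex_diff.
rewrite (_ : (fun _ => _) = h \o (cst x + ( *:%R^~ z)))//.
by rewrite diff_val/= add0r scale1r diff_dotp_grad.
Qed.

(** The derivative of t |-> h (x + t z) - h (x - t z) - 2 t <grad h x, z> is at
    most 2 L |z|^2 on [0, 1] because the gradient is Lipschitz. *)
Lemma two_point_error h L x z : 0 <= L -> lipschitz_gradient L h ->
  `|h (x + z) - h (x - z) - 2 * dotp (grad h x) z| <= 2 * L * dotp z z.
Proof.
move=> L0 [dh lip].
pose phi (t : R^o) : R^o := h (x + t *: z) - h (x + t *: (- z))
  - t * (2 * dotp (grad h x) z).
pose dphi (t : R) : R := dotp (grad h (x + t *: z) - grad h x) z
  + dotp (grad h (x + t *: (- z)) - grad h x) z.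
have dphiP (t : R) : is_derive (t : R^o) 1 phi (dphi t).
  have d1 := is_derive_line x z t dh.
  have d2 := is_derive_line x (- z) t dh.
  have d3 : is_derive (t : R^o) 1 (fun t : R^o => t * (2 * dotp (grad h x) z) : R^o)
     (2 * dotp (grad h x) z).
    have := is_deriveM (is_derive_id (t : R^o) 1)
      (is_derive_cst (2 * dotp (grad h x) z : R^o) (t : R^o) 1).
    by move/is_derive_eq; apply; rewrite scaler0 add0r; exact: mulr1.
  have dd := is_deriveB (is_deriveB d1 d2) d3.
  apply: (is_derive_eq dd).
  rewrite /dphi; move: (grad h (x + t *: z)) (grad h (x + t *: - z)) (grad h x).
  move=> A B C; rewrite !dotpDl !dotpNl dotpNr.
  move: (dotp A z) (dotp B z) (dotp C z) => a b c.
  have e (p q r : R) : p - (- q) - 2 * r = p - r + (q - r) by ring.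
  exact: e.
have cphi : {within `[0, 1], continuous phi}.
  apply: continuous_subspaceT => t; apply: differentiable_continuous.
  by apply/derivable1_diffP; exact: ex_derive.
have [t t01] := MVT_segment ler01 (fun t _ => dphiP t) cphi.
rewrite /phi !scale1r !scale0r !addr0 subrr mul0r mul1r !subr0 mulr1 => ->.
move: t01; rewrite in_itv/= => /andP[t0 t1].
have bound (w : 'rV[R]_d) : dotp w w = dotp z z ->
    `|dotp (grad h (x + t *: w) - grad h x) z| <= L * dotp z z.
  move=> wz; rewrite -(@ler_pXn2r _ 2%N)// ?nnegrE ?mulr_ge0 ?dotp_ge0//.
  rewrite -normrX ger0_norm ?sqr_ge0//; apply: le_trans (cauchy_schwarz _ _) _.
  have := lip (x + t *: w) x.
  have -> : x + t *: w - x = t *: w by rewrite addrC addKr.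
  move=> lp.
  have : enorm (grad h (x + t *: w) - grad h x) ^+ 2 <= (L * enorm (t *: w)) ^+ 2.
    by rewrite ler_pXn2r// ?nnegrE ?mulr_ge0 ?enorm_ge0.
  rewrite exprMn !enorm_sqr dotpZl dotpZr wz => H.
  rewrite exprMn [X in _ <= _ * X]expr2 mulrA ler_wpM2r ?dotp_ge0//.
  apply: le_trans H _; rewrite ler_wpM2l ?sqr_ge0// mulrA -[leRHS]mul1r.
  by rewrite ler_wpM2r ?dotp_ge0//; nra.
rewrite /dphi; apply: le_trans (ler_normD _ _) _.
have := bound z erefl; have := bound (- z).
rewrite dotpNl dotpNr opprK => /(_ erefl) b2 b1.
have -> : 2 * L * dotp z z = L * dotp z z + L * dotp z z by ring.
exact: lerD b1 b2.
Qed.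

End smooth_functions.

(** * The decrease of the objective along one step *)

Section descent.
Context {R : realType} {d : nat}.
Implicit Types (x y v g N : 'rV[R]_d) (L mu a alpha w : R).

(** p and n stand for the components of the gradient and of the noise along the
    direction and e for the error of the two-point difference. Young's
    inequality leaves the product p n alone: it has mean 0, and bounding it by
    squares would cost a term of order n^2 without the factor L a. *)
Lemma descent_scalar L a p n e : 0 < a -> 0 <= L -> a * L <= 1 / 8 ->
  - (a * p * (p + n + e)) + L / 2 * a ^+ 2 * (p + n + e) ^+ 2 <=
  - (3 / 4 * a * p ^+ 2) - a * (p * n) + 3 / 2 * L * a ^+ 2 * n ^+ 2
  + 5 * a * e ^+ 2 :> R.
Proof.
move=> a0 L0 aL.
have sq : (p + n + e) ^+ 2 <= 3 * (p ^+ 2 + n ^+ 2 + e ^+ 2).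
  by have := sqr_ge0 (p - n); have := sqr_ge0 (n - e); have := sqr_ge0 (p - e); lra.
have c0 : 0 <= L / 2 * a ^+ 2 by rewrite mulr_ge0 ?sqr_ge0// divr_ge0.
have := ler_wpM2l c0 sq.
have La p' : L / 2 * a ^+ 2 * (3 * p' ^+ 2) <= a * (3 / 16 * p' ^+ 2).
  have -> : L / 2 * a ^+ 2 * (3 * p' ^+ 2) = a * (a * L * (3 / 2 * p' ^+ 2)) by ring.
  rewrite ler_wpM2l ?(ltW a0)//.
  have := sqr_ge0 p'; move: (p' ^+ 2) => z z0.
  have := ler_wpM2r (mulr_ge0 (ltW (ltr0n R 3)) z0) aL; lra.
have := La p; have := La e.
have : 0 <= a * (p / 4 + 2 * e) ^+ 2 by rewrite mulr_ge0 ?sqr_ge0// ltW.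
have : 0 <= a * e ^+ 2 by rewrite mulr_ge0 ?sqr_ge0// ltW.
by lra.
Qed.

(** One step along a direction v moves by a multiple of v alone, so only the
    components of the gradient and of the noise along v enter. *)
Lemma descent_step f (F : 'rV[R]_d -> R) L mu alpha w x v (t0 : R) (t : nat) :
  0 < mu -> mu <= L -> 0 < alpha -> (0 < d)%N ->
  w = t%:R + t0 -> 32 * d%:R * L / mu <= w ->
  smooth_strongly_convex L mu f -> lipschitz_gradient L F ->
  let a := 4 * d%:R / (mu * w) in
  let g := grad f x in
  let N := grad F x - g in
  let ri := (dotp v v)^-1 in
  f (x - step_size mu t0 t v *: two_point_estimator F alpha x v) <=
  f x - 3 / 4 * a * (dotp g v ^+ 2 * ri) - a * (dotp g v * dotp N v * ri)
  + 3 / 2 * L * a ^+ 2 * (dotp N v ^+ 2 * ri)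
  + 5 * a * (L ^+ 2 * alpha ^+ 2 * dotp v v).
Proof.
move=> mu0 muL al0 d0 wE wL fs Fl; lazy zeta.
set a := 4 * d%:R / (mu * w); set g := grad f x; set N := grad F x - g.
set ri := (dotp v v)^-1.
have L0 : 0 < L by apply: lt_le_trans muL.
have dR : 0 < d%:R :> R by rewrite ltr0n.
have w0 : 0 < w by apply: lt_le_trans wL; rewrite divr_gt0// !mulr_gt0.
have a0 : 0 < a by rewrite divr_gt0// mulr_gt0.
have aL : a * L <= 1 / 8.
  rewrite /a mulrAC ler_pdivrMr ?mulr_gt0//.
  by move: wL; rewrite ler_pdivrMr//; lra.
have [v0|v0] := eqVneq (dotp v v) 0.
  rewrite (dotp_eq0 v0) /two_point_estimator !scaler0 subr0.
  by rewrite /ri !dotp0 !expr0n/= !(mul0r, mulr0, subr0, addr0).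
have r0 : 0 < dotp v v by rewrite lt_neqAle eq_sym v0 dotp_ge0.
set r := dotp v v in v0 r0 ri *.
pose kap := (F (x + alpha *: v) - F (x - alpha *: v)) / (2 * alpha).
pose e := kap - dotp (grad F x) v.
have e2 : e ^+ 2 <= (L * alpha * r) ^+ 2.
  have := two_point_error x (alpha *: v) (ltW L0) Fl.
  rewrite !(dotpZl, dotpZr) -/r => H.
  have -> : e = (F (x + alpha *: v) - F (x - alpha *: v)
     - 2 * (alpha * dotp (grad F x) v)) / (2 * alpha).
    by rewrite /e /kap; field; rewrite gt_eqF.
  rewrite -real_normK ?num_real// normrM (ger0_norm (x := (2 * alpha)^-1)); last first.
    by rewrite invr_ge0 mulr_ge0// ltW.
  rewrite ler_pXn2r// ?nnegrE ?mulr_ge0 ?invr_ge0 ?mulr_ge0 ?(ltW L0) ?(ltW al0) ?(ltW r0)//.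
  rewrite ler_pdivrMr ?mulr_gt0//.
  by apply: le_trans H _; rewrite le_eqVlt; apply/orP; left; apply/eqP; ring.
set y := x - _.
have yx : y - x = (- (a * ri * kap)) *: v.
  rewrite /y /two_point_estimator /step_size -wE enorm_sqr -/r -/kap.
  rewrite addrC addKr scalerA -scaleNr; congr (_ *: _); rewrite /a /ri.
  by field; rewrite !gt_eqF.
have [_ /(_ x y)[_ fy]] := fs.
apply: le_trans fy _; rewrite yx enorm_sqr !(dotpZl, dotpZr) -/g -/r.
pose p := dotp g v; pose n := dotp N v.
have kE : kap = p + n + e.
  by rewrite /e /n /N dotpDl dotpNl -/p !subrKC.
have := descent_scalar p n e a0 (ltW L0) aL; rewrite -kE => H.
have ri0 : 0 < ri by rewrite invr_gt0.
have rr : ri * r = 1 by rewrite mulVf.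
have {}H := ler_wpM2l (ltW ri0) H.
have e3 : ri * (5 * a * e ^+ 2) <= 5 * a * (L ^+ 2 * alpha ^+ 2 * r).
  have -> : 5 * a * (L ^+ 2 * alpha ^+ 2 * r) = ri * (5 * a * (L * alpha * r) ^+ 2).
    have -> : ri * (5 * a * (L * alpha * r) ^+ 2) =
       (ri * r) * (5 * a * (L ^+ 2 * alpha ^+ 2 * r)) by ring.
    by rewrite rr mul1r.
  by rewrite ler_wpM2l ?(ltW ri0)// ler_wpM2l// mulr_ge0// ltW.
have -> : L / 2 * (- (a * ri * kap) * (- (a * ri * kap) * r)) =
   (ri * r) * (ri * (L / 2 * a ^+ 2 * kap ^+ 2)) by ring.
rewrite rr mul1r -/p -/n.
lra.
Qed.

End descent.

(** * Exponential moments of one step *)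

Section one_step.
Context {R : realType} {d : nat} {dX : measure_display} {Xi : measurableType dX}.
Variables (gam : probability 'rV[R]_d R) (Q : probability Xi R).
Hypothesis gam_normal : std_gaussian_law gam.
Hypothesis d_gt0 : (0 < d)%N.
Variables (N : Xi -> 'rV[R]_d) (g : 'rV[R]_d) (L mu sigma alpha : R).
Hypothesis sigma_gt0 : 0 < sigma.
Hypothesis mu_gt0 : 0 < mu.
Hypothesis L_gt0 : 0 < L.
Hypothesis N_mean : forall i, has_mean Q (fun s => N s 0 i) 0.
Hypothesis N_expR : forall l, 0 < l < sigma ^- 2 ->
  (\int[Q]_s (expR (l * dotp (N s) (N s)))%:E <= (expR (l * sigma ^+ 2))%:E)%E.

Let dR : 0 < d%:R :> R. Proof. by rewrite ltr0n. Qed.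

Let mN : measurable_fun setT N.
Proof. by apply: measurable_fun_rV => i; exact: has_mean_measurable (N_mean i). Qed.

Let mNN : measurable_fun setT (fun s => dotp (N s) (N s)).
Proof. exact: measurable_dotp. Qed.

Let mfst : measurable_fun setT (fst : 'rV[R]_d * Xi -> 'rV[R]_d).
Proof. exact: measurable_fst. Qed.

Let mNsnd : measurable_fun setT (fun p : 'rV[R]_d * Xi => N p.2).
Proof. exact: (measurableT_comp mN measurable_snd). Qed.

Let mri : measurable_fun setT (fun p : 'rV[R]_d * Xi => (dotp p.1 p.1)^-1).
Proof. by apply: (measurableT_comp (@measurable_invr R)); exact: measurable_dotp. Qed.

Let mr : measurable_fun setT (fun p : 'rV[R]_d * Xi => dotp p.1 p.1).
Proof. exact: measurable_dotp. Qed.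

Let mg : measurable_fun setT (fun p : 'rV[R]_d * Xi => dotp g p.1).
Proof. by apply: measurable_dotp => //; exact: measurable_cst. Qed.

Let mn : measurable_fun setT (fun p : 'rV[R]_d * Xi => dotp (N p.2) p.1).
Proof. exact: measurable_dotp. Qed.

Let mi := @measurable_invr_dotp R d.

Let mg1 : measurable_fun setT (fun v : 'rV[R]_d => dotp g v).
Proof. by apply: measurable_dotp; [exact: measurable_cst|exact: measurable_id]. Qed.

Let tonelli (E : 'rV[R]_d * Xi -> R) :
  measurable_fun setT E -> (forall p, 0 <= E p) ->
  (\int[gam \x Q]_p (E p)%:E = \int[gam]_v \int[Q]_s (E (v, s))%:E)%E.
Proof.
move=> mE E0; by rewrite fubini_tonelli1//; exact/measurable_EFinP.
Qed.

Let integral_fst (E : 'rV[R]_d -> R) :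
  measurable_fun setT E -> (forall v, 0 <= E v) ->
  (\int[gam \x Q]_p (E p.1)%:E = \int[gam]_v (E v)%:E)%E.
Proof.
move=> mE E0; rewrite tonelli//; last exact: (measurableT_comp mE mfst).
by apply: eq_integral => v _ /=; rewrite integral_real_cst.
Qed.

(** The mean of p^2 is |g|^2 / d, at least 2 mu D / d, and the Laplace bound for
    the projection makes this mean effective in the exponent. The coefficient
    is first lowered to k1, for which k1 |g|^2 / d is exactly 16 k D, so that
    the Laplace bound is used in its range. *)
Lemma drift_term D k k0 : 0 <= D -> 0 <= k0 -> 2 * mu * D <= dotp g g ->
  16 * (k * D) <= 120^-1 -> 0 <= k -> 8 * k * d%:R / mu <= k0 ->
  (\int[gam \x Q]_p
     (expR (4 * (k * D) - k0 * (dotp g p.1 ^+ 2 * (dotp p.1 p.1)^-1)))%:E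
   <= 1)%E.
Proof.
move=> D0 k00 gD kD k_ge0 kk.
have mexp : measurable_fun setT (fun v : 'rV[R]_d =>
    expR (4 * (k * D) - k0 * (dotp g v ^+ 2 * (dotp v v)^-1))).
  apply: (measurableT_comp (@measurable_expR R)).
  by apply: measurable_funB; mfun.
rewrite (integral_fst (E := fun v => expR (4 * (k * D) - k0 * (dotp g v ^+ 2 * (dotp v v)^-1))))//.
have kD0 : 0 <= k * D by rewrite mulr_ge0.
have [g0|g0] := eqVneq (dotp g g) 0.
  have DE : D = 0.
    by apply/le_anti; rewrite D0 andbT -(pmulr_rle0 _ (mulr_gt0 (ltr0n R 2) mu_gt0)) -g0.
  rewrite DE !mulr0 -[leRHS](integral_real_cst gam 1).
  apply: le_integral_real; [|by mfun|by move=> v; nonneg|].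
    by move: mexp; rewrite DE !mulr0.
  move=> v; rewrite (dotp_eq0 g0) dotpC dotp0 expr0n mul0r mulr0 subr0 expR0//.
have gp : 0 < dotp g g by rewrite lt_neqAle eq_sym g0 dotp_ge0.
pose k1 := 16 * (k * D) * d%:R / dotp g g.
have k10 : 0 <= k1 by rewrite divr_ge0 ?(ltW gp)// mulr_ge0 ?(ltW dR)// mulr_ge0.
have k1d : k1 * dotp g g / d%:R = 16 * (k * D) by rewrite /k1; field; rewrite g0 gt_eqF.
have k1k : k1 <= k0.
  apply: le_trans kk; rewrite /k1 ler_pdivrMr//.
  have -> : 16 * (k * D) * d%:R = 8 * k * d%:R / mu * (2 * mu * D).
    by field; rewrite gt_eqF.
  by rewrite ler_wpM2l// divr_ge0 ?(ltW mu_gt0)// !mulr_ge0// ltW.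
pose E v := expR (- (k1 * dotp g v ^+ 2 * (dotp v v)^-1)).
have mE : measurable_fun setT E.
  apply: (measurableT_comp (@measurable_expR R)).
  apply: (@measurable_funN _ _ _ setT (fun v => k1 * dotp g v ^+ 2 * (dotp v v)^-1)).
  by mfun.
apply: (@le_trans _ _ (\int[gam]_v (expR (4 * (k * D)) * E v)%:E)%E).
  apply: le_integral_real => //; [by mfun|].
  move=> v; rewrite /E -expRD ler_expR lerD2l lerN2 -mulrA ler_wpM2r//.
  by rewrite mulr_ge0 ?sqr_ge0// invr_ge0 dotp_ge0.
rewrite integral_realZ; [|exact: expR_ge0|by []|by move=> v; exact: expR_ge0].
apply: (@le_trans _ _ ((expR (4 * (k * D)))%:E * (1 - 4 * (k * D))%:E)%E).
  rewrite lee_wpmul2l ?lee_fin ?expR_ge0//.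
  have := gaussian_projection_laplace gam_normal d_gt0 (h := g) k10.
  rewrite k1d => /(_ kD).
  by have -> : k1 * dotp g g / (4 * d%:R) = 4 * (k * D)
    by rewrite /k1; field; rewrite g0 gt_eqF.
rewrite -EFinM lee_fin -[leRHS]expR0 -(subrr (4 * (k * D))) expRD.
by rewrite ler_wpM2l ?expR_ge0// expR_ge1Dx.
Qed.

(** For a fixed direction the noise component is centered, and the drift
    proportional to p^2 pays for its sub-Gaussian variance, which is also
    proportional to p^2. *)
Lemma martingale_term k0 : 0 <= k0 -> 32 * k0 * sigma ^+ 2 <= 1 ->
  (\int[gam \x Q]_p
     (expR (- (4 * k0 * (dotp g p.1 * dotp (N p.2) p.1 * (dotp p.1 p.1)^-1)
               + k0 * (dotp g p.1 ^+ 2 * (dotp p.1 p.1)^-1))))%:E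
   <= 1)%E.
Proof.
move=> k00 ks.
have mE : measurable_fun setT (fun p : 'rV[R]_d * Xi =>
   expR (- (4 * k0 * (dotp g p.1 * dotp (N p.2) p.1 * (dotp p.1 p.1)^-1)
               + k0 * (dotp g p.1 ^+ 2 * (dotp p.1 p.1)^-1)))).
  apply: (measurableT_comp (@measurable_expR R)).
  apply: (@measurable_funN _ _ _ setT (fun p : 'rV[R]_d * Xi =>
   4 * k0 * (dotp g p.1 * dotp (N p.2) p.1 * (dotp p.1 p.1)^-1)
               + k0 * (dotp g p.1 ^+ 2 * (dotp p.1 p.1)^-1))).
  by mfun.
rewrite tonelli//.
rewrite -[leRHS](integral_real_cst gam 1).
apply: ge0_le_integral => //.
- by move=> v _; apply: integral_real_ge0 => s; exact: expR_ge0.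
- apply: (measurable_fun_fubini_tonelli_F (fun p => (expR (- (4 * k0 * (dotp g p.1 * dotp (N p.2) p.1 * (dotp p.1 p.1)^-1)
               + k0 * (dotp g p.1 ^+ 2 * (dotp p.1 p.1)^-1))))%:E)).
    exact/measurable_EFinP.
  by move=> p; rewrite lee_fin expR_ge0.
move=> v _ /=.
pose h := (enorm v)^-1 *: v.
have hE x y : dotp x v * dotp y v * (dotp v v)^-1 = dotp x h * dotp y h.
  rewrite /h !dotpZr -enorm_sqr -exprVn; ring.
pose b := - (4 * k0 * dotp g h).
have hh : dotp h h <= 1.
  rewrite /h dotpZl dotpZr mulrA -expr2 exprVn enorm_sqr.
  have [->|v0] := eqVneq (dotp v v) 0; first by rewrite mulr0.
  by rewrite mulVf.
pose X s := dotp h (N s).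
have X0 : has_mean Q X 0.
  rewrite -(dotp0 h); apply: has_mean_dotp => i; rewrite mxE; exact: N_mean.
have mX := has_mean_measurable X0.
have Xexp l : 0 < l < sigma ^- 2 ->
    (\int[Q]_s (expR (l * X s ^+ 2))%:E <= (expR (l * sigma ^+ 2))%:E)%E.
  move=> l0; apply: le_trans (N_expR l0).
  apply: le_integral_real; [by mfun|by mfun|by move=> s; nonneg|].
  move=> s; rewrite ler_expR ler_wpM2l//; first by case/andP: l0 => /ltW.
  apply: le_trans (cauchy_schwarz _ _) _.
  by rewrite -[leRHS]mul1r ler_wpM2r// dotp_ge0.
have := subgaussian_laplace b sigma_gt0 X0 Xexp => H.
apply: (@le_trans _ _ (\int[Q]_s (expR (- (k0 * dotp g h ^+ 2)) * expR (b * X s))%:E)%E).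
  rewrite le_eqVlt; apply/orP; left; apply/eqP; apply: eq_integral => s _.
  rewrite -expRD; congr (expR _)%:E; rewrite expr2 !hE /b /X (dotpC (N s) h).
  by ring.
rewrite integral_realZ; [|exact: expR_ge0|by mfun|by move=> s; exact: expR_ge0].
apply: (@le_trans _ _ ((expR (- (k0 * dotp g h ^+ 2)))%:E * (expR (2 * b ^+ 2 * sigma ^+ 2))%:E)%E).
  by rewrite lee_wpmul2l// lee_fin expR_ge0.
rewrite -EFinM lee_fin -expRD -[leRHS]expR0 ler_expR.
have -> : 2 * b ^+ 2 * sigma ^+ 2 = (32 * k0 * sigma ^+ 2) * (k0 * dotp g h ^+ 2).
  by rewrite /b; ring.
rewrite addrC subr_le0 -[leRHS]mul1r ler_wpM2r//.
by apply: mulr_ge0 => //; exact: sqr_ge0.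
Qed.

(** Integrating the direction first keeps the factor 1/d: only the component of
    the noise along the direction contributes. *)
Lemma noise_term k : 0 < k -> k * sigma ^+ 2 <= 1 / 2 ->
  (\int[gam \x Q]_p
     (expR (k * (dotp (N p.2) p.1 ^+ 2 * (dotp p.1 p.1)^-1)))%:E
   <= (1 + 2 * (k * sigma ^+ 2) / d%:R)%:E)%E.
Proof.
move=> k0 ks.
have s2 : 0 < sigma ^+ 2 by rewrite exprn_gt0.
have mE : measurable_fun setT (fun p : 'rV[R]_d * Xi =>
   (expR (k * (dotp (N p.2) p.1 ^+ 2 * (dotp p.1 p.1)^-1)))%:E).
  by apply/measurable_EFinP; mfun.
have E0 (p : 'rV[R]_d * Xi) : (0 <=
   (expR (k * (dotp (N p.2) p.1 ^+ 2 * (dotp p.1 p.1)^-1)))%:E)%E.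
  by rewrite lee_fin expR_ge0.
rewrite fubini_tonelli2//.
have c0 : 0 <= 1 - d%:R^-1 :> R.
  by rewrite subr_ge0 invf_le1// ler1n.
have dV : 0 <= d%:R^-1 :> R by rewrite invr_ge0 ltW.
apply: (@le_trans _ _ (\int[Q]_s (1 - d%:R^-1 + d%:R^-1 * expR (k * dotp (N s) (N s)))%:E)%E).
  apply: ge0_le_integral => //.
  - by move=> s _; apply: integral_ge0 => v _; exact: E0.
  - exact: measurable_fun_fubini_tonelli_G.
  - by apply/measurable_EFinP; mfun.
  move=> s _; have := gaussian_projection_expR gam_normal d_gt0 (N s) (ltW k0).
  by rewrite /fubini_G => /le_trans; apply; rewrite lee_fin; lra.
rewrite integral_realD; [|by mfun|by mfun|by []|by move=> s; nonneg].
rewrite integral_realZ; [|by []|by mfun|by move=> s; nonneg].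
have kl : 0 < k < sigma ^- 2.
  by rewrite k0/= -div1r ltr_pdivlMr//; apply: le_lt_trans ks _; lra.
rewrite integral_real_cst.
apply: (@le_trans _ _ ((1 - d%:R^-1)%:E + d%:R^-1%:E * (expR (k * sigma ^+ 2))%:E)%E).
  by rewrite leeD2l// lee_wpmul2l//; exact: N_expR.
rewrite -EFinM -EFinD lee_fin.
have ex : expR (k * sigma ^+ 2) <= 1 + 2 * (k * sigma ^+ 2).
  move: ks; set y := k * _ => y2.
  have y0 : 0 <= y by rewrite mulr_ge0// ltW.
  have q0 : 0 < 1 - y by lra.
  have := expR_ge1Dx (- y); rewrite expRN => ey.
  have e0 := expR_gt0 y.
  have : expR y * (1 - y) <= 1.
    by rewrite -[leRHS](mulfV (lt0r_neq0 e0)) ler_wpM2l// ltW.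
  have : 1 <= (1 + 2 * y) * (1 - y) by nra.
  by move=> h1 h2; rewrite -(ler_pM2r q0); apply: le_trans h2 h1.
have := ler_wpM2l dV ex; rewrite mulrDr mulr1 => H.
have -> : 2 * (k * sigma ^+ 2) / d%:R = d%:R^-1 * (2 * (k * sigma ^+ 2)) by rewrite mulrC.
lra.
Qed.

Lemma bias_term s : 0 <= s -> s * d%:R <= 1 / 4 ->
  (\int[gam \x Q]_p (expR (s * dotp p.1 p.1))%:E <= (1 + 2 * (s * d%:R))%:E)%E.
Proof.
move=> s0 sd.
have mr1 : measurable_fun setT (fun v : 'rV[R]_d => dotp v v).
  by apply: measurable_dotp; exact: measurable_id.
rewrite (integral_fst (E := fun v => expR (s * dotp v v))).
- exact: gaussian_sqnorm_expR.
- by mfun.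
- by move=> v; exact: expR_ge0.
Qed.

Lemma expR_mean4 (a b c e : R) : expR (a + b + c + e) <=
  4^-1 * expR (4 * a) + (4^-1 * expR (4 * b) + (4^-1 * expR (4 * c) + 4^-1 * expR (4 * e))).
Proof.
(* tangent at the mean exponent *)
have t (m y : R) : expR m * (1 + (4 * y - m)) <= expR (4 * y).
  rewrite -[X in _ <= expR X](subrKC m) expRD ler_wpM2l ?expR_ge0//.
  exact: expR_ge1Dx.
have := t (a + b + c + e) a; have := t (a + b + c + e) b.
have := t (a + b + c + e) c; have := t (a + b + c + e) e.
by move: (expR (a + b + c + e)) => z; lra.
Qed.

(** Drift, martingale, noise and bias are separated by convexity of the
    exponential, so that each can be integrated in its own order; the drift
    3/4 p^2 is divided between the first two, 1/2 against the growth of the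
    weight and 1/4 against the martingale term. *)
Lemma one_step_integral D k A a : 0 <= D -> 0 < k -> 0 < A -> 0 < a ->
  2 * mu * D <= dotp g g -> 16 * (k * D) <= 120^-1 -> 4 * d%:R / mu <= A ->
  32 * (k * A) * sigma ^+ 2 <= 1 ->
  6 * k * A * L * a * sigma ^+ 2 <= 1 / 2 ->
  20 * k * A * L ^+ 2 * alpha ^+ 2 * d%:R <= 1 / 4 ->
  (\int[gam \x Q]_p (expR (k * (D + A * (
      - (3 / 4 * (dotp g p.1 ^+ 2 * (dotp p.1 p.1)^-1))
      - dotp g p.1 * dotp (N p.2) p.1 * (dotp p.1 p.1)^-1
      + 3 / 2 * L * a * (dotp (N p.2) p.1 ^+ 2 * (dotp p.1 p.1)^-1)
      + 5 * (L ^+ 2 * alpha ^+ 2 * dotp p.1 p.1)))))%:E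
   <= (expR (6 * k * A * L * a * sigma ^+ 2 / (2 * d%:R)
            + 20 * k * A * L ^+ 2 * alpha ^+ 2 * d%:R / 2))%:E)%E.
Proof.
move=> D0 k0 A0 a0 gD kD dA kA k3 s4.
have kA0 : 0 < k * A by rewrite mulr_gt0.
have k30 : 0 < 6 * k * A * L * a by rewrite !mulr_gt0.
have s40 : 0 <= 20 * k * A * L ^+ 2 * alpha ^+ 2.
  by nonneg.
pose p2 (p : 'rV[R]_d * Xi) := dotp g p.1 ^+ 2 * (dotp p.1 p.1)^-1.
pose pn (p : 'rV[R]_d * Xi) := dotp g p.1 * dotp (N p.2) p.1 * (dotp p.1 p.1)^-1.
pose n2 (p : 'rV[R]_d * Xi) := dotp (N p.2) p.1 ^+ 2 * (dotp p.1 p.1)^-1.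
have mp2 : measurable_fun setT p2 by rewrite /p2; mfun.
have mpn : measurable_fun setT pn by rewrite /pn; mfun.
have mn2 : measurable_fun setT n2 by rewrite /n2; mfun.
pose e1 p := expR (4 * (k * D) - 2 * (k * A) * p2 p).
pose e2 p := expR (- (4 * (k * A) * pn p + k * A * p2 p)).
pose e3 p := expR (6 * k * A * L * a * n2 p).
pose e4 (p : 'rV[R]_d * Xi) := expR (20 * k * A * L ^+ 2 * alpha ^+ 2 * dotp p.1 p.1).
have m1 : measurable_fun setT e1.
  apply: (measurableT_comp (@measurable_expR R)).
  by apply: measurable_funB; mfun.
have m2 : measurable_fun setT e2.
  apply: (measurableT_comp (@measurable_expR R)).
  apply: (@measurable_funN _ _ _ setT (fun p => 4 * (k * A) * pn p + k * A * p2 p)).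
  by mfun.
have m3 : measurable_fun setT e3 by rewrite /e3; mfun.
have m4 : measurable_fun setT e4 by rewrite /e4; mfun.
have i1 : (\int[gam \x Q]_p (e1 p)%:E <= 1)%E.
  apply: drift_term => //; [by rewrite mulr_ge0// ltW|exact: ltW|].
  have -> : 8 * k * d%:R / mu = 2 * k * (4 * d%:R / mu) by ring.
  by rewrite mulrA ler_wpM2l// mulr_ge0// ltW.
have i2 : (\int[gam \x Q]_p (e2 p)%:E <= 1)%E by apply: martingale_term => //; exact: ltW.
have i3 := noise_term k30 k3.
have i4 := bias_term s40 s4.
have q4 : 0 <= 4^-1 :> R by rewrite invr_ge0.
apply: (@le_trans _ _ (\int[gam \x Q]_p (4^-1 * e1 p + (4^-1 * e2 p
    + (4^-1 * e3 p + 4^-1 * e4 p)))%:E)%E).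
  apply: le_integral_real.
  - apply: (measurableT_comp (@measurable_expR R)).
    apply: measurable_funM; first exact: measurable_cst.
    apply: measurable_funD; first exact: measurable_cst.
    apply: measurable_funM; first exact: measurable_cst.
    apply: measurable_funD; last by mfun.
    apply: measurable_funD; last by mfun.
    apply: measurable_funB; last by mfun.
    apply: (@measurable_funN _ _ _ setT (fun p => 3 / 4 * p2 p)); by mfun.
  - by mfun.
  - by move=> p; exact: expR_ge0.
  move=> p.
  have -> : e1 p = expR (4 * (k * (D - A * p2 p / 2))) by rewrite /e1; congr expR; field.
  have -> : e2 p = expR (4 * (- (k * A * (pn p + p2 p / 4)))) by rewrite /e2; congr expR; field.
  have -> : e3 p = expR (4 * (k * A * (3 / 2 * L * a) * n2 p)) by rewrite /e3; congr expR; field.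
  have -> : e4 p = expR (4 * (k * A * (5 * (L ^+ 2 * alpha ^+ 2 * dotp p.1 p.1)))) by rewrite /e4; congr expR; ring.
  apply: le_trans (expR_mean4 _ _ _ _); rewrite ler_expR -/(p2 p) -/(pn p) -/(n2 p).
  by rewrite le_eqVlt; apply/orP; left; apply/eqP; field.
do 3 (rewrite integral_realD; [|by mfun|by mfun|by move=> v; nonneg|by move=> v; nonneg]).
do 4 (rewrite integral_realZ; [|by []|by []|by move=> v; exact: expR_ge0]).
have b1 := lee_wpmul2l (x := 4^-1%:E) q4 i1.
have b2 := lee_wpmul2l (x := 4^-1%:E) q4 i2.
have b3 := lee_wpmul2l (x := 4^-1%:E) q4 i3.
have b4 := lee_wpmul2l (x := 4^-1%:E) q4 i4.
apply: le_trans (leeD b1 (leeD b2 (leeD b3 b4))) _.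
rewrite -!EFinM -!EFinD lee_fin; apply: le_trans (expR_ge1Dx _).
set x := 6 * k * A * L * a * sigma ^+ 2; set y := 20 * k * A * L ^+ 2 * alpha ^+ 2 * d%:R.
have -> : x / (2 * d%:R) = x / d%:R / 2 by field; rewrite gt_eqF.
have -> : 2 * x / d%:R = 2 * (x / d%:R) by rewrite mulrA.
by lra.
Qed.

End one_step.

(** * Measures determined by rectangles *)

Section product_uniqueness.
Context {R : realType}.

Lemma eq_measure_rectangles (d1 d2 : measure_display) (T1 : measurableType d1)
    (T2 : measurableType d2) (m1 m2 : {measure set (T1 * T2) -> \bar R}) :
  (m1 setT < +oo)%E ->
  (forall A B, measurable A -> measurable B -> m1 (A `*` B) = m2 (A `*` B)) ->
  forall E, measurable E -> m1 E = m2 E.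
Proof.
move=> moo m12 E mE.
pose G : set (set (T1 * T2)) := [set A `*` B | A in measurable & B in measurable].
apply: (measure_unique G (fun=> setT)) => //.
- exact: measurable_prod_measurableType.
- move=> _ _ [A mA [B mB <-]] [A' mA' [B' mB' <-]].
  exists (A `&` A'); first exact: measurableI.
  exists (B `&` B'); first exact: measurableI.
  by rewrite setXI.
- by move=> _; exists setT => //; exists setT => //; rewrite setXTT.
- by rewrite bigcup_const//; exists 0%N.
- by move=> _ [A mA [B mB <-]]; exact: m12.
Qed.

Lemma eq_measure_rectangles3 (d1 d2 d3 : measure_display)
    (T1 : measurableType d1) (T2 : measurableType d2) (T3 : measurableType d3)
    (m1 m2 : {measure set (T1 * (T2 * T3)) -> \bar R}) :
  (m1 setT < +oo)%E ->
  (forall A B C, measurable A -> measurable B -> measurable C ->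
    m1 (A `*` (B `*` C)) = m2 (A `*` (B `*` C))) ->
  forall E, measurable E -> m1 E = m2 E.
Proof.
move=> moo m12; apply: eq_measure_rectangles => // A E mA mE.
have mA' : measurable (A `*` [set: T2 * T3]) by exact: measurableX.
have mrE (m : {measure set (T1 * (T2 * T3)) -> \bar R}) F :
    pushforward (mrestr m mA') snd F = m (A `*` F).
  rewrite /pushforward /mrestr; congr (m _).
  by apply/seteqP; split => [[x y] [/= Fy [Ax _]]|[x y] [/= Ax Fy]].
rewrite -!mrE.
apply: (@eq_measure_rectangles _ _ _ _ (pushforward (mrestr m1 mA') snd)
                               (pushforward (mrestr m2 mA') snd)) => //.
- apply: le_lt_trans moo; rewrite /= mrE; apply: le_measure => //; rewrite inE//.
- by move=> B C mB mC; rewrite /= !mrE m12.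
Qed.

End product_uniqueness.

(** * Recursions driven by independent noise *)

Section markov_chain.
Context {R : realType} {dW dE dU dX : measure_display}.
Context {W : measurableType dW} {E : measurableType dE}.
Context {U : measurableType dU} {Xi : measurableType dX}.
Variables (P : probability W R) (T : nat).
Variables (u : nat -> {RV P >-> U}) (xi : nat -> {RV P >-> Xi}).
Variables (phi : nat -> E -> U * Xi -> E) (x0 : E).
Hypothesis phi_meas :
  forall t, measurable_fun setT (fun p : E * (U * Xi) => phi t p.1 p.2).

Let noise : set (nat + nat) :=
  [set k : nat + nat | match k with inl t => t < T | inr t => t < T end]%N.
Let sys (k : nat + nat) : set (set W) :=
  match k with inl t => sigma_of (u t) | inr t => sigma_of (xi t) end.

Hypothesis indep : mutually_independent P noise sys.

Fixpoint chain (t : nat) (w : W) : E :=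
  if t is s.+1 then phi s (chain s w) (u s w, xi s w) else x0.

Lemma measurable_chain t : measurable_fun setT (chain t).
Proof.
elim: t => [|t IH]; first exact: measurable_cst.
have mY : measurable_fun setT (fun w => (chain t w, (u t w, xi t w))).
  by apply: measurable_fun_pair => //; exact: measurable_fun_pair.
exact: (measurableT_comp (phi_meas t) mY).
Qed.

Definition future (t : nat) : set (nat + nat) :=
  [set k : nat + nat | match k with inl s => t <= s < T | inr s => t <= s < T end]%N.

(* Events of u t and xi t are added to those of a finite family of later
   noise variables; as the result is again such a family, independence from
   the noise after t can be used at time t. *)
Let upd t (B : set U) (C : set Xi) (A : nat + nat -> set W) (k : nat + nat) :=
  match k with
  | inl s => if s == t then u t @^-1` B else A k
  | inr s => if s == t then xi t @^-1` C else A k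
  end.

Let ext t (J : {fset (nat + nat)}) : {fset (nat + nat)} :=
  (inl t |` (inr t |` J))%fset.

Let sys_measurable k S : sys k S -> measurable S.
Proof.
by case: k => t /= [A mA <-]; rewrite setTI; exact: measurable_funPTI.
Qed.

Let bigcap_measurable (J : {fset (nat + nat)}) A :
  (forall i, i \in J -> sys i (A i)) -> measurable (\bigcap_(i in [set` J]) A i).
Proof.
move=> AJ; apply: fin_bigcap_measurable => // i iJ.
by apply: (@sys_measurable i); exact: AJ.
Qed.

Let ext_facts t (J : {fset (nat + nat)}) B C (A : nat + nat -> set W) :
  (t < T)%N -> [set` J] `<=` future t.+1 ->
  measurable B -> measurable C -> (forall i, i \in J -> sys i (A i)) ->
  [/\ [set` ext t J] `<=` future t,
      (forall i, i \in ext t J -> sys i (upd t B C A i)),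
      \bigcap_(i in [set` ext t J]) upd t B C A i =
        u t @^-1` B `&` (xi t @^-1` C) `&` \bigcap_(i in [set` J]) A i &
      (\prod_(i <- ext t J) P (upd t B C A i) =
        P (u t @^-1` B) * (P (xi t @^-1` C) * \prod_(i <- J) P (A i)))%E].
Proof.
move=> tT Jfut mB mC AJ.
have neq k : k \in J -> (inl t != k) /\ (inr t != k).
  move=> kJ; have := Jfut _ kJ; case: k {kJ} => s /= /andP[ts _]; split => //;
    by apply/eqP => -[st]; move: ts; rewrite st ltnn.
have updJ k : k \in J -> upd t B C A k = A k.
  move=> /neq; case: k => s /= [n1 n2].
    by rewrite (_ : (s == t) = false)//; apply/eqP => st; rewrite st eqxx in n1.
  by rewrite (_ : (s == t) = false)//; apply/eqP => st; rewrite st eqxx in n2.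
split.
- move=> k /=; rewrite !inE => /or3P[/eqP->|/eqP->|/Jfut] /=; rewrite ?leqnn//.
  by case: k => s /= /andP[/ltnW -> ->].
- move=> k; rewrite !inE => /or3P[/eqP->|/eqP->|kJ].
  + by rewrite /= eqxx; exists B => //; rewrite setTI.
  + by rewrite /= eqxx; exists C => //; rewrite setTI.
  + by rewrite updJ//; exact: AJ.
- apply/seteqP; split => w.
  + move=> H; split.
      split; first by have := H (inl t); rewrite /= !inE !eqxx; apply.
      by have := H (inr t); rewrite /= !inE !eqxx orbT; apply.
    by move=> k kJ; have := H k; rewrite updJ//; apply; rewrite /= !inE kJ !orbT.
  + move=> [[wB wC] wA] k; rewrite /= !inE => /or3P[/eqP->|/eqP->|kJ].
    * by rewrite /= eqxx.
    * by rewrite /= eqxx.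
    * by rewrite updJ//; exact: wA.
- have nl : inl t \notin (inr t |` J)%fset.
    by rewrite !inE negb_or /=; apply/negP => /neq[]; rewrite eqxx.
  have nr : inr t \notin J by apply/negP => /neq[_]; rewrite eqxx.
  rewrite big_fsetU1//= big_fsetU1//= !eqxx; congr (_ * (_ * _))%E.
  by apply: eq_big_seq => k kJ; rewrite updJ.
Qed.

(** The state at time t is a function of the noise before t. Propagating
    independence of X_t from the later noise along the recursion avoids
    describing the sigma-algebra of the past. *)
Lemma chain_independent t : (t <= T)%N ->
  forall (J : {fset (nat + nat)}) (A : nat + nat -> set W) (D : set E),
  [set` J] `<=` future t -> (forall i, i \in J -> sys i (A i)) -> measurable D ->
  (P (chain t @^-1` D `&` \bigcap_(i in [set` J]) A i) =
   P (chain t @^-1` D) * \prod_(i <- J) P (A i))%E.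
Proof.
elim: t => [_|t IH tT] J A D Jfut AJ mD.
  have JP : P (\bigcap_(i in [set` J]) A i) = (\prod_(i <- J) P (A i))%E.
    apply: indep => // k /Jfut; case: k => s /=; by case/andP.
  have [Dx|Dx] := pselect (D x0).
    rewrite (_ : chain 0 @^-1` D = setT); last by apply/seteqP; split.
    by rewrite setTI probability_setT mul1e.
  rewrite (_ : chain 0 @^-1` D = set0); last by apply/seteqP; split.
  by rewrite set0I !measure0 mul0e.
have {}IH := IH (ltnW tT).
set H := \bigcap_(i in [set` J]) A i.
have mH : measurable H by exact: bigcap_measurable.
pose Y w := (chain t w, (u t w, xi t w)).
have mY : measurable_fun setT Y.
  by apply: measurable_fun_pair; [exact: measurable_chain|exact: measurable_fun_pair].
pose c : {nonneg R} := NngNum (fine_ge0 (measure_ge0 P H)).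
have cE : c%:num%:E = P H by rewrite /= fineK// fin_num_measure.
have PJ : P H = (\prod_(i <- J) P (A i))%E.
  apply: indep => // k /Jfut; case: k => s /=; by case/andP.
have key F : measurable F -> P (Y @^-1` F `&` H) = (P (Y @^-1` F) * P H)%E.
  move=> mF.
  have -> : P (Y @^-1` F `&` H) = pushforward (mrestr P mH) Y F by [].
  have -> : (P (Y @^-1` F) * P H = mscale c (pushforward P Y) F)%E.
    by rewrite /mscale cE muleC.
  apply: (@eq_measure_rectangles3 _ _ _ _ _ _ _
    (pushforward (mrestr P mH) Y) (mscale c (pushforward P Y))) => //.
    rewrite /pushforward /mrestr; apply: le_lt_trans (ltry 1).
    by apply: probability_le1; apply: measurableI => //; rewrite preimage_setT.
  move=> X B C mX mB mC.
  have [f1 f2 f3 f4] := ext_facts tT Jfut mB mC AJ.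
  have noJ : [set` (fset0 : {fset (nat + nat)})] `<=` future t.+1 by move=> k /=; rewrite inE.
  have noA i : i \in (fset0 : {fset (nat + nat)}) -> sys i (A i) by rewrite inE.
  have [g1 g2 g3 g4] := ext_facts tT noJ mB mC noA.
  have E1 := IH _ _ _ f1 f2 mX; have E2 := IH _ _ _ g1 g2 mX.
  change (P (Y @^-1` (X `*` (B `*` C)) `&` H) =
    (c%:num%:E * P (Y @^-1` (X `*` (B `*` C))))%E); rewrite cE.
  rewrite (_ : Y @^-1` (X `*` (B `*` C)) `&` H =
     chain t @^-1` X `&` \bigcap_(i in [set` ext t J]) upd t B C A i); last first.
    by rewrite f3 -/H; apply/seteqP; split => w /= [];
      [move=> [? [? ?]] ?|move=> ? [[? ?] ?]].
  rewrite (_ : Y @^-1` (X `*` (B `*` C)) =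
     chain t @^-1` X `&` \bigcap_(i in [set` ext t fset0]) upd t B C A i); last first.
    rewrite g3 set_fset0 bigcap_set0 setIT; apply/seteqP; split => w /= [];
      by [move=> ? [? ?]|move=> ? [? ?]].
  rewrite E1 E2 f4 g4 big_seq_fset0 mule1 -PJ.
  by rewrite [RHS]muleC -!muleA.
have -> : chain t.+1 @^-1` D = Y @^-1` ((fun p : E * (U * Xi) => phi t p.1 p.2) @^-1` D) by [].
rewrite -PJ key// -[_ @^-1` D]setTI; exact: phi_meas.
Qed.

(** The state and the noise of step t have a product law, so the noise can be
    integrated with the state held fixed. *)
Lemma chain_expectation t (h : E * (U * Xi) -> \bar R) : (t < T)%N ->
  measurable_fun setT h -> (forall p, 0 <= h p)%E ->
  (\int[P]_w h (chain t w, (u t w, xi t w)) =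
   \int[P]_w \int[distribution P (u t) \x distribution P (xi t)]_p
     h (chain t w, p))%E.
Proof.
move=> tT mh h0.
pose Y w := (chain t w, (u t w, xi t w)).
have mc := measurable_chain t.
have mY : measurable_fun setT Y.
  by apply: measurable_fun_pair => //; exact: measurable_fun_pair.
pose X : {mfun W >-> E} := HB.pack (chain t) (isMeasurableFun.Build _ _ _ _ _ mc).
pose nu : probability (U * Xi)%type R :=
  (distribution P (u t) \x distribution P (xi t))%E.
have law F : measurable F ->
    pushforward P Y F = (distribution P X \x nu)%E F.
  move=> mF.
  apply: (@eq_measure_rectangles3 _ _ _ _ _ _ _ (pushforward P Y)
    (distribution P X \x nu)%E) => //.
    change (P setT < +oo)%E; by rewrite probability_setT ltry.
  move=> A B C mA mB mC.
  rewrite [RHS](product_measure1E (distribution P X) nu mA (measurableX mB mC)).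
  rewrite [X in (_ * X)%E](product_measure1E (distribution P (u t)) (distribution P (xi t)) mB mC).
  have noJ : [set` (fset0 : {fset (nat + nat)})] `<=` future t.+1 by move=> k /=; rewrite inE.
  have noA i : i \in (fset0 : {fset (nat + nat)}) -> sys i ((fun=> setT) i) by rewrite inE.
  have [g1 g2 g3 g4] := ext_facts tT noJ mB mC noA.
  have := chain_independent (ltnW tT) g1 g2 mA.
  rewrite g3 g4 set_fset0 bigcap_set0 setIT big_seq_fset0 mule1 => <-.
  by congr (P _); apply/seteqP; split => w /= [].
transitivity (\int[pushforward P Y]_y h y)%E.
  by rewrite ge0_integral_pushforward.
rewrite (eq_measure_integral (distribution P X \x nu)%E); last by move=> A mA _; exact: law.
rewrite fubini_tonelli1// ge0_integral_pushforward//.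
- exact: measurable_fun_fubini_tonelli_F.
- by move=> x _; apply: integral_ge0.
Qed.

End markov_chain.

(** * One step of the potential *)

Section potential.
Context {R : realType} {d : nat} {dX : measure_display} {Xi : measurableType dX}.
Variables (gam : probability 'rV[R]_d R) (Q : probability Xi R).
Variables (f : 'rV[R]_d -> R) (F : 'rV[R]_d -> Xi -> R).
Variables (G : 'rV[R]_d -> Xi -> 'rV[R]_d) (xstar : 'rV[R]_d).
Variables (L mu sigma t0 alpha : R).
Implicit Types (x : 'rV[R]_d) (p : 'rV[R]_d * Xi).

Definition zo_step (t : nat) x p : 'rV[R]_d :=
  x - step_size mu t0 t p.1 *: two_point_estimator (F^~ p.2) alpha x p.1.

Hypothesis gam_normal : std_gaussian_law gam.
Hypothesis d_gt0 : (0 < d)%N.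
Hypothesis mu_gt0 : 0 < mu.
Hypothesis mu_le_L : mu <= L.
Hypothesis sigma_gt0 : 0 < sigma.
Hypothesis alpha_gt0 : 0 < alpha.
Hypothesis xstar_min : forall x, f xstar <= f x.
Hypothesis f_sc : smooth_strongly_convex L mu f.
Hypothesis F_meas : measurable_fun setT (fun y : 'rV[R]_d * Xi => F y.1 y.2).
Hypothesis F_lip : {ae Q, forall s, lipschitz_gradient L (F^~ s) /\
                   forall x, G x s = grad (F^~ s) x}.
Hypothesis G_mean : forall x i, has_mean Q (fun s => G x s 0 i) (grad f x 0 i).
Hypothesis G_expR : forall x lambda, 0 < lambda < sigma ^- 2 ->
    ('E_Q[fun s => expR (lambda * enorm (grad f x - G x s) ^+ 2)]
       <= (expR (lambda * sigma ^+ 2))%:E)%E.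

Let L_gt0 : 0 < L. Proof. exact: lt_le_trans mu_le_L. Qed.

Let dR : 0 < d%:R :> R. Proof. by rewrite ltr0n. Qed.

Lemma measurable_zo_step t :
  measurable_fun setT (fun y : 'rV[R]_d * ('rV[R]_d * Xi) => zo_step t y.1 y.2).
Proof.
pose Y := ('rV[R]_d * ('rV[R]_d * Xi))%type.
have mx : measurable_fun setT (fun y : Y => y.1) by exact: measurable_fst.
have mp : measurable_fun setT (fun y : Y => y.2) by exact: measurable_snd.
have mv : measurable_fun setT (fun y : Y => y.2.1).
  exact: (measurableT_comp measurable_fst mp).
have ms : measurable_fun setT (fun y : Y => y.2.2).
  exact: (measurableT_comp measurable_snd mp).
have mF (c : R) : measurable_fun setT (fun y : Y => F (y.1 + c *: y.2.1) y.2.2).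
  have m1 : measurable_fun setT (fun y : Y => (y.1 + c *: y.2.1, y.2.2)).
    apply: measurable_fun_pair => //; apply: measurable_addr => //.
    by apply: measurable_scaler => //; exact: measurable_cst.
  exact: (measurableT_comp F_meas m1).
have E (y : Y) : zo_step t y.1 y.2 = y.1
    + (- (4 * d%:R) * (mu * (t%:R + t0) * dotp y.2.1 y.2.1)^-1
       * ((F (y.1 + alpha *: y.2.1) y.2.2 - F (y.1 + (- alpha) *: y.2.1) y.2.2)
          * (2 * alpha)^-1)) *: y.2.1.
  rewrite /zo_step /two_point_estimator /step_size scalerA -scaleNr -enorm_sqr.
  by rewrite !scaleNr !mulNr scaleNr.
under eq_fun do rewrite E.
apply: measurable_addr => //; apply: measurable_scaler => //.
apply: measurable_funM; last first.
  apply: measurable_funM; last exact: measurable_cst.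
  by apply: measurable_funB; exact: mF.
apply: measurable_funM; first exact: measurable_cst.
apply: (measurableT_comp (@measurable_invr R)).
apply: measurable_funM; first exact: measurable_cst.
exact: measurable_dotp.
Qed.

(** The logarithm lies below its tangent, so an upper bound on the increment of
    z is enough; the slope q / (B + z) is what keeps every exponent bounded
    when z is large. *)
Lemma ln_step (q B z z' : R) : 0 < q -> 0 < B -> 0 <= z -> 0 <= z' ->
  q * ln (B + z') <= q * ln (B + z) + q / (B + z) * (z' - z).
Proof.
move=> q0 B0 z0 z0'.
have h : 0 < B + z by rewrite ltr_wpDr.
have h' : 0 < B + z' by rewrite ltr_wpDr.
have e : B + z' = (B + z) * (1 + (z' - z) / (B + z)) by field; rewrite gt_eqF.
have pos : 0 < 1 + (z' - z) / (B + z).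
  by rewrite -(pmulr_rgt0 _ h) -e.
rewrite [in X in X <= _]e lnM ?posrE// mulrDr lerD2l -mulrA ler_wpM2l ?(ltW q0)//.
rewrite [(B + z)^-1 * _]mulrC; apply: le_ln1Dx; lra.
Qed.

(** With k = q / (B + w D), the exponents of one_step_integral are small for two
    different reasons: k D <= q / w limits the drift, and k <= q / B limits the
    noise and the bias. *)
Lemma potential_step t x (w q B : R) :
  w = t%:R + t0 -> 32 * d%:R * L / mu <= w ->
  0 < q -> 120 * (16 * q) <= w -> 0 < B ->
  160 * (q * d%:R * sigma ^+ 2 / mu) <= B ->
  100 * (q / B * (d%:R ^+ 2 / mu) * L ^+ 2 * alpha ^+ 2) <= 1 / 4 ->
  (\int[gam \x Q]_p
     (expR (q * ln (B + (w + 1) * (f (zo_step t x p) - f xstar))))%:E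
   <= (expR (60 * (q / B * (d%:R * L * sigma ^+ 2 / mu ^+ 2) / w)
             + 50 * (q / B * (d%:R ^+ 2 / mu) * L ^+ 2 * alpha ^+ 2))
      * expR (q * ln (B + w * (f x - f xstar))))%:E)%E.
Proof.
move=> wE wL q0 qw B0 Bq sB.
set D := f x - f xstar.
have D0 : 0 <= D by rewrite subr_ge0.
have d1 : 1 <= d%:R :> R by rewrite ler1n.
have w4 : 32 <= w.
  apply: le_trans wL; rewrite ler_pdivlMr// -mulrA ler_wpM2l//.
  by rewrite -[leLHS]mul1r ler_pM// ltW.
have w0 : 0 < w by apply: lt_le_trans w4; rewrite ltr0n.
have BZ : 0 < B + w * D by rewrite ltr_wpDr// mulr_ge0// ltW.
pose k := q / (B + w * D).
have k0 : 0 < k by rewrite divr_gt0.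
have kB : k <= q / B.
  by rewrite ler_pM2l// lef_pV2 ?posrE// lerDl mulr_ge0// ltW.
have kD : w * (k * D) <= q.
  have -> : w * (k * D) = q * ((w * D) / (B + w * D)) by rewrite /k; ring.
  by rewrite -[leRHS]mulr1 ler_wpM2l ?(ltW q0)// ler_pdivrMr// mul1r lerDr ltW.
pose a := 4 * d%:R / (mu * w).
have a0 : 0 < a by rewrite divr_gt0// mulr_gt0.
pose A := (w + 1) * a.
have A0 : 0 < A by rewrite mulr_gt0// addr_gt0.
have dm : 0 < d%:R / mu by rewrite divr_gt0.
have AE : A = 4 * (d%:R / mu) * (1 + w^-1) by rewrite /A /a; field; rewrite !gt_eqF.
have A4 : 4 * d%:R / mu <= A.
  have -> : 4 * d%:R / mu = 4 * (d%:R / mu) * 1 by ring.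
  rewrite AE; apply: ler_wpM2l; first by apply: mulr_ge0 => //; exact: ltW.
  by rewrite lerDl invr_ge0 ltW.
have A5 : A <= 5 * (d%:R / mu).
  have wi : w^-1 <= 1 / 4 by rewrite ler_pdivlMr// mulrC ler_pdivrMr//; lra.
  have := ler_wpM2l (ltW dm) wi; rewrite AE; lra.
have qB : 0 < q / B by rewrite divr_gt0.
have kA : k * A <= 5 * (q / B * (d%:R / mu)).
  have := ler_pM (ltW k0) (ltW A0) kB A5; lra.
have s2 : 0 < sigma ^+ 2 by rewrite exprn_gt0.
pose e := q / B * (d%:R / mu) * sigma ^+ 2.
have e160 : 160 * e <= 1.
  have -> : 160 * e = 160 * (q * d%:R * sigma ^+ 2 / mu) / B.
    by rewrite /e; field; rewrite !gt_eqF.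
  by rewrite ler_pdivrMr// mul1r.
have c1 : 32 * (k * A) * sigma ^+ 2 <= 1.
  apply: le_trans e160; have := ler_wpM2r (ltW s2) kA; rewrite /e; lra.
pose h := d%:R * L / (mu * w).
have h0 : 0 < h by rewrite divr_gt0// mulr_gt0.
have h32 : h <= 1 / 32.
  rewrite /h ler_pdivrMr ?mulr_gt0//; move: wL; rewrite ler_pdivrMr//; lra.
have k3E : 6 * k * A * L * a * sigma ^+ 2 = 24 * h * (k * A * sigma ^+ 2).
  by rewrite /h /a; field; rewrite !gt_eqF.
have kAs : k * A * sigma ^+ 2 <= 5 * e.
  have := ler_wpM2r (ltW s2) kA; rewrite /e; lra.
have kAs0 : 0 <= k * A * sigma ^+ 2 by apply: mulr_ge0; [apply: mulr_ge0|]; exact: ltW.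
have k3 : 6 * k * A * L * a * sigma ^+ 2 <= 120 * (h * e).
  by rewrite k3E; have := ler_wpM2l (ltW h0) kAs; lra.
have e0 : 0 < e by apply: mulr_gt0 => //; apply: mulr_gt0.
have c2 : 6 * k * A * L * a * sigma ^+ 2 <= 1 / 2.
  by apply: le_trans k3 _; have := ler_wpM2r (ltW e0) h32; lra.
have La0 : 0 <= L ^+ 2 * alpha ^+ 2 * d%:R.
  by apply: mulr_ge0; [apply: mulr_ge0; exact: sqr_ge0|exact: ltW].
have s4 : 20 * k * A * L ^+ 2 * alpha ^+ 2 * d%:R <=
    100 * (q / B * (d%:R ^+ 2 / mu) * L ^+ 2 * alpha ^+ 2).
  have := ler_wpM2r La0 kA.
  have -> : 5 * (q / B * (d%:R / mu)) * (L ^+ 2 * alpha ^+ 2 * d%:R) =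
    5 * (q / B * (d%:R ^+ 2 / mu) * L ^+ 2 * alpha ^+ 2) by ring.
  by lra.
have c3 := le_trans s4 sB.
pose g := grad f x; pose N s := G x s - g.
have N_mean i : has_mean Q (fun s => N s 0 i) 0.
  have -> : (fun s => N s 0 i) = (fun s => G x s 0 i + - g 0 i).
    by apply/funext => s; rewrite /N mxE; congr (_ + _); rewrite mxE.
  rewrite -(subrr (g 0 i)).
  apply: (@has_meanD _ _ _ _ _ (fun=> - g 0 i)); first exact: G_mean.
  exact: has_mean_cst.
have N_expR l : 0 < l < sigma ^- 2 ->
    (\int[Q]_s (expR (l * dotp (N s) (N s)))%:E <= (expR (l * sigma ^+ 2))%:E)%E.
  move=> /(G_expR x); rewrite unlock => H.
  under eq_integral => s _.
    rewrite (_ : dotp (N s) (N s) = enorm (grad f x - G x s) ^+ 2); last first.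
      by rewrite enorm_sqr /N -opprB dotpNl dotpNr opprK.
    over.
  exact: H.
have gD : 2 * mu * D <= dotp g g by exact: polyak_lojasiewicz f_sc.
have kD120 : 16 * (k * D) <= 120^-1.
  rewrite -div1r ler_pdivlMr// -(ler_pM2l w0).
  have -> : w * (16 * (k * D) * 120) = 120 * (16 * (w * (k * D))) by ring.
  by rewrite mulr1; apply: le_trans qw; lra.
have main := one_step_integral gam_normal d_gt0 sigma_gt0 mu_gt0 L_gt0
  (alpha := alpha) N_mean N_expR D0 k0 A0 a0 gD kD120 A4 c1 c2 c3.
pose bd p := D + A * (- (3 / 4 * (dotp g p.1 ^+ 2 * (dotp p.1 p.1)^-1))
      - dotp g p.1 * dotp (N p.2) p.1 * (dotp p.1 p.1)^-1
      + 3 / 2 * L * a * (dotp (N p.2) p.1 ^+ 2 * (dotp p.1 p.1)^-1)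
      + 5 * (L ^+ 2 * alpha ^+ 2 * dotp p.1 p.1)).
have mN : measurable_fun setT N.
  by apply: measurable_fun_rV => i; exact: has_mean_measurable (N_mean i).
have mf : measurable_fun setT f.
  by apply: continuous_measurable_rV; exact: smooth_strongly_convex_continuous f_sc.
have mE1 : measurable_fun setT (fun p : 'rV[R]_d * Xi =>
    expR (q * ln (B + (w + 1) * (f (zo_step t x p) - f xstar)))).
  apply: (measurableT_comp (@measurable_expR R)).
  apply: measurable_funM; first exact: measurable_cst.
  apply: (measurableT_comp (@measurable_ln R)).
  apply: measurable_funD; first exact: measurable_cst.
  apply: measurable_funM; first exact: measurable_cst.
  apply: measurable_funB; last exact: measurable_cst.
  apply: (measurableT_comp mf).
  have m1 : measurable_fun setT (fun p : 'rV[R]_d * Xi => (x, p)).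
    by apply: measurable_fun_pair; [exact: measurable_cst|exact: measurable_id].
  exact: (measurableT_comp (measurable_zo_step t) m1).
have mE2 : measurable_fun setT (fun p => expR (k * bd p)).
  have m1 : measurable_fun setT (fun p : 'rV[R]_d * Xi => p.1) by exact: measurable_fst.
  have m2 : measurable_fun setT (fun p : 'rV[R]_d * Xi => N p.2).
    exact: (measurableT_comp mN measurable_snd).
  have m3 : measurable_fun setT (fun p : 'rV[R]_d * Xi => dotp p.1 p.1) by exact: measurable_dotp.
  have m4 : measurable_fun setT (fun p : 'rV[R]_d * Xi => dotp g p.1).
    by apply: measurable_dotp => //; exact: measurable_cst.
  have m5 : measurable_fun setT (fun p : 'rV[R]_d * Xi => dotp (N p.2) p.1) by exact: measurable_dotp.
  have m6 : measurable_fun setT (fun p : 'rV[R]_d * Xi => (dotp p.1 p.1)^-1).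
    exact: (measurableT_comp (@measurable_invr R) m3).
  apply: (measurableT_comp (@measurable_expR R)); rewrite /bd.
  apply: measurable_funM; first exact: measurable_cst.
  apply: measurable_funD; first exact: measurable_cst.
  apply: measurable_funM; first exact: measurable_cst.
  apply: measurable_funD; last by mfun.
  apply: measurable_funD; last by mfun.
  apply: measurable_funB; last by mfun.
  apply: (@measurable_funN _ _ _ setT (fun p => 3 / 4 * (dotp g p.1 ^+ 2 * (dotp p.1 p.1)^-1))).
  by mfun.
apply: (@le_trans _ _ (\int[gam \x Q]_p
    (expR (q * ln (B + w * D)) * expR (k * bd p))%:E)%E).
  apply: ae_ge0_le_integral.
  - by [].
  - by move=> p _; rewrite lee_fin expR_ge0.
  - exact/measurable_EFinP.
  - by move=> p _; rewrite lee_fin mulr_ge0 ?expR_ge0.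
  - by apply/measurable_EFinP; apply: measurable_funM => //; exact: measurable_cst.
  have [S [mS S0 badS]] := F_lip.
  exists ([set: 'rV[R]_d] `*` S); split; first exact: measurableX.
    rewrite [LHS](product_measure1E gam Q measurableT mS).
    by rewrite [X in (_ * X)%E](_ : _ = 0%E) ?mule0; last exact: S0.
  move=> [v s] bad; split=> //=; apply: badS => good; apply: bad => _ /=.
  case: good => lipF gF.
  rewrite lee_fin -expRD ler_expR.
  have D0' : 0 <= f (zo_step t x (v, s)) - f xstar by rewrite subr_ge0.
  have w1 : 0 < w + 1 by rewrite addr_gt0.
  apply: le_trans (ln_step q0 B0 (mulr_ge0 (ltW w0) D0) (mulr_ge0 (ltW w1) D0')) _.
  rewrite lerD2l -/k ler_wpM2l ?(ltW k0)//.
  have := descent_step x v mu_gt0 mu_le_L alpha_gt0 d_gt0 wE wL f_sc lipF.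
  rewrite -(gF x) -/g -/(N s) -/a -[X in f X]/(zo_step t x (v, s)) => H.
  have {}H : f (zo_step t x (v, s)) - f xstar <= D + a * (- (3 / 4 * (dotp g v ^+ 2 * (dotp v v)^-1))
      - dotp g v * dotp (N s) v * (dotp v v)^-1
      + 3 / 2 * L * a * (dotp (N s) v ^+ 2 * (dotp v v)^-1)
      + 5 * (L ^+ 2 * alpha ^+ 2 * dotp v v)).
    rewrite /D; apply: (@le_trans _ _ (_ - f xstar)); first by rewrite lerD2r; exact: H.
    by rewrite le_eqVlt; apply/orP; left; apply/eqP; ring.
  have {}H := ler_wpM2l (ltW w1) H.
  rewrite lerBlDr; apply: le_trans H _; rewrite /bd /A /=.
  by rewrite le_eqVlt; apply/orP; left; apply/eqP; ring.
rewrite integral_realZ; [|exact: expR_ge0|by []|by move=> p; exact: expR_ge0].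
apply: (@le_trans _ _ ((expR (q * ln (B + w * D)))%:E * (expR (60 * (q / B * (d%:R * L * sigma ^+ 2 / mu ^+ 2) / w)
             + 50 * (q / B * (d%:R ^+ 2 / mu) * L ^+ 2 * alpha ^+ 2)))%:E)%E); last first.
  by rewrite -EFinM mulrC.
rewrite lee_wpmul2l ?lee_fin ?expR_ge0//; apply: le_trans main _.
rewrite lee_fin ler_expR; apply: lerD; last first.
  by rewrite ler_pdivrMr//; apply: le_trans s4 _; rewrite le_eqVlt; apply/orP; left; apply/eqP; ring.
rewrite ler_pdivrMr ?mulr_gt0//; apply: le_trans k3 _.
by rewrite le_eqVlt; apply/orP; left; apply/eqP; rewrite /h /e; field; rewrite !gt_eqF.
Qed.

End potential.

(** * A maximal inequality for the scaled gap *)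

Section maximal_inequality.
Context {R : realType} {d : nat}.
Context {dW : measure_display} {W : measurableType dW} (P : probability W R).
Context {dX : measure_display} {Xi : measurableType dX} (Q : probability Xi R).
Variables (T : nat) (f : 'rV[R]_d -> R) (F : 'rV[R]_d -> Xi -> R).
Variables (G : 'rV[R]_d -> Xi -> 'rV[R]_d) (x0 xstar : 'rV[R]_d).
Variables (u : nat -> {RV P >-> 'rV[R]_d}) (xi : nat -> {RV P >-> Xi}).
Variables (L mu sigma t0 alpha q B M delta : R).
Implicit Types (x : 'rV[R]_d).

Hypothesis d_gt0 : (0 < d)%N.
Hypothesis mu_gt0 : 0 < mu.
Hypothesis mu_le_L : mu <= L.
Hypothesis sigma_gt0 : 0 < sigma.
Hypothesis alpha_gt0 : 0 < alpha.
Hypothesis xstar_min : forall x, f xstar <= f x.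
Hypothesis f_sc : smooth_strongly_convex L mu f.
Hypothesis F_mean : forall x, has_mean Q (F x) (f x).
Hypothesis F_lip : {ae Q, forall s, lipschitz_gradient L (F^~ s) /\
                   forall x, G x s = grad (F^~ s) x}.
Hypothesis G_mean : forall x i, has_mean Q (fun s => G x s 0 i) (grad f x 0 i).
Hypothesis G_expR : forall x lambda, 0 < lambda < sigma ^- 2 ->
    ('E_Q[fun s => expR (lambda * enorm (grad f x - G x s) ^+ 2)]
       <= (expR (lambda * sigma ^+ 2))%:E)%E.
Hypothesis u_normal : forall t, (t < T)%N -> std_gaussian_law (distribution P (u t)).
Hypothesis xi_law : forall t, (t < T)%N ->
    forall A, measurable A -> distribution P (xi t) A = Q A.
Hypothesis indep : mutually_independent P
    [set k : nat + nat | match k with inl t => t < T | inr t => t < T end]%N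
    (fun k => match k with inl t => sigma_of (u t) | inr t => sigma_of (xi t) end).

Hypothesis t0_ge : 32 * d%:R * L / mu <= t0.
Hypothesis q_gt0 : 0 < q.
Hypothesis q_le : 120 * (16 * q) <= t0.
Hypothesis B_gt0 : 0 < B.
Hypothesis B_ge : 160 * (q * d%:R * sigma ^+ 2 / mu) <= B.
Hypothesis alpha_le :
  100 * (q / B * (d%:R ^+ 2 / mu) * L ^+ 2 * alpha ^+ 2) <= 1 / 4.
Hypothesis M_ge0 : 0 <= M.

Let t0_gt0 : 0 < t0.
Proof.
have L0 : 0 < L by apply: lt_le_trans mu_le_L.
by apply: lt_le_trans t0_ge; rewrite divr_gt0// !mulr_gt0// ltr0n.
Qed.

Definition scaled_gap (t : nat) x : R := (t%:R + t0) * (f x - f xstar).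

Definition growth (t : nat) : R :=
  60 * (q / B * (d%:R * L * sigma ^+ 2 / mu ^+ 2) / (t%:R + t0))
  + 50 * (q / B * (d%:R ^+ 2 / mu) * L ^+ 2 * alpha ^+ 2).

Hypothesis M_ge : \sum_(t < T) growth t + q * ln (B + scaled_gap 0 x0) + ln (delta^-1)
  <= q * ln (B + M).
Hypothesis delta_gt0 : 0 < delta.

Let mf : measurable_fun setT f.
Proof. by apply: continuous_measurable_rV; exact: smooth_strongly_convex_continuous f_sc. Qed.

Lemma scaled_gap_ge0 t x : 0 <= scaled_gap t x.
Proof. by rewrite mulr_ge0 ?subr_ge0// addr_ge0// ltW. Qed.

Let measurable_scaled_gap t : measurable_fun setT (scaled_gap t).
Proof.
apply: measurable_funM; first exact: measurable_cst.
by apply: measurable_funB => //; exact: measurable_cst.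
Qed.

Lemma growth_ge0 t : 0 <= growth t.
Proof.
have L0 : 0 < L by apply: lt_le_trans mu_le_L.
have tt : 0 <= t%:R + t0 by rewrite addr_ge0// ltW.
have dR : 0 <= d%:R :> R by [].
by rewrite /growth; nonneg.
Qed.

(** Truncating the gap at M makes the potential of the frozen process bounded,
    and M is the level at which the process is frozen. *)
Definition potential (t : nat) x : R :=
  expR (q * ln (B + Num.min (scaled_gap t x) M)).

Let measurable_potential t : measurable_fun setT (potential t).
Proof.
apply: (measurableT_comp (@measurable_expR R)).
apply: measurable_funM; first exact: measurable_cst.
apply: (measurableT_comp (@measurable_ln R)).
apply: measurable_funD; first exact: measurable_cst.
by apply: measurable_minr => //; exact: measurable_cst.
Qed.

Section measurable_version.
Variable F' : 'rV[R]_d -> Xi -> R.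
Hypothesis F'_meas : measurable_fun setT (fun y : 'rV[R]_d * Xi => F' y.1 y.2).
Hypothesis F'_lip : {ae Q, forall s, lipschitz_gradient L (F'^~ s) /\
                   forall x, G x s = grad (F'^~ s) x}.

(** Once the gap exceeds M the iterate is kept: the gap at a fixed point only
    grows with t, so exceeding M at some time is the same as exceeding M at
    time T. *)
Definition frozen_step (t : nat) x (p : 'rV[R]_d * Xi) : 'rV[R]_d :=
  if M < scaled_gap t x then x else zo_step F' mu t0 alpha t x p.

Lemma measurable_frozen_step t :
  measurable_fun setT (fun y : 'rV[R]_d * ('rV[R]_d * Xi) => frozen_step t y.1 y.2).
Proof.
have mx : measurable_fun setT (fun y : 'rV[R]_d * ('rV[R]_d * Xi) => y.1).
  exact: measurable_fst.
apply: measurable_fun_ifT => //.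
  apply: measurable_fun_ltr; first exact: measurable_cst.
  exact: (measurableT_comp (measurable_scaled_gap t) mx).
exact: measurable_zo_step.
Qed.

Let frozen := chain u xi frozen_step x0.

Lemma scaled_gap_mono t x : scaled_gap t x <= scaled_gap t.+1 x.
Proof. by rewrite ler_wpM2r ?subr_ge0// lerD2r ler_nat. Qed.

Let ln_mono y z : 0 < y -> y <= z -> expR (q * ln y) <= expR (q * ln z).
Proof.
move=> y0 yz; rewrite ler_expR ler_wpM2l ?(ltW q_gt0)// ler_ln// posrE//.
exact: lt_le_trans yz.
Qed.

Lemma frozen_potential t x : (t < T)%N ->
  (\int[distribution P (u t) \x Q]_p (potential t.+1 (frozen_step t x p))%:E
   <= (expR (growth t) * potential t x)%:E)%E.
Proof.
move=> tT; have [exc|exc] := ltP M (scaled_gap t x).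
  under eq_integral do rewrite /frozen_step exc.
  rewrite integral_real_cst lee_fin /potential.
  have exc' := lt_le_trans exc (scaled_gap_mono t x).
  rewrite !min_r ?(ltW exc) ?(ltW exc')//.
  rewrite -[leLHS]mul1r ler_wpM2r ?expR_ge0// -expR0 ler_expR.
  exact: growth_ge0.
have wL : 32 * d%:R * L / mu <= t%:R + t0 by apply: le_trans t0_ge _; rewrite lerDr.
have wq : 120 * (16 * q) <= t%:R + t0 by apply: le_trans q_le _; rewrite lerDr.
have step := potential_step (u_normal tT) d_gt0 mu_gt0 mu_le_L sigma_gt0 alpha_gt0
  xstar_min f_sc F'_meas F'_lip G_mean G_expR x erefl wL q_gt0 wq B_gt0 B_ge alpha_le.
have mstep : measurable_fun setT (fun p : 'rV[R]_d * Xi => zo_step F' mu t0 alpha t x p).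
  have m1 : measurable_fun setT (fun p : 'rV[R]_d * Xi => (x, p)).
    by apply: measurable_fun_pair; [exact: measurable_cst|exact: measurable_id].
  exact: (measurableT_comp (measurable_zo_step mu t0 alpha F'_meas t) m1).
under eq_integral do rewrite /frozen_step ltNge exc /=.
rewrite /potential (min_l exc).
apply: le_trans step; apply: le_integral_real.
- exact: (measurableT_comp (measurable_potential t.+1) mstep).
- apply: (measurableT_comp (@measurable_expR R)).
  apply: measurable_funM; first exact: measurable_cst.
  apply: (measurableT_comp (@measurable_ln R)).
  apply: measurable_funD; first exact: measurable_cst.
  apply: measurable_funM; first exact: measurable_cst.
  apply: measurable_funB; last exact: measurable_cst.
  exact: (measurableT_comp mf mstep).
- by move=> p; exact: expR_ge0.
- move=> p; apply: ln_mono.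
    by rewrite ltr_wpDr// le_min scaled_gap_ge0.
  rewrite lerD2l; apply: (@le_trans _ _ (scaled_gap t.+1 (zo_step F' mu t0 alpha t x p))).
    by rewrite ge_min lexx.
  by rewrite /scaled_gap -natr1 addrAC.
Qed.

Lemma frozen_expectation t : (t <= T)%N ->
  (\int[P]_w (potential t (frozen t w))%:E
   <= (expR (\sum_(s < t) growth s) * potential 0 x0)%:E)%E.
Proof.
elim: t => [_|t IH tT].
  by rewrite big_ord0 expR0 mul1r /frozen/= integral_real_cst.
pose h (y : 'rV[R]_d * ('rV[R]_d * Xi)) := (potential t.+1 (frozen_step t y.1 y.2))%:E.
have mh : measurable_fun setT h.
  apply/measurable_EFinP.
  exact: (measurableT_comp (measurable_potential t.+1) (measurable_frozen_step t)).
have h0 y : (0 <= h y)%E by rewrite lee_fin expR_ge0.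
have mfr := measurable_chain u xi x0 measurable_frozen_step t.
rewrite [leLHS](chain_expectation x0 measurable_frozen_step indep tT mh h0).
pose nu : probability ('rV[R]_d * Xi)%type R :=
  (distribution P (u t) \x distribution P (xi t))%E.
rewrite -/nu.
have mH : measurable_fun setT (fun x => \int[nu]_p h (x, p))%E.
  exact: (measurable_fun_fubini_tonelli_F (m2 := nu) h mh h0).
apply: (@le_trans _ _ (\int[P]_w (expR (growth t) * potential t (frozen t w))%:E)%E).
  apply: ge0_le_integral => //.
  - by move=> w _; apply: integral_ge0.
  - exact: (measurableT_comp mH mfr).
  - apply/measurable_EFinP; apply: measurable_funM; first exact: measurable_cst.
    exact: (measurableT_comp (measurable_potential t) mfr).
  move=> w _; apply: le_trans (frozen_potential (frozen t w) tT).
  rewrite (eq_measure_integral (distribution P (u t) \x Q)%E)//.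
  move=> A mA _; apply: eq_measure_rectangles => //.
    by apply: le_lt_trans (ltry 1); exact: (probability_le1 nu measurableT).
  move=> X Y mX mY.
  rewrite [LHS](product_measure1E (distribution P (u t)) (distribution P (xi t)) mX mY).
  rewrite [RHS](product_measure1E (distribution P (u t)) Q mX mY).
  by congr (_ * _)%E; exact: xi_law.
rewrite integral_realZ; [|exact: expR_ge0| |by move=> w; exact: expR_ge0]; last first.
  exact: (measurableT_comp (measurable_potential t) mfr).
apply: (@le_trans _ _ ((expR (growth t))%:E * (expR (\sum_(s < t) growth s) * potential 0 x0)%:E)%E).
  by rewrite lee_wpmul2l ?lee_fin ?expR_ge0//; exact: IH (ltnW tT).
by rewrite -EFinM mulrA -expRD big_ord_recr/= addrC.
Qed.

Definition exceed : set W := [set w | M < scaled_gap T (frozen T w)].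

Lemma measurable_exceed : measurable exceed.
Proof.
have mfr := measurable_chain u xi x0 measurable_frozen_step T.
have m1 : measurable_fun setT (fun w => scaled_gap T (frozen T w)).
  exact: (measurableT_comp (measurable_scaled_gap T) mfr).
rewrite (_ : exceed = (fun w => scaled_gap T (frozen T w)) @^-1` `]M, +oo[%classic).
  by rewrite -[_ @^-1` _]setTI; exact: m1.
by apply/seteqP; split=> w /=; rewrite in_itv/= andbT.
Qed.

(** Markov's inequality at the single time T; freezing has turned the supremum
    over time into a terminal value. *)
Lemma exceed_le : (P exceed <= delta%:E)%E.
Proof.
have mfr := measurable_chain u xi x0 measurable_frozen_step T.
have mE := measurable_exceed.
pose c := expR (q * ln (B + M)).
have c0 : 0 < c by exact: expR_gt0.
have markov : (c%:E * P exceed <= \int[P]_w (potential T (frozen T w))%:E)%E.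
  have -> : P exceed = (\int[P]_w (\1_exceed w)%:E)%E.
    by rewrite integral_indic// setIT.
  rewrite -integral_realZ//; last exact: ltW.
  apply: le_integral_real.
  - by apply: measurable_funM => //; exact: measurable_cst.
  - exact: (measurableT_comp (measurable_potential T) mfr).
  - by move=> w; rewrite mulr_ge0// ltW.
  move=> w; rewrite indicE; case: (boolP (w \in exceed)) => [|_].
    by rewrite inE mulr1 /potential /exceed/= => ex; rewrite min_r ?(ltW ex).
  by rewrite mulr0 expR_ge0.
have {}markov := le_trans markov (frozen_expectation (leqnn T)).
rewrite -(@lee_pmul2l _ c%:E)//; apply: le_trans markov _.
rewrite -EFinM lee_fin.
apply: (@le_trans _ _ (expR (\sum_(t < T) growth t + q * ln (B + scaled_gap 0 x0)))).
  rewrite expRD ler_wpM2l ?expR_ge0//; apply: ln_mono.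
    by rewrite ltr_wpDr// le_min scaled_gap_ge0.
  by rewrite lerD2l ge_min lexx.
have -> : c * delta = expR (q * ln (B + M) - ln (delta^-1)).
  by rewrite expRD lnV ?posrE// opprK lnK// posrE.
by rewrite ler_expR lerBrDr.
Qed.

Lemma frozen_until w : ~ exceed w -> forall k, (k <= T)%N ->
  scaled_gap k (frozen k w) <= M /\
  frozen k w = zo_sgd F' mu t0 alpha x0 (fun t => u t w) (fun t => xi t w) k.
Proof.
move=> nex.
have below k : (k <= T)%N -> scaled_gap k (frozen k w) <= M.
  move=> kT; rewrite leNgt; apply/negP => exc; apply: nex; rewrite /exceed/=.
  have : forall n, M < scaled_gap (k + n) (frozen (k + n) w).
    elim=> [|n IHn]; first by rewrite addn0.
    rewrite addnS; apply: (lt_le_trans IHn).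
    have := scaled_gap_mono (k + n) (frozen (k + n) w).
    move=> /le_trans; apply.
    rewrite [X in _ <= scaled_gap _ X](_ : _ = frozen (k + n) w)//.
    by rewrite /frozen /= /frozen_step IHn.
  by move=> /(_ (T - k)%N); rewrite subnKC.
move=> k kT; split; first exact: below.
elim: k kT => [//|k IHk kT].
have := below k (ltnW kT); rewrite leNgt => /negbTE nexc.
rewrite /= -(IHk (ltnW kT)) /frozen /= /frozen_step.
by rewrite -/frozen nexc.
Qed.

End measurable_version.

(** Each F^~ s is differentiable only for almost every s; setting F to 0 on a
    null set of samples makes it a Caratheodory function and changes the
    iterates with probability 0 only. *)
Lemma sgd_uniform_bound :
  with_prob_at_least P (1 - delta) [set w | forall k, (k <= T)%N ->
    scaled_gap k (zo_sgd F mu t0 alpha x0 (fun t => u t w) (fun t => xi t w) k) <= M].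
Proof.
have [S [mS S0 badS]] := F_lip.
have goodS s : ~ S s -> lipschitz_gradient L (F^~ s) /\ forall x, G x s = grad (F^~ s) x.
  by move=> nS; apply: contrapT => bad; apply: nS; exact: badS.
pose F' x s := F x s * \1_(~` S) s.
have F'E s : ~ S s -> F'^~ s = F^~ s.
  move=> nS; apply/funext => x; rewrite /F' indicE.
  by rewrite (_ : s \in ~` S) ?mulr1// inE.
have F'_lip : {ae Q, forall s, lipschitz_gradient L (F'^~ s) /\
                   forall x, G x s = grad (F'^~ s) x}.
  exists S; split => // s /= bad; apply: contrapT => nS; apply: bad.
  by rewrite F'E//; exact: goodS.
have F'_meas : measurable_fun setT (fun y : 'rV[R]_d * Xi => F' y.1 y.2).
  apply: measurable_caratheodory => [x|s].
    apply: measurable_funM; first exact: has_mean_measurable (F_mean x).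
    by apply: measurable_indic; exact: measurableC.
  have [Ss|nS] := pselect (S s).
    have -> : F'^~ s = cst 0.
      apply/funext => x; rewrite /F' indicE.
      by rewrite (_ : (s \in ~` S) = false) ?mulr0//; apply/negbTE; rewrite notin_setE => /(_ Ss).
    by move=> x; exact: cst_continuous.
  by rewrite F'E// => x; apply: differentiable_continuous; have [[]] := goodS s nS.
pose bad := \bigcup_t (if (t < T)%N then xi t @^-1` S else set0).
have mex := measurable_exceed F'_meas.
have mbad : measurable bad.
  apply: bigcupT_measurable => t; case: ifP => // _; exact: measurable_funPTI.
have PS t : (t < T)%N -> P (xi t @^-1` S) = 0%E.
  by move=> tT; rewrite -[LHS]/(distribution P (xi t) S) xi_law.
exists (~` (exceed F' `|` bad)); first split.
- by apply: measurableC; exact: measurableU.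
- move=> w wA k kT /=.
  have [|b e] := @frozen_until F' w _ k kT; first by move=> ex; apply: wA; left.
  rewrite (_ : zo_sgd F _ _ _ _ _ _ k = zo_sgd F' mu t0 alpha x0 (fun t => u t w) (fun t => xi t w) k).
    by rewrite -e.
  elim: k kT {b e} => [//|k IHk kT] /=.
  rewrite (IHk (ltnW kT)) F'E// => Sw; apply: wA; right.
  by exists k => //; rewrite kT.
rewrite probability_setC; last exact: measurableU.
have -> : P (exceed F' `|` bad) = P (exceed F').
  apply/eqP; rewrite eq_le; apply/andP; split; last first.
    apply: le_measure; rewrite ?inE//; exact: measurableU.
  apply: le_trans (measureU2 _ _ _) _ => //.
  rewrite [X in (_ + X)%E](_ : _ = 0%E) ?adde0//.
  apply: measure_negligible => //; apply: negligible_bigcup => t.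
  case: ifP => [tT|_]; last exact: negligible_set0.
  by apply/negligibleP; [exact: measurable_funPTI|exact: PS].
by rewrite EFinB; apply: leeB => //; exact: exceed_le.
Qed.

End maximal_inequality.

(** * The choice of constants *)

Section constants.
Context {R : realType}.
Variables (d T : nat) (L mu sigma delta : R).
Hypothesis T_ge1 : (1 <= T)%N.
Hypothesis delta01 : 0 < delta < 1.
Hypothesis d_ge2 : (2 <= d)%N.
Hypothesis mu_gt0 : 0 < mu.
Hypothesis mu_le_L : mu <= L.
Hypothesis sigma_gt0 : 0 < sigma.

Let K : R := 5 * 100.
(** 2 const_C = 16 * 120 is the ratio between t0 and the largest exponent of the
    potential for which the drift can be integrated. *)
Definition const_C : R := 8 * 120.
Definition const_abs : R := 8 * (5 * 100).

Lemma const_C_gt0 : 0 < const_C.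
Proof. by rewrite /const_C mulr_gt0. Qed.

Lemma const_abs_ge1 : 1 <= const_abs.
Proof. by rewrite /const_abs; lra. Qed.

Let const_abs_gt0 : 0 < const_abs.
Proof. exact: lt_le_trans const_abs_ge1. Qed.

Let t0 := T0 d L mu.
Let Lam := Lambda T t0.
Let Gam := Gamma T t0 delta.
Let E := expR (2 * const_C / t0 * Gam).

Lemma expR_quarter : expR (4^-1) <= 4 / 3 :> R.
Proof.
have := expR_ge1Dx (- 4^-1 : R); rewrite expRN => h.
have e0 := expR_gt0 (4^-1 : R).
have : (expR 4^-1)^-1 * expR 4^-1 = 1 :> R by rewrite mulVf// gt_eqF.
have := ler_wpM2r (ltW e0) h; lra.
Qed.

Let L_gt0 : 0 < L. Proof. exact: lt_le_trans mu_le_L. Qed.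

Let d_ge2R : 2 <= d%:R :> R. Proof. by rewrite (ler_nat R 2). Qed.

Let T_ge1R : 1 <= T%:R :> R. Proof. by rewrite (ler_nat R 1). Qed.

Let t0E : t0 = 32 * (d%:R * (L / mu)). Proof. by rewrite /t0 /T0; ring. Qed.

Let Lmu : 1 <= L / mu. Proof. by rewrite ler_pdivlMr// mul1r. Qed.

Lemma t0_ge64 : 64 <= t0.
Proof.
have h : 2 * 1 <= d%:R * (L / mu) by apply: ler_pM.
by rewrite t0E; lra.
Qed.

Let t0_gt0 : 0 < t0. Proof. by apply: lt_le_trans t0_ge64; rewrite ltr0n. Qed.

Lemma Lambda_ge1 : 1 <= Lam.
Proof.
have e3 : expR 1 <= 4 :> R.
  have -> : expR 1 = expR 4^-1 ^+ 4 :> R by rewrite -expRM_natl; congr expR; field.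
  apply: (@le_trans _ _ ((4 / 3) ^+ 4)); last by lra.
  by rewrite lerXn2r ?nnegrE ?expR_ge0 ?expR_quarter.
rewrite -[leLHS]expRK /Lam /Lambda ler_ln ?posrE ?expR_gt0//.
  by apply: le_trans e3 _; have := t0_ge64; have := T_ge1R; lra.
by have := t0_ge64; have := T_ge1R; lra.
Qed.

Lemma ln_inv_delta_ge0 : 0 <= ln delta^-1.
Proof. by case/andP: delta01 => d0 d1; rewrite ln_ge0// invf_ge1 ?ltW. Qed.

Lemma Gamma_ge : 1 + ln delta^-1 <= Gam.
Proof.
have J : 0 <= ln (JT T t0).
  rewrite ln_ge0// /JT lerDl ler0z -(@ceil0 R) le_ceil//.
  apply: divr_ge0; last by rewrite ln_ge0// ler1n.
  rewrite ln_ge0// ler_pdivlMr// mul1r.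
  have := t0_ge64; have := T_ge1R; nra.
have e : 0 <= ln (expR 1 + t0).
  by rewrite ln_ge0//; have := expR_gt0 (1 : R); have := t0_ge64; lra.
rewrite /Gam /Gamma; lra.
Qed.

Lemma Gamma_ge1 : 1 <= Gam.
Proof. by have := Gamma_ge; have := ln_inv_delta_ge0; lra. Qed.

Lemma expR_Gamma_ge1 : 1 <= E.
Proof.
rewrite /E -[leLHS]expR0 ler_expR; apply: mulr_ge0; last by have := Gamma_ge1; lra.
apply: divr_ge0; last exact: ltW.
by have := const_C_gt0; lra.
Qed.

(** The bound 1/w <= ln w - ln (w - 1) makes the harmonic sum telescope. *)
Lemma sum_inv_le (n : nat) : \sum_(t < n) (t%:R + t0)^-1 <= ln (n%:R + t0).
Proof.
have t64 := t0_ge64.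
apply: (@le_trans _ _ (ln (n%:R + t0 - 1))); last first.
  have n0 : 0 <= n%:R :> R by [].
  by rewrite ler_ln ?posrE; lra.
elim: n => [|n IH]; first by rewrite big_ord0 ln_ge0// add0r; lra.
rewrite big_ord_recr/=.
have n0 : 0 <= n%:R :> R by [].
set w := n%:R + t0 in IH *.
have w0 : 1 < w by rewrite /w; lra.
have wi : w^-1 < 1 by rewrite invf_lt1//; lra.
have -> : n.+1%:R + t0 - 1 = w by rewrite /w -natr1; ring.
apply: le_trans (lerD IH (lexx _)) _.
have -> : w - 1 = w * (1 + - w^-1) by field; rewrite gt_eqF//; lra.
rewrite lnM ?posrE; [|lra|lra].
have := @le_ln1Dx R (- w^-1); rewrite ltrN2 => /(_ wi); lra.
Qed.

Let V := d%:R * L * sigma ^+ 2 / mu ^+ 2.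
Let H := d%:R * L ^+ 2 / mu.

(** A large exponent q makes the cost delta^(-1/q) of the confidence level
    small, and Gam is large enough for this cost to be a constant; the drift
    limits q to a multiple of t0. *)
Definition potential_exponent : R := Num.min (t0 / (16 * 120)) Gam.

(** V is the scale of the noise in the scaled gap and H that of the smoothing
    bias. The factor Lam accounts for the harmonic sum of the noise over time
    and Gam for the exponent q of the potential, so that the potential grows by
    at most the factor exp (q / 4). *)
Definition potential_offset : R := K * (V * (Lam + Gam)) + K * H.

Local Notation q := potential_exponent.
Local Notation B := potential_offset.
Let alpha := smoothing_radius d t0 T.

Let dR : 0 < d%:R :> R. Proof. by have := d_ge2R; lra. Qed.

Let V_gt0 : 0 < V.
Proof. by rewrite divr_gt0 ?exprn_gt0// !mulr_gt0// exprn_gt0. Qed.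

Let H_gt0 : 0 < H.
Proof. by rewrite divr_gt0// mulr_gt0// exprn_gt0. Qed.

Lemma potential_exponent_gt0 : 0 < q.
Proof.
rewrite lt_min; apply/andP; split; last by have := Gamma_ge1; lra.
by rewrite divr_gt0// mulr_gt0.
Qed.

Lemma potential_exponent_le : 120 * (16 * q) <= t0.
Proof.
have : q <= t0 / (16 * 120) by rewrite ge_min lexx.
by rewrite ler_pdivlMr ?mulr_gt0//; lra.
Qed.

Let q_le_Gam : q <= Gam. Proof. by rewrite ge_min lexx orbT. Qed.

Lemma potential_offset_gt0 : 0 < B.
Proof.
have := Lambda_ge1; have := Gamma_ge1 => h1 h2.
have : 0 < V * (Lam + Gam) by rewrite mulr_gt0//; lra.
by have := H_gt0; rewrite /B /K; lra.
Qed.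

Let B_geVL : K * (V * Lam) + K * H <= B.
Proof.
have h : 0 <= V * Gam by apply: mulr_ge0; [exact: ltW|have := Gamma_ge1; lra].
by rewrite /B /K; lra.
Qed.

Lemma potential_offset_ge_noise : 160 * (q * d%:R * sigma ^+ 2 / mu) <= B.
Proof.
set y := d%:R * sigma ^+ 2 / mu.
have y0 : 0 < y by rewrite divr_gt0// mulr_gt0// exprn_gt0.
have yV : y <= V.
  have -> : V = y * (L / mu) by rewrite /V /y; field; rewrite gt_eqF.
  by rewrite -[leLHS]mulr1 ler_wpM2l// ltW.
have -> : q * d%:R * sigma ^+ 2 / mu = q * y by rewrite /y; ring.
have qV : q * y <= V * Gam.
  by rewrite mulrC; apply: ler_pM => //; apply: ltW => //; exact: potential_exponent_gt0.
have := Lambda_ge1 => h1; have := H_gt0 => h2.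
have : 0 <= V * Lam by apply: mulr_ge0; [exact: ltW|lra].
have : 0 <= V * Gam by apply: mulr_ge0; [exact: ltW|have := Gamma_ge1; lra].
by rewrite /B /K; lra.
Qed.

Lemma smoothing_radius_gt0 : 0 < alpha.
Proof. by rewrite invr_gt0 sqrtr_gt0 mulr_gt0// addr_gt0//; have := T_ge1R; lra. Qed.

Lemma smoothing_bias : d%:R ^+ 2 / mu * L ^+ 2 * alpha ^+ 2 = H / (T%:R + t0).
Proof.
have TT : 0 < T%:R + t0 by rewrite addr_gt0//; have := T_ge1R; lra.
rewrite /alpha /smoothing_radius exprVn sqr_sqrtr; last by apply: mulr_ge0; exact: ltW.
by rewrite /H; field; rewrite !gt_eqF.
Qed.

Lemma smoothing_bias_small :
  100 * (q / B * (d%:R ^+ 2 / mu) * L ^+ 2 * alpha ^+ 2) <= 1 / 4.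
Proof.
have TT : 0 < T%:R + t0 by rewrite addr_gt0//; have := T_ge1R; lra.
have -> : q / B * (d%:R ^+ 2 / mu) * L ^+ 2 * alpha ^+ 2 =
  (H / B) * (q / (T%:R + t0)).
  rewrite (_ : q / B * (d%:R ^+ 2 / mu) * L ^+ 2 * alpha ^+ 2 =
    q / B * (d%:R ^+ 2 / mu * L ^+ 2 * alpha ^+ 2)); last by ring.
  by rewrite smoothing_bias; ring.
have h1 : H / B <= 1.
  rewrite ler_pdivrMr ?potential_offset_gt0// mul1r; apply: le_trans B_geVL.
  have : 0 <= V * Lam by apply: mulr_ge0; [exact: ltW|have := Lambda_ge1; lra].
  by have := H_gt0; rewrite /K; lra.
have h2 : q / (T%:R + t0) <= 1 / (4 * 100).
  rewrite ler_pdivrMr//; have := potential_exponent_le; have := T_ge1R; have := potential_exponent_gt0; lra.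
have h0 : 0 <= q / (T%:R + t0) by apply: divr_ge0; apply: ltW => //; exact: potential_exponent_gt0.
have h3 : 0 <= H / B by apply: divr_ge0; apply: ltW => //; exact: potential_offset_gt0.
have := ler_pM h3 h0 h1 h2; lra.
Qed.

Lemma sum_growth_le :
  \sum_(t < T) growth (d := d) L mu sigma t0 alpha q B t <= q / 4.
Proof.
have B0 := potential_offset_gt0; have q0 := potential_exponent_gt0.
have TT : 0 < T%:R + t0 by rewrite addr_gt0//; have := T_ge1R; lra.
rewrite /growth big_split/=.
rewrite (eq_bigr (fun t : 'I_T => 60 * (q / B * V) * (t%:R + t0)^-1)); last first.
  by move=> t _; rewrite /V; ring.
rewrite -mulr_sumr sumr_const card_ord.
have -> : 50 * (q / B * (d%:R ^+ 2 / mu) * L ^+ 2 * alpha ^+ 2) *+ T =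
    50 * (q / B * H) * (T%:R / (T%:R + t0)).
  rewrite -[LHS]mulr_natr.
  rewrite (_ : q / B * (d%:R ^+ 2 / mu) * L ^+ 2 * alpha ^+ 2 =
    q / B * (d%:R ^+ 2 / mu * L ^+ 2 * alpha ^+ 2)); last by ring.
  by rewrite smoothing_bias; ring.
have qB0 : 0 <= q / B by apply: divr_ge0; exact: ltW.
have h1 : 60 * (q / B * V) * \sum_(t < T) (t%:R + t0)^-1 <= 60 * (q / B * V) * Lam.
  rewrite ler_wpM2l//; first by apply: mulr_ge0 => //; apply: mulr_ge0 => //; exact: ltW.
  exact: sum_inv_le.
have h2 : 50 * (q / B * H) * (T%:R / (T%:R + t0)) <= 50 * (q / B * H) * 1.
  rewrite ler_wpM2l//; first by apply: mulr_ge0 => //; apply: mulr_ge0 => //; exact: ltW.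
  by rewrite ler_pdivrMr// mul1r lerDl ltW.
have h3 : q / B * (K * (V * Lam) + K * H) <= q.
  rewrite -[leRHS](divfK (lt0r_neq0 B0)) ler_wpM2l//; exact: B_geVL.
have h4 : 0 <= q / B * (V * Lam).
  apply: mulr_ge0 => //; apply: mulr_ge0; [exact: ltW|have := Lambda_ge1; lra].
have h5 : 0 <= q / B * H by apply: mulr_ge0 => //; exact: ltW.
by move: h3; rewrite /K; lra.
Qed.

Let S := 1 + L ^+ 2 / mu + L ^+ 3 / mu ^+ 2.

Variables (Delta0 : R).
Hypothesis Delta0_ge0 : 0 <= Delta0.

Let cC := calC const_C const_abs d T L mu sigma delta Delta0.
Let Th := Theta T t0 delta.
Let cr := c_rho const_C T t0 delta.
Let cd := c_delta T t0 delta.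

Let crE : cr = 2 * E. Proof. by []. Qed.

(** The solution M of q ln (B + M) = q ln (B + t0 Delta0) + q / 4 + ln (1/delta):
    the initial potential, its growth and the confidence level. *)
Definition level : R := (B + t0 * Delta0) * expR (ln delta^-1 / q + 4^-1) - B.

Lemma level_ge : B + level = (B + t0 * Delta0) * expR (ln delta^-1 / q + 4^-1).
Proof. by rewrite /level subrKC. Qed.

Let Z_ge0 : 0 <= t0 * Delta0. Proof. by apply: mulr_ge0 => //; exact: ltW. Qed.

Lemma level_ge0 : 0 <= level.
Proof.
rewrite /level subr_ge0 -[leLHS]mulr1; apply: ler_pM => //.
- exact: ltW potential_offset_gt0.
- by rewrite lerDl.
- rewrite -[leLHS]expR0 ler_expR addr_ge0//; apply: divr_ge0; [exact: ln_inv_delta_ge0|].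
  exact: ltW potential_exponent_gt0.
Qed.

Lemma level_growth :
  \sum_(t < T) growth (d := d) L mu sigma t0 alpha q B t
    + q * ln (B + t0 * Delta0) + ln delta^-1 <= q * ln (B + level).
Proof.
have B0 := potential_offset_gt0; have q0 := potential_exponent_gt0.
rewrite level_ge lnM ?posrE ?expR_gt0//; last by rewrite ltr_pwDl.
rewrite expRK !mulrDr mulrCA mulfV ?mulr1 ?gt_eqF//.
by have := sum_growth_le; lra.
Qed.

(** When the min in q is t0 / 1920, the confidence level costs the factor
    exp (1920 Gam / t0), which is c_rho / 2; when it is Gam, the cost is at most
    exp 1. *)
Lemma level_le : level <= 9 / 2 * E * (B + t0 * Delta0).
Proof.
have B0 := potential_offset_gt0; have q0 := potential_exponent_gt0.
have BZ : 0 <= B + t0 * Delta0 by rewrite addr_ge0// ltW.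
apply: (@le_trans _ _ ((B + t0 * Delta0) * expR (ln delta^-1 / q + 4^-1))).
  by rewrite -level_ge lerDr ltW.
rewrite [leRHS]mulrC ler_wpM2l//.
have lq : ln delta^-1 / q <= 1 + 2 * const_C / t0 * Gam.
  have G1 := Gamma_ge1; have G := Gamma_ge; have l0 := ln_inv_delta_ge0.
  have e0 : 0 <= 2 * const_C / t0 * Gam.
    by apply: mulr_ge0; [apply: divr_ge0; [have := const_C_gt0; lra|exact: ltW]|lra].
  have [->|->] : q = t0 / (16 * 120) \/ q = Gam.
    by rewrite /q /Num.min; case: ifP; [left|right].
    rewrite ler_pdivrMr ?divr_gt0 ?mulr_gt0// mulrDl mul1r; have -> : 2 * const_C / t0 * Gam * (t0 / (16 * 120)) = Gam.
      by rewrite /const_C; field; rewrite gt_eqF.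
    have : 0 <= t0 / (16 * 120) by apply: divr_ge0; [exact: ltW|lra].
    by lra.
  rewrite ler_pdivrMr; last by lra.
  by rewrite mulrDl mul1r; have := mulr_ge0 e0 (le_trans ler01 G1); lra.
apply: (@le_trans _ _ (expR (5%:R * 4^-1 + 2 * const_C / t0 * Gam))).
  by rewrite ler_expR; lra.
rewrite expRD -/E ler_wpM2r ?expR_ge0// expRM_natl.
apply: (@le_trans _ _ ((4 / 3) ^+ 5)); last by lra.
by rewrite lerXn2r ?nnegrE ?expR_ge0 ?expR_quarter.
Qed.

Let LG : 0 < Lam * Gam.
Proof. by rewrite mulr_gt0//; [have := Lambda_ge1|have := Gamma_ge1]; lra. Qed.

Let cd_ge0 : 0 <= cd.
Proof. by apply: divr_ge0; [have := Gamma_ge1|have := Lambda_ge1]; rewrite -/Gam -/Lam; lra. Qed.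

(** The initial gap is absorbed by the first entry of the maximum, the noise
    V (Lam + Gam) <= 2 V Lam Gam by the second and the bias H by the last. *)
Lemma level_le_calC : level <= cC * d%:R * Th.
Proof.
have E1 := expR_Gamma_ge1; have L1 := Lambda_ge1; have G1 := Gamma_ge1.
have dTh : 0 < d%:R * Th by rewrite mulr_gt0.
apply: le_trans level_le _; rewrite -mulrA.
pose b1 := 8 * cr * t0 * Delta0 / (d%:R * Th).
pose b2 := const_abs * L * sigma ^+ 2 * cr ^+ 2 / mu ^+ 2 * (1 + cd / t0).
pose b4 := const_abs * cr * (1 + cd) / Gam * S.
have c1 : b1 <= cC by rewrite /cC /calC le_max lexx.
have c2 : b2 <= cC by rewrite /cC /calC !le_max lexx !orbT.
have c4 : b4 <= cC by rewrite /cC /calC !le_max lexx !orbT.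
have B1 : b1 * (d%:R * Th) = 16 * E * (t0 * Delta0).
  by rewrite /b1 crE divfK ?gt_eqF//; ring.
have V0 := V_gt0; have H0 := H_gt0.
have EV : E * V <= E * E * V.
  by rewrite -mulrA ler_wpM2l//; [lra|rewrite -[leLHS]mul1r ler_wpM2r// ltW].
have B2 : 4 * const_abs * (E * V) * (Lam * Gam) <= b2 * (d%:R * Th).
  have -> : b2 * (d%:R * Th) = 4 * const_abs * (E * E * V) * (1 + cd / t0) * (Lam * Gam).
    by rewrite /b2 crE /V /Th /Theta -/Lam -/Gam; field; rewrite !gt_eqF.
  rewrite ler_wpM2r ?(ltW LG)//.
  have c0 : 0 <= cd / t0 by apply: divr_ge0 => //; exact: ltW.
  have k0 : 0 <= 4 * const_abs * (E * E * V).
    by apply: mulr_ge0; [have := const_abs_gt0; lra|apply: mulr_ge0; [nra|exact: ltW]].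
  apply: (@le_trans _ _ (4 * const_abs * (E * E * V) * 1)); last by rewrite ler_wpM2l// lerDl.
  by rewrite mulr1 ler_wpM2l// /const_abs; lra.
have B4 : 2 * const_abs * (E * H) * (Lam + Gam) <= b4 * (d%:R * Th).
  have -> : b4 * (d%:R * Th) = 2 * const_abs * E * d%:R * S * (Lam + Gam).
    rewrite /b4 crE /Th /Theta /cd /c_delta -/Lam -/Gam; field.
    by rewrite !gt_eqF//; lra.
  rewrite ler_wpM2r//; first by lra.
  have -> : 2 * const_abs * (E * H) = 2 * const_abs * E * d%:R * (L ^+ 2 / mu) by rewrite /H; ring.
  rewrite ler_wpM2l//.
    apply: mulr_ge0; last exact: ltW.
    by apply: mulr_ge0; have := const_abs_gt0; lra.
  have : 0 <= L ^+ 3 / mu ^+ 2 by apply: divr_ge0; rewrite exprn_ge0// ltW.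
  by rewrite /S; lra.
have dTh' := ltW dTh.
have m1 := ler_wpM2r dTh' c1; have m2 := ler_wpM2r dTh' c2; have m4 := ler_wpM2r dTh' c4.
have EV0 : 0 <= E * V by apply: mulr_ge0; [lra|exact: ltW].
have EH0 : 0 <= E * H by apply: mulr_ge0; [lra|exact: ltW].
have LGs : Lam + Gam <= 2 * (Lam * Gam) by nra.
have n2 := ler_wpM2l EV0 LGs.
have n4 : E * H <= (E * H) * (Lam + Gam) by rewrite -[leLHS]mulr1 ler_wpM2l//; lra.
have EZ : 0 <= E * (t0 * Delta0) by apply: mulr_ge0 => //; lra.
have -> : 9 / 2 * (E * (B + t0 * Delta0)) =
  9 / 2 * K * ((E * V) * (Lam + Gam)) + 9 / 2 * K * (E * H) + 9 / 2 * (E * (t0 * Delta0)).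
  by rewrite /B; ring.
have EVLG : 0 <= (E * V) * (Lam * Gam) by apply: mulr_ge0 => //; exact: ltW.
rewrite -mulrA in m1 m2 m4 *.
move: B2 B4 m1 m2 m4; rewrite /const_abs /K; lra.
Qed.

Definition big_O_const : R :=
  8 + 3 * const_abs * (L * sigma ^+ 2 / mu ^+ 2)
  + 2 * const_abs * (1 + L ^+ 2 / mu + L ^+ 3 / mu ^+ 2).

Lemma calC_big_O : cC * (d%:R * Th / (T%:R + t0)) <=
  big_O_const * (cr * t0 * Delta0 / (T%:R + t0)
    + cr ^+ 2 * (d%:R * Lam * Gam / (T%:R + t0)) * (1 + Gam / t0)).
Proof.
have E1 := expR_Gamma_ge1; have L1 := Lambda_ge1; have G1 := Gamma_ge1.
have TT : 0 < T%:R + t0 by rewrite addr_gt0//; have := T_ge1R; lra.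
have dTh : 0 < d%:R * Th by rewrite mulr_gt0.
have cr2 : 2 <= cr by rewrite crE; lra.
pose X := cr * t0 * Delta0.
pose Y := cr ^+ 2 * (d%:R * Lam * Gam) * (1 + Gam / t0).
have -> : cr * t0 * Delta0 / (T%:R + t0)
    + cr ^+ 2 * (d%:R * Lam * Gam / (T%:R + t0)) * (1 + Gam / t0) = (X + Y) / (T%:R + t0).
  by rewrite /X /Y; ring.
rewrite [leRHS]mulrA [leLHS]mulrA ler_wpM2r ?invr_ge0 ?(ltW TT)//.
have X0 : 0 <= X by rewrite /X -mulrA; apply: mulr_ge0 => //; lra.
have Gt : 0 <= Gam / t0 by apply: divr_ge0; [lra|exact: ltW].
pose y := cr * (d%:R * Lam * Gam).
have dLG : 0 < d%:R * Lam * Gam by rewrite -mulrA mulr_gt0.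
have y0 : 0 <= y by apply: mulr_ge0; [lra|exact: ltW].
have yY : y <= Y.
  have -> : Y = y * (cr * (1 + Gam / t0)) by rewrite /Y /y; ring.
  by rewrite -[leLHS]mulr1 ler_wpM2l//; nra.
have Y0 := le_trans y0 yY.
pose v := L * sigma ^+ 2 / mu ^+ 2.
have v0 : 0 < v by rewrite divr_gt0 ?exprn_gt0// mulr_gt0// exprn_gt0.
have S0 : 1 <= S.
  have : 0 <= L ^+ 2 / mu by apply: divr_ge0; [exact: sqr_ge0|exact: ltW].
  have : 0 <= L ^+ 3 / mu ^+ 2 by apply: divr_ge0; rewrite exprn_ge0// ltW.
  by rewrite /S; lra.
have cdG : cd <= Gam.
  rewrite /cd /c_delta -/Gam -/Lam ler_pdivrMr; last by lra.
  by rewrite -[leLHS]mulr1 ler_wpM2l//; lra.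
have big : forall z : R, 0 <= z <= 8 * X + 3 * const_abs * v * Y + 2 * const_abs * S * Y ->
    z <= big_O_const * (X + Y).
  move=> z /andP[_ zz]; apply: le_trans zz _.
  rewrite /big_O_const -/v -/S.
  have p1 : 0 <= 3 * const_abs * v by apply: mulr_ge0; [have := const_abs_gt0; lra|exact: ltW].
  have p2 : 0 <= 2 * const_abs * S by apply: mulr_ge0; [have := const_abs_gt0; lra|lra].
  have := mulr_ge0 p1 X0; have := mulr_ge0 p2 X0; lra.
have p1 : 0 <= const_abs * v * Y.
  by apply: mulr_ge0 => //; apply: mulr_ge0; [have := const_abs_gt0; lra|exact: ltW].
have p2 : 0 <= const_abs * S * Y.
  by apply: mulr_ge0 => //; apply: mulr_ge0; [have := const_abs_gt0; lra|lra].
apply: (@le_trans _ _ (8 * X + 3 * const_abs * v * Y + 2 * const_abs * S * Y)); last first.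
  by apply: big; rewrite lexx andbT; lra.
rewrite -ler_pdivlMr// /cC /calC !ge_max; apply/and4P; split; rewrite ler_pdivlMr//.
- rewrite -/t0 -/Th -/cr divfK ?gt_eqF//.
  have -> : 8 * cr * t0 * Delta0 = 8 * X by rewrite /X; ring.
  by lra.
- have -> : const_abs * L * sigma ^+ 2 * c_rho const_C T (T0 d L mu) delta ^+ 2 / mu ^+ 2
      * (1 + c_delta T (T0 d L mu) delta / T0 d L mu) * (d%:R * Th)
    = const_abs * v * (cr ^+ 2 * (d%:R * Lam * Gam)) * (1 + cd / t0).
    by rewrite /v /Th /Theta -/t0 -/Lam -/Gam -/cr -/cd; ring.
  have h : 1 + cd / t0 <= 1 + Gam / t0.
    by rewrite lerD2l ler_wpM2r// invr_ge0 ltW.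
  have k0 : 0 <= const_abs * v * (cr ^+ 2 * (d%:R * Lam * Gam)).
    apply: mulr_ge0; first by apply: mulr_ge0; [have := const_abs_gt0; lra|exact: ltW].
    by apply: mulr_ge0; [exact: sqr_ge0|exact: ltW].
  have := ler_wpM2l k0 h; rewrite -[_ * _ * (1 + Gam / t0)]mulrA -/Y; lra.
- have -> : const_abs * L * c_rho const_C T (T0 d L mu) delta * sigma ^+ 2
      / (mu ^+ 2 * Gamma T (T0 d L mu) delta)
      * (1 + d%:R * c_delta T (T0 d L mu) delta / T0 d L mu) * (d%:R * Th)
    = const_abs * v * (cr * (d%:R * Lam)) * (1 + d%:R * cd / t0).
    rewrite /v /Th /Theta -/t0 -/Lam -/Gam -/cr -/cd; field.
    by rewrite !gt_eqF//; lra.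
  have h : 1 + d%:R * cd / t0 <= 2 * Gam.
    have : d%:R * cd / t0 <= cd.
      rewrite mulrAC -[leRHS]mul1r ler_wpM2r// ler_pdivrMr// mul1r t0E.
      have : d%:R * 1 <= d%:R * (L / mu) by rewrite ler_wpM2l// ltW.
      by have := dR; lra.
    by lra.
  have k0 : 0 <= const_abs * v * (cr * (d%:R * Lam)).
    apply: mulr_ge0; first by apply: mulr_ge0; [have := const_abs_gt0; lra|exact: ltW].
    by apply: mulr_ge0; [lra|apply: mulr_ge0; [exact: ltW|lra]].
  have k1 : 0 <= const_abs * v by apply: mulr_ge0; [have := const_abs_gt0; lra|exact: ltW].
  apply: le_trans (ler_wpM2l k0 h) _.
  have -> : const_abs * v * (cr * (d%:R * Lam)) * (2 * Gam) = 2 * (const_abs * v * y) by rewrite /y; ring.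
  have := ler_wpM2l k1 yY; lra.
- have -> : const_abs * c_rho const_C T (T0 d L mu) delta
      * (1 + c_delta T (T0 d L mu) delta) / Gamma T (T0 d L mu) delta
      * (1 + L ^+ 2 / mu + L ^+ 3 / mu ^+ 2) * (d%:R * Th)
    = const_abs * S * (cr * (d%:R * Lam)) * (1 + cd).
    rewrite /Th /Theta -/t0 -/Lam -/Gam -/cr -/cd -/S; field.
    by rewrite gt_eqF//; lra.
  have k1 : 0 <= const_abs * S by apply: mulr_ge0; [have := const_abs_gt0; lra|lra].
  have k0 : 0 <= const_abs * S * (cr * (d%:R * Lam)).
    apply: mulr_ge0 => //.
    by apply: mulr_ge0; [lra|apply: mulr_ge0; [exact: ltW|lra]].
  have h : 1 + cd <= 2 * Gam by lra.
  apply: le_trans (ler_wpM2l k0 h) _.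
  have -> : const_abs * S * (cr * (d%:R * Lam)) * (2 * Gam) = 2 * (const_abs * S * y) by rewrite /y; ring.
  have := ler_wpM2l k1 yY; lra.
Qed.

End constants.

Theorem theorem1 (R : realType) :
  exists (C Cabs : R) (bigO : R -> R -> R -> R),
  [/\ 0 < C, 1 <= Cabs &
  forall (dW : measure_display) (W : measurableType dW) (P : probability W R)
    (dX : measure_display) (Xi : measurableType dX) (Q : probability Xi R)
    (d T : nat) (delta L mu sigma : R)
    (f : 'rV[R]_d -> R) (F : 'rV[R]_d -> Xi -> R)
    (G : 'rV[R]_d -> Xi -> 'rV[R]_d)
    (x0 xstar : 'rV[R]_d)
    (u : nat -> {RV P >-> 'rV[R]_d}) (xi : nat -> {RV P >-> Xi}),
  (1 <= T)%N -> 0 < delta < 1 -> (2 <= d)%N ->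
  0 < mu -> mu <= L -> 0 < sigma ->
  unique_minimizer f xstar ->
  x0 <> xstar ->
  (* f(x) = E_xi[f(x; xi)], where Q is the law of xi *)
  (forall x, has_mean Q (F x) (f x)) ->
  smooth_strongly_convex L mu f ->
  (* G is a jointly measurable version of (x, xi) |-> grad f(x; xi) *)
  {ae Q, forall s, lipschitz_gradient L (F^~ s) /\
                   forall x, G x s = grad (F^~ s) x} ->
  measurable_fun [set: 'rV[R]_d * Xi] (fun p => G p.1 p.2) ->
  (forall x i, has_mean Q (fun s => G x s 0 i) (grad f x 0 i)) ->
  (forall x lambda, 0 < lambda < sigma ^- 2 ->
    ('E_Q[fun s => expR (lambda * enorm (grad f x - G x s) ^+ 2)]
       <= (expR (lambda * sigma ^+ 2))%:E)%E) ->
  (forall t, (t < T)%N -> std_gaussian_law (distribution P (u t))) ->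
  (forall t, (t < T)%N ->
    forall B, measurable B -> distribution P (xi t) B = Q B) ->
  (* u_0, xi_0, ..., u_(T-1), xi_(T-1) are mutually independent *)
  mutually_independent P
    [set k : nat + nat | match k with inl t => t < T | inr t => t < T end]%N
    (fun k => match k with inl t => sigma_of (u t) | inr t => sigma_of (xi t) end) ->
  let t0 := T0 d L mu in
  let alpha := smoothing_radius d t0 T in
  let x (t : nat) (w : W) :=
    zo_sgd F mu t0 alpha x0 (fun k => u k w) (fun k => xi k w) t in
  let Delta0 := f x0 - f xstar in
  let cC := calC C Cabs d T L mu sigma delta Delta0 in
  let E (K : nat) : set W :=
    [set w | forall k, (k <= K)%N ->
       f (x k w) - f xstar <= cC * d%:R * Theta T t0 delta / (k%:R + t0)] in
  let goodE : set W := \bigcap_(K in [set K | (K <= T)%N]) E K in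
  let cr := c_rho C T t0 delta in
  let Gam := Gamma T t0 delta in
  [/\ with_prob_at_least P (1 - delta) goodE,
      (forall w, goodE w ->
         f (x T w) - f xstar <= cC * (d%:R * Theta T t0 delta / (T%:R + t0))) &
      cC * (d%:R * Theta T t0 delta / (T%:R + t0)) <=
        bigO L mu sigma *
          (cr * t0 * Delta0 / (T%:R + t0)
           + cr ^+ 2 * (d%:R * Lambda T t0 * Gam / (T%:R + t0))
             * (1 + Gam / t0))]].

Proof.
exists const_C, const_abs, big_O_const; split; [exact: const_C_gt0|exact: const_abs_ge1|].
move=> dW W P dX Xi Q d T delta L mu sigma f F G x0 xstar u xi T_ge1 delta01 d_ge2
  mu_gt0 mu_le_L sigma_gt0 xstar_lt _ F_mean f_sc F_lip _ G_mean G_expR u_normal xi_law indep.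
move=> t0 alpha x Delta0 cC E goodE cr Gam.
have xstar_min y : f xstar <= f y.
  by have [->//|/eqP y_neq] := eqVneq y xstar; exact/ltW/xstar_lt.
have Delta0_ge0 : 0 <= Delta0 by rewrite /Delta0 subr_ge0.
have w_gt0 k : 0 < k%:R + t0.
  by apply: ltr_wpDl => //; apply: lt_le_trans (t0_ge64 d_ge2 mu_gt0 mu_le_L).
have goodE_final w : goodE w ->
    f (x T w) - f xstar <= cC * (d%:R * Theta T t0 delta / (T%:R + t0)).
  by move=> /(_ T (leqnn T))/(_ T (leqnn T)); rewrite !mulrA.
split => //; last exact: calC_big_O.
have d_gt0 : (0 < d)%N by exact: ltnW.
have gap0 : scaled_gap f xstar t0 0 x0 = t0 * Delta0 by rewrite /scaled_gap add0r.
have growth_le := level_growth T_ge1 delta01 d_ge2 mu_gt0 mu_le_L sigma_gt0 Delta0_ge0.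
rewrite -gap0 in growth_le.
have /andP[delta_gt0 _] := delta01.
have [A [mA Asub] PA] := sgd_uniform_bound d_gt0 mu_gt0 mu_le_L sigma_gt0
  (smoothing_radius_gt0 T_ge1 d_ge2 mu_gt0 mu_le_L) xstar_min f_sc F_mean F_lip G_mean G_expR
  u_normal xi_law indep (lexx t0)
  (potential_exponent_gt0 T_ge1 delta01 d_ge2 mu_gt0 mu_le_L) (potential_exponent_le d T L mu delta)
  (potential_offset_gt0 T_ge1 delta01 d_ge2 mu_gt0 mu_le_L sigma_gt0)
  (potential_offset_ge_noise T_ge1 delta01 d_ge2 mu_gt0 mu_le_L sigma_gt0)
  (smoothing_bias_small T_ge1 delta01 d_ge2 mu_gt0 mu_le_L sigma_gt0)
  (level_ge0 T_ge1 delta01 d_ge2 mu_gt0 mu_le_L sigma_gt0 Delta0_ge0)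
  growth_le delta_gt0.
exists A => //; split => // w /Asub w_le K /= KT k kK.
rewrite ler_pdivlMr// mulrC.
apply: le_trans (w_le k (leq_trans kK KT)) _.
exact: level_le_calC.
Qed.
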